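(* Let $\mathcal{G}_n$ be the number of graphical sequences $d_1\leqslant\cdots\leqslant d_n$ of length $n$, and let $\mathcal{T}_n$ be the number of rooted unlabeled (cyclically distinct) plane trees with $n$ edges. Then, as $n\to\infty$, \[ \frac{n^{3/4}}{4^{n-1}}\,\mathcal{G}_n\to\frac{e^{\omega}}{\Gamma(1/4)}, \qquad\text{where}\qquad \omega=\sum_{k=1}^\infty\frac{\mathcal{T}_k}{k4^k}. \]
   Context: A sequence of non-negative integers $d_1\leqslant\cdots\leqslant d_n$ is graphical if there is a (finite, simple, undirected) graph on $n$ vertices whose degrees, listed in non-decreasing order, are $d_1,\ldots,d_n$. So $\mathcal{G}_n$ counts unordered degree sequences of graphs on $n$ vertices. $\mathcal{T}_n$ ($n\geqslant1$) is the number of unlabeled plane trees with $n$ edges and a distinguished root vertex, where two such trees are identified if there is a root-preserving isomorphism preserving the cyclic order of edges around each vertex (in particular the subtrees at the root are only ordered cyclically). By Walkup's formula, \[ \mathcal{T}_n=\frac1n\sum_{d\mid n}\binom{2d-1}{d}\phi(n/d), \] where $\phi$ is Euler's totient function. For example, $\mathcal{T}_1=1$, $\mathcal{T}_2=2$, $\mathcal{T}_3=4$. $\Gamma(z)=\int_0^\infty t^{z-1}e^{-t}\,dt$ is the gamma function. *)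

(* Defs.v *)
(* MathComp and MathComp-Analysis. *)
From mathcomp Require Import all_boot all_order all_fingroup all_algebra.
From mathcomp Require Import all_classical all_reals all_analysis.

Set Implicit Arguments.
Unset Strict Implicit.
Unset Printing Implicit Defensive.

Import Order.TTheory GRing.Theory Num.Theory.
Import numFieldNormedType.Exports.

(* A graph on V is given by its set of arcs; each edge is present as two
   opposite arcs. *)
Section Graphs.
Variable V : finType.
Implicit Type E : {set V * V}.

Definition adj E : rel V := fun x y => (x, y) \in E.

Definition simple_graph E : Prop := symmetric (adj E) /\ irreflexive (adj E).

Definition neighbours E (v : V) : {set V} := [set w | adj E v w].

Definition degree E (v : V) : nat := #|neighbours E v|.

Definition degree_sequence E : seq nat := sort leq [seq degree E v | v : V].

Definition connected_graph E : Prop := forall x y, connect (adj E) x y.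

(* In a simple graph, the cyclic paths without repeated vertices of size at
   most 2 are the empty one and the two orientations of each edge. *)
Definition acyclic_graph E : Prop :=
  forall c : seq V, ucycle (adj E) c -> size c <= 2.

Definition tree_graph E : Prop :=
  [/\ simple_graph E, connected_graph E & acyclic_graph E].

End Graphs.

Definition graphical (n : nat) (d : seq nat) : Prop :=
  exists E : {set 'I_n * 'I_n}, simple_graph E /\ degree_sequence E = d.

Lemma graphical_bounded (n : nat) (d : seq nat) :
  graphical n d -> [/\ sorted leq d, size d = n & all (fun k => k < n) d].
Proof.
move=> [E [[_ Eirr] <-]]; split.
- exact/sort_sorted/leq_total.
- by rewrite size_sort size_map -cardE card_ord.
- rewrite all_sort; apply/allP => _ /mapP[v _ ->].
  rewrite -[X in _ < X]card_ord -cardsT; apply: proper_card.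
  by apply/properP; split; [exact: finset.subsetT | exists v; rewrite ?inE ?Eirr].
Qed.

(* By [graphical_bounded], entries may be taken in 'I_n. *)
Definition num_graphical (n : nat) : nat :=
  #|[pred d : n.-tuple 'I_n | `[< graphical n (map val d) >]]|.

(* A tree drawn in the plane is given by a rotation system: [rot P v] sends
   each neighbour of v to the next one in the cyclic order around v, and fixes
   all the other vertices, so that it is determined by that cyclic order. *)
Section PlaneTrees.
Variable V : finType.

Definition rooted_map : Type :=
  ({set V * V} * {ffun V -> {perm V}} * V)%type.

Definition arcs (P : rooted_map) : {set V * V} := P.1.1.
Definition rot (P : rooted_map) : {ffun V -> {perm V}} := P.1.2.
Definition root (P : rooted_map) : V := P.2.

Definition rotation_system (P : rooted_map) : Prop :=
  forall v, perm_on (neighbours (arcs P) v) (rot P v) /\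
    {in neighbours (arcs P) v,
      forall w, porbit (rot P v) w = neighbours (arcs P) v}.

Definition rooted_plane_tree (P : rooted_map) : Prop :=
  tree_graph (arcs P) /\ rotation_system P.

Definition plane_isomorphism (P Q : rooted_map) (s : {perm V}) : Prop :=
  [/\ s (root P) = root Q,
      forall v w, adj (arcs Q) (s v) (s w) = adj (arcs P) v w &
      forall v w, adj (arcs P) v w -> s (rot P v w) = rot Q (s v) (s w)].

Definition plane_isomorphic : rel rooted_map :=
  fun P Q => `[< exists s, plane_isomorphism P Q s >].

Lemma plane_isomorphic_equiv :
  {in [pred P | `[< rooted_plane_tree P >]] & &,
    equivalence_rel plane_isomorphic}.
Proof.
have sym P Q : plane_isomorphic P Q -> plane_isomorphic Q P.
  move=> /asboolP[s [sr sE sR]]; apply/asboolP; exists (s^-1)%g; split.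
  - by rewrite -sr permK.
  - by move=> v w; rewrite -sE !permKV.
  - move=> v w vw; apply: (@perm_inj _ s).
    by rewrite permKV sR ?permKV // -sE !permKV.
have trans P Q S :
    plane_isomorphic P Q -> plane_isomorphic Q S -> plane_isomorphic P S.
  move=> /asboolP[s [sr sE sR]] /asboolP[t [tr tE tR]].
  apply/asboolP; exists (s * t)%g; split.
  - by rewrite permM sr.
  - by move=> v w; rewrite !permM tE sE.
  - by move=> v w vw; rewrite !permM sR // tR // sE.
move=> P Q S _ _ _; split.
  by apply/asboolP; exists 1%g; split=> *; rewrite !perm1.
move=> PQ; apply/idP/idP; first exact: trans (sym _ _ PQ).
exact: trans PQ.
Qed.

End PlaneTrees.

(* A tree with n edges has n + 1 vertices. *)
Definition num_plane_trees (n : nat) : nat :=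
  #|equivalence_partition (@plane_isomorphic 'I_n.+1)
      (finset (fun P : rooted_map 'I_n.+1 => `[< rooted_plane_tree P >]))|.

Local Open Scope ring_scope.

Definition Gamma (R : realType) (z : R) : R :=
  \int[lebesgue_measure]_(t in `]0, +oo[) (t `^ (z - 1) * expR (- t)).

Definition omega_partial_sum (R : realType) (n : nat) : R :=
  \sum_(1 <= k < n.+1) (num_plane_trees k)%:R / (k%:R * 4 ^+ k).

Definition omega (R : realType) : R := limn (@omega_partial_sum R).

(* Main.v *)
From HB Require Import structures.
Require Import Defs.
From mathcomp Require Import all_boot all_order all_fingroup all_algebra all_field.
From mathcomp Require Import all_classical all_reals all_analysis.
From mathcomp Require Import measurable_realfun.
From mathcomp Require Import zify ring lra.
Import Order.TTheory GRing.Theory Num.Theory.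
Import numFieldNormedType.Exports.
Set Implicit Arguments.
Unset Strict Implicit.
Unset Printing Implicit Defensive.

(** A sequence [d_0 <= d_1 <= ...] of [n] degrees is determined by the set of
    the numbers [d_i + i], and that set is best read as a lattice walk of length
    [n] with steps in [{-1, 0, 0, 1}], ending at height 0.  The criterion for
    the existence of a graph (the degrees of a set [S] are bounded by what [S]
    and a disjoint set [T] can absorb, [realize]) says that the area under every
    prefix of the walk is nonnegative, and the parity of the sum of the degrees
    is that of the total area.  So [num_graphical n] counts the closed walks
    with nonnegative partial areas and an even total area, up to a condition on
    the last step ([num_graphicalE]).

    Such walks are cut at their visits to 0 into excursions.  During an
    excursion the partial area is monotone, so only the areas of the excursions
    matter, and the bridges with nonnegative partial areas are governed by a
    Wiener-Hopf factorization ([wiener_hopf]): the logarithmic derivative of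
    their generating function [S] is the part of nonnegative area of that of all
    the bridges ([theta_sinai]).  By symmetry this part is half of the whole, up
    to the bridges of area zero, and cutting at the mean level turns these into
    closed walks of length [n] whose area is divisible by [n]
    ([sum_flen_area0]).  Fourier inversion over the [n]-th roots of unity counts
    those ([closed_walks_count]).

    The same numbers come from plane trees.  The directions, away from the root
    or towards it, of the arcs of the tour around a tree with [n] edges form a
    cyclic word with [n] letters of each kind.  This word determines the tree,
    because the arc opposite to a given one is the first return of the depth,
    and each word occurs, by inserting leaves one by one.  Thus
    [num_plane_trees n] is a number of orbits of rotations, and Burnside's lemma
    yields half of the number of closed walks ([closed_walks_trees]).

    With the variable scaled by 4, the bridges have generating function
    [(1 - x) `^ (- 1 / 2)].  Hence [S] is [(1 - x) `^ (- 1 / 4)] times the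
    exponential of [\sum_k T_k x ^ k / (k 4 ^ k)], [T_k] being the number of
    plane trees, and its coefficients are asymptotic to
    [exp omega / (Gamma (1 / 4) n ^ (3 / 4))] ([quarter_coef_cvg],
    [quarter_conv_cvg]).  The parity of the area is dealt with by the same
    factorization for walks signed by it, whose generating functions have
    coefficients of smaller order, as are those of the correction for the last
    step ([combined_asymptotics]).  The two remaining choices, of the parity and
    of the last step, each halve the count: this is the 4 between [4 ^ n] and
    [4 ^ (n - 1)]. *)

Local Open Scope classical_set_scope.
Local Open Scope ring_scope.

(** * The gamma function at one quarter *)

Section GammaFunction.
Variable R : realType.
Implicit Types (s z t : R).
Notation mu := (@lebesgue_measure R).

Definition gamma_integrand (z t : R) : R := t `^ (z - 1) * expR (- t).

(** Working with extended reals lets the functional equation be proved before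
    anything is known about convergence. *)
Definition egamma (z : R) : \bar R :=
  (\int[mu]_(t in `]0%R, +oo[) (gamma_integrand z t)%:E)%E.

Lemma gamma_integrand_ge0 z t : 0 <= gamma_integrand z t.
Proof. by rewrite mulr_ge0 ?powR_ge0 ?expR_ge0. Qed.

Lemma measurable_gamma_integrand (A : set R) z :
  measurable_fun A (gamma_integrand z).
Proof.
apply: measurable_funM; first exact: measurable_funS (measurable_powR _).
apply: measurable_funTS; apply: measurableT_comp => //.
Qed.

Lemma derive_gamma_integrand z t : 0 < t ->
  is_derive t 1 (gamma_integrand (z + 1))
    (z * gamma_integrand z t - gamma_integrand (z + 1) t).
Proof.
move=> t0; rewrite /gamma_integrand addrK.
have d1 := is_derive1_powR z t0.
have d2 : is_derive t 1 (fun x : R => expR (- x)) (- expR (- t)).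
  rewrite -mulrN1; exact: (@is_derive1_comp R expR -%R).
apply: is_derive_eq.
rewrite /GRing.scale /=; ring.
Qed.

Lemma continuous_gamma_integrand z t : 0 < t ->
  {for t, continuous (gamma_integrand z)}.
Proof.
move=> t0; have [d _] := derive_gamma_integrand (z - 1) t0.
rewrite subrK in d.
by apply: differentiable_continuous; apply/derivable1_diffP.
Qed.

Lemma within_continuous_gamma_integrand z a b : 0 < a ->
  {within `[a, b], continuous (gamma_integrand z)}.
Proof.
move=> a0; apply: continuous_in_subspaceT => t; rewrite inE /= in_itv /=.
by move=> /andP[at_ _]; apply: continuous_gamma_integrand; exact: lt_le_trans at_.
Qed.

Lemma gamma_integrand_integrable z a b : 0 < a ->
  mu.-integrable `[a, b] (EFin \o gamma_integrand z).
Proof.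
move=> a0; apply: continuous_compact_integrable; first exact: segment_compact.
exact: within_continuous_gamma_integrand.
Qed.

Lemma gamma_by_parts z a b : 0 < a -> a < b ->
  (\int[mu]_(t in `[a, b]) (gamma_integrand (z + 1) t)%:E =
   \int[mu]_(t in `[a, b]) (z * gamma_integrand z t)%:E +
   (gamma_integrand (z + 1) a - gamma_integrand (z + 1) b)%:E)%E.
Proof.
move=> a0 ab.
have iz : mu.-integrable `[a, b] (EFin \o (fun t => z * gamma_integrand z t)).
  by apply: (integrableZl _ z (gamma_integrand_integrable z b a0)).
have iz1 := gamma_integrand_integrable (z + 1) b a0.
have dF t : a <= t -> is_derive t 1 (gamma_integrand (z + 1))
    (z * gamma_integrand z t - gamma_integrand (z + 1) t).
  by move=> at_; apply: derive_gamma_integrand; exact: lt_le_trans at_.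
have := @continuous_FTC2 R
  (fun t => z * gamma_integrand z t - gamma_integrand (z + 1) t)
  (gamma_integrand (z + 1)) a b ab.
have -> : (\int[mu]_(x in `[a, b])
     (z * gamma_integrand z x - gamma_integrand (z + 1) x)%:E =
  \int[mu]_(x in `[a, b]) (z * gamma_integrand z x)%:E -
   \int[mu]_(x in `[a, b]) (gamma_integrand (z + 1) x)%:E)%E.
  by rewrite -integralB_EFin.
have : (\int[mu]_(t in `[a, b]) (gamma_integrand (z + 1) t)%:E)%E \is a fin_num.
  by apply: integrable_fin_num => //; exact: iz1.
have : (\int[mu]_(t in `[a, b]) (z * gamma_integrand z t)%:E)%E \is a fin_num.
  by apply: integrable_fin_num => //; exact: iz.
case: (integral _ _ _) => [u| |] // _; case: (integral _ _ _) => [v| |] // _.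
move=> H.
have : (u%:E - v%:E =
   (gamma_integrand (z + 1) b)%:E - (gamma_integrand (z + 1) a)%:E)%E.
  apply: H.
  - apply: continuous_in_subspaceT => t; rewrite inE /= in_itv /= => /andP[at_ _].
    have t0 : 0 < t := lt_le_trans a0 at_.
    apply: cvgB; last exact: continuous_gamma_integrand.
    by apply: cvgM; [exact: cvg_cst|exact: continuous_gamma_integrand].
  - split.
    + by move=> t; rewrite in_itv /= => /andP[/ltW at_ _]; have [] := dF _ at_.
    + by apply: cvg_at_right_filter; exact: continuous_gamma_integrand.
    + by apply: cvg_at_left_filter; apply: continuous_gamma_integrand; lra.
  - move=> t; rewrite in_itv /= => /andP[/ltW at_ _].
    by rewrite derive1E; have := dF _ at_ => D; rewrite derive_val.
by rewrite -!EFinB -!EFinD => -[e]; congr EFin; lra.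
Qed.

Let K (i : nat) : set R := `[i.+2%:R^-1, i.+2%:R].

Let K_bigcup : \bigcup_i K i = [set` `]0, +oo[].
Proof.
apply/seteqP; split => [t [i _]|t]; rewrite /K /= !in_itv /= ?andbT.
  by move=> /andP[it _]; apply: lt_le_trans it; rewrite invr_gt0.
move=> t0; have t'0 : 0 < t^-1 by rewrite invr_gt0.
exists (Num.truncn t + Num.truncn t^-1)%N => //=.
have h1 : t <= (Num.truncn t + Num.truncn t^-1).+2%:R.
  by apply: le_trans (ltW (truncnS_gt t)) _; rewrite ler_nat ltnS leqW // leq_addr.
have h2 : t^-1 <= (Num.truncn t + Num.truncn t^-1).+2%:R.
  by apply: le_trans (ltW (truncnS_gt _)) _; rewrite ler_nat ltnS leqW // leq_addl.
by rewrite in_itv /= h1 andbT -[leRHS]invrK lef_pV2 ?posrE.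
Qed.

Let K_cvg z : (\int[mu]_(t in K i) (gamma_integrand z t)%:E)%E @[i --> \oo]
  --> egamma z.
Proof.
rewrite /egamma -K_bigcup; apply: ge0_nondecreasing_set_cvg_integral.
- move=> m n mn; apply/subsetPset => t; rewrite /K /= !in_itv /= => /andP[h1 h2].
  apply/andP; split; last by apply: le_trans h2 _; rewrite ler_nat.
  by apply: le_trans h1; rewrite lef_pV2 ?posrE // ler_nat.
- by move=> i; exact: measurable_itv.
- by move=> i; apply/measurable_EFinP; exact: measurable_gamma_integrand.
- by move=> i t _; rewrite lee_fin gamma_integrand_ge0.
Qed.

Lemma invSS_cvg0 : (i.+2%:R^-1 : R) @[i --> \oo] --> (0 : R).
Proof. by have := @cvg_harmonic R; rewrite -cvg_shiftS. Qed.

Lemma gamma_integrand_cvg0 z : 0 < z ->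
  gamma_integrand (z + 1) i.+2%:R^-1 @[i --> \oo] --> (0 : R).
Proof.
move=> z0; rewrite /gamma_integrand addrK.
have inv0 : (i.+2%:R^-1 : R) @[i --> \oo] --> (0 : R).
  exact: invSS_cvg0.
rewrite -[0](mul0r (expR (- 0))); apply: cvgM.
  have /cvg_at_rightP := powR_cvg0 z0; apply; split; last exact: invSS_cvg0.
  by move=> i; rewrite invr_gt0.
apply: continuous_cvg; first exact: continuous_expR.
by apply: cvgN; exact: invSS_cvg0.
Qed.

Lemma gamma_integrand_cvgy0 z :
  gamma_integrand z i.+2%:R @[i --> \oo] --> (0 : R).
Proof.
pose N := Num.truncn z.
apply: (@squeeze_cvgr _ _ _ _ (fun=> 0) (fun i => (N.+2)`!%:R * i.+2%:R^-1)).
- near=> i; rewrite gamma_integrand_ge0 /= /gamma_integrand.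
  have i1 : 1 <= i.+2%:R :> R by rewrite ler1n.
  have le1 : i.+2%:R `^ (z - 1) <= i.+2%:R ^+ N.+1 :> R.
    rewrite -powR_mulrn //; apply: ler_powR => //.
    by have := truncnS_gt z; rewrite -/N; lra.
  have le2 : i.+2%:R ^+ N.+2 / N.+2`!%:R <= expR i.+2%:R :> R.
    by rewrite (le_trans _ (expR_ge1Dxn N.+1 (ler0n _ i.+2))) // lerDr.
  have i0 : 0 < i.+2%:R :> R by [].
  rewrite expRN ler_pdivrMr ?expR_gt0 //; apply: le_trans le1 _.
  rewrite ler_pdivrMr ?ltr0n ?fact_gt0 // in le2.
  rewrite mulrAC ler_pdivlMr // -exprSr; apply: le_trans le2 _.
  by rewrite mulrC.
- exact: cvg_cst.
- rewrite -[0](mulr0 (N.+2)`!%:R); apply: cvgMr.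
  exact: invSS_cvg0.
Unshelve. all: by end_near. Qed.

(** Integration by parts on the compact sets of an exhaustion, the boundary
    terms of which vanish in the limit. *)
Lemma egammaS z : 0 < z -> egamma (z + 1) = (z%:E * egamma z)%E.
Proof.
move=> z0; have lim_K := @K_cvg (z + 1).
rewrite -(cvg_lim (@ereal_hausdorff R) lim_K); apply/cvg_lim => //.
have -> : (fun i => \int[mu]_(t in K i) (gamma_integrand (z + 1) t)%:E)%E =
  (fun i => z%:E * \int[mu]_(t in K i) (gamma_integrand z t)%:E +
   (gamma_integrand (z + 1) i.+2%:R^-1 - gamma_integrand (z + 1) i.+2%:R)%:E)%E.
  apply/funext => i; rewrite gamma_by_parts ?invr_gt0 //; last first.
    by apply: (@lt_trans _ _ 1); rewrite ?invf_lt1 ?ltr1n.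
  congr (_ + _)%E; under eq_integral do rewrite EFinM.
  apply: ge0_integralZl_EFin; rewrite ?(ltW z0) //.
    by move=> t _; rewrite lee_fin gamma_integrand_ge0.
  by apply/measurable_EFinP; exact: measurable_gamma_integrand.
rewrite -[X in _ --> X]adde0; apply: cvgeD.
- exact: fin_num_adde_defl.
- by apply: cvgeZl => //; exact: K_cvg.
- apply: cvg_EFin; first by apply: nearW => i.
  rewrite -[X in _ --> X](subr0 0); apply: cvgB.
    exact: gamma_integrand_cvg0.
  exact: gamma_integrand_cvgy0.
Qed.

Lemma egamma1 : egamma 1 = 1%E.
Proof.
have lim_K := @K_cvg 1.
rewrite -(cvg_lim (@ereal_hausdorff R) lim_K); apply/cvg_lim => //.
have -> : (fun i => \int[mu]_(t in K i) (gamma_integrand 1 t)%:E)%E =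
  (fun i => (expR (- i.+2%:R^-1) - gamma_integrand 1 i.+2%:R)%:E)%E.
  apply/funext => i; have := @gamma_by_parts 0 i.+2%:R^-1 i.+2%:R.
  rewrite !add0r => ->; rewrite ?invr_gt0 //; last first.
    by apply: (@lt_trans _ _ 1); rewrite ?invf_lt1 ?ltr1n.
  under eq_integral do rewrite mul0r.
  by rewrite integral0 add0e /gamma_integrand subrr !powRr0 !mul1r.
apply: cvg_EFin; first by apply: nearW => i.
rewrite -[X in _ --> X](subr0 1) -[X in X - 0]expR0 -oppr0.
apply: cvgB; last by rewrite oppr0; exact: gamma_integrand_cvgy0.
apply: continuous_cvg; first exact: continuous_expR.
by apply: cvgN; exact: invSS_cvg0.
Qed.

Lemma egamma_nat n : egamma n.+1%:R = (n`!%:R)%:E.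
Proof.
elim: n => [|n IH]; first by rewrite egamma1.
by rewrite -[n.+2]addn1 natrD egammaS ?ltr0n // IH -EFinM -natrM factS.
Qed.

(** Weighted arithmetic-geometric inequality. *)
Lemma powR_le_affine s x : 0 < s < 1 -> 0 <= x -> x `^ s <= 1 - s + s * x.
Proof.
move=> /andP[s0 s1] x0.
have := @conjugate_powR R (x `^ s) 1 s^-1 (1 - s)^-1 (powR_ge0 _ _) ler01.
rewrite !invrK powR1 mulr1 -powRrM mulfV ?gt_eqF // powRr1 //.
rewrite !invr_gt0 s0 subr_gt0 s1 => /(_ isT isT).
rewrite addrC subrK => /(_ erefl) => h; lra.
Qed.

(** The tangent line of [t `^ s] at [t = z] integrates exactly, by the
    functional equation. *)
Lemma egammaD_le z s : 0 < z -> 0 < s < 1 ->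
  (egamma (z + s) <= (z `^ s)%:E * egamma z)%E.
Proof.
move=> z0 s01; have /andP[s0 s1] := s01.
have m w : measurable_fun (`]0%R, +oo[ : set R) (EFin \o gamma_integrand w).
  by apply/measurable_EFinP; exact: measurable_gamma_integrand.
have pos w t : (0 <= (gamma_integrand w t)%:E)%E.
  by rewrite lee_fin gamma_integrand_ge0.
have c1 : 0 <= z `^ s * (1 - s) by rewrite mulr_ge0 ?powR_ge0; lra.
have c2 : 0 <= z `^ s * (s / z) by rewrite mulr_ge0 ?powR_ge0 // divr_ge0 ?ltW.
have -> : ((z `^ s)%:E * egamma z = (z `^ s * (1 - s))%:E * egamma z +
   (z `^ s * (s / z))%:E * egamma (z + 1))%E.
  rewrite egammaS // muleA -EFinM -ge0_muleDl ?lee_fin //.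
    rewrite -EFinD; congr (_%:E * _)%E.
    by rewrite -[in RHS]mulrA mulfVK ?gt_eqF // -mulrDr subrK mulr1.
  by rewrite mulr_ge0 // ltW.
rewrite /egamma -!ge0_integralZl_EFin // -?ge0_integralD //.
- apply: ge0_le_integral => //.
  + exact: m.
  + by apply: emeasurable_funD; apply: measurable_funeM; exact: m.
  + move=> t /=; rewrite in_itv /= andbT => t0.
    rewrite -!EFinM -EFinD lee_fin /gamma_integrand addrK.
    have -> : z + s - 1 = (z - 1) + s by ring.
    rewrite powRD; last by rewrite (gt_eqF t0) implybT.
    have -> : t `^ z = t `^ (z - 1) * t.
      by rewrite mulrC mulr_powRB1 // ltW.
    have -> : t `^ s = z `^ s * (t / z) `^ s.
      rewrite -powRM ?divr_ge0 ?ltW //; congr (_ `^ _).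
      by rewrite mulrC divfK ?gt_eqF.
    have := @powR_le_affine s (t / z) s01 (divr_ge0 (ltW t0) (ltW z0)).
    have : 0 <= t `^ (z - 1) * expR (- t) * z `^ s.
      by rewrite !mulr_ge0 ?powR_ge0 ?expR_ge0.
    set A := t `^ _; set B := expR _; set C := z `^ _; set D := (_ / _) `^ _.
    move=> h1 h2; have := ler_wpM2l h1 h2.
    have -> : A * B * C * D = A * (C * D) * B by ring.
    have -> // : A * B * C * (1 - s + s * (t / z)) =
      C * (1 - s) * (A * B) + C * (s / z) * (A * t * B).
    by field; rewrite gt_eqF.
- by move=> t _; rewrite mule_ge0 // lee_fin.
- apply: measurable_funeM; exact: m.
- by move=> t _; rewrite mule_ge0 // lee_fin.
- apply: measurable_funeM; exact: m.
- exact: m.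
- exact: m.
Qed.

Lemma egamma_quarter : egamma (1 / 4) = (Gamma (1 / 4 : R))%:E.
Proof.
have fin : egamma (1 / 4) \is a fin_num.
  rewrite ge0_fin_numE; last first.
    by apply: integral_ge0 => t _; rewrite lee_fin gamma_integrand_ge0.
  have h : ((1 / 4)%:E * egamma (1 / 4) <= 1)%E.
    rewrite -egammaS; last lra.
    have := @egammaD_le 1 (1 / 4); rewrite egamma1 powR1 mule1 [1 + _]addrC.
    by apply; lra.
  move: h; case: (egamma _) => [r _| |] //; first exact: ltry.
  by rewrite gt0_muley // lte_fin; lra.
by rewrite -[LHS]fineK.
Qed.

Lemma egamma_quarterD n : egamma (n%:R + 1 / 4) =
  ((\prod_(k < n) (k%:R + 1 / 4)) * Gamma (1 / 4 : R))%:E.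
Proof.
elim: n => [|n IH]; first by rewrite big_ord0 add0r egamma_quarter; congr EFin; ring.
rewrite -addn1 natrD addrAC egammaS; last first.
  by apply: ltr_wpDl => //; lra.
by rewrite IH -EFinM addn1 big_ord_recr /=; congr EFin; ring.
Qed.

Lemma Gamma_quarter_gt0 : 0 < Gamma (1 / 4 : R).
Proof.
have := @egammaD_le (1 / 4) (3 / 4).
have -> : 1 / 4 + 3 / 4 = 1 :> R by lra.
rewrite egamma1 egamma_quarter -EFinM lee_fin => h.
have {h} : 1 <= (1 / 4) `^ (3 / 4) * Gamma (1 / 4 : R) by apply: h; lra.
have : 0 < (1 / 4 : R) `^ (3 / 4) by apply: powR_gt0; lra.
by move=> c0 h; rewrite -(pmulr_rgt0 _ c0); lra.
Qed.

(** The coefficients of [(1 - x) `^ (- 1 / 4)]. *)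
Definition quarter_coef (n : nat) : R :=
  \prod_(k < n) ((k%:R + 1 / 4) / k.+1%:R).

Lemma quarter_coefE n :
  quarter_coef n = (\prod_(k < n) (k%:R + 1 / 4)) / n`!%:R.
Proof.
rewrite /quarter_coef; elim: n => [|n IH].
  by rewrite !big_ord0 fact0 divr1.
rewrite !big_ord_recr /= IH factS natrM invfM; ring.
Qed.

(** Euler's limit, in the form given by the two instances [s = 1 / 4] and
    [s = 3 / 4] of the convexity bound. *)
Lemma quarter_coef_cvg :
  n%:R `^ (3 / 4) * quarter_coef n @[n --> \oo] --> (Gamma (1 / 4 : R))^-1.
Proof.
have G0 := Gamma_quarter_gt0; set G := Gamma _ in G0 *.
rewrite -cvg_shiftS /=.
apply: (@squeeze_cvgr _ _ _ _ (fun n => (1 - n.+2%:R^-1) * G^-1) (fun=> G^-1)).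
- apply: nearW => n; rewrite quarter_coefE.
  set P := \prod_(_ < _) _.
  have n0 : 0 < n.+1%:R :> R by [].
  have f0 : 0 < n`!%:R :> R by rewrite ltr0n fact_gt0.
  have f1 : 0 < n.+1`!%:R :> R by rewrite ltr0n fact_gt0.
  have up : P * G <= n.+1%:R `^ (1 / 4) * n`!%:R.
    have := @egammaD_le n.+1%:R (1 / 4) n0.
    rewrite egamma_quarterD egamma_nat -EFinM lee_fin -/G -/P.
    by apply; lra.
  have low : n.+1`!%:R <= (n.+1%:R + 1 / 4) `^ (3 / 4) * (P * G).
    have := @egammaD_le (n.+1%:R + 1 / 4) (3 / 4).
    have -> : n.+1%:R + 1 / 4 + 3 / 4 = n.+2%:R :> R.
      by rewrite -[n.+2]addn1 natrD; lra.
    rewrite egamma_quarterD egamma_nat -EFinM lee_fin -/G -/P.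
    by apply; lra.
  apply/andP; split; last first.
    rewrite -(ler_pM2r G0) mulVf ?gt_eqF // -(ler_pM2r f1) mul1r.
    have -> : n.+1%:R `^ (3 / 4) * (P / n.+1`!%:R) * G * n.+1`!%:R =
       n.+1%:R `^ (3 / 4) * (P * G) by field; rewrite gt_eqF.
    apply: (@le_trans _ _ (n.+1%:R `^ (3 / 4) * (n.+1%:R `^ (1 / 4) * n`!%:R))).
      by apply: ler_wpM2l up; rewrite powR_ge0.
    rewrite mulrA -powRD; last by rewrite (gt_eqF n0) implybT.
    have -> : 3 / 4 + 1 / 4 = 1 :> R by lra.
    by rewrite powRr1 // factS natrM.
  rewrite -(ler_pM2r G0) divfK ?gt_eqF // -(ler_pM2r f1).
  have -> : n.+1%:R `^ (3 / 4) * (P / n.+1`!%:R) * G * n.+1`!%:R =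
     n.+1%:R `^ (3 / 4) * (P * G) by field; rewrite gt_eqF.
  have q1 : 1 - n.+2%:R^-1 <= (n.+1%:R / (n.+1%:R + 1 / 4)) `^ (3 / 4) :> R.
    have d0 : 0 < n.+1%:R + 1 / 4 :> R by lra.
    apply: (@le_trans _ _ (n.+1%:R / (n.+1%:R + 1 / 4))).
      rewrite ler_pdivlMr //.
      have -> : n.+2%:R = n.+1%:R + 1 :> R by rewrite -[n.+2]addn1 natrD.
      set x := n.+1%:R in n0 d0 *.
      have -> : (1 - (x + 1)^-1) * (x + 1 / 4) = x * ((x + 1 / 4) / (x + 1)).
        by field; lra.
      by rewrite ger_pMr // ler_pdivrMr; lra.
    apply: ger1_powR; last lra.
    by rewrite divr_gt0 //= ler_pdivrMr // mul1r; lra.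
  apply: le_trans (ler_wpM2r (ltW f1) q1) _.
  have d0 : 0 < n.+1%:R + 1 / 4 :> R by lra.
  apply: le_trans (ler_wpM2l (powR_ge0 _ _) low) _.
  by rewrite mulrA -powRM ?divr_ge0 ?(ltW d0) // divfK // gt_eqF.
- have lim1 : (1 - n.+2%:R^-1 : R) @[n --> \oo] --> (1 - 0 : R).
    by apply: cvgB; [exact: cvg_cst|exact: invSS_cvg0].
  have lim2 : (1 - n.+2%:R^-1) * G^-1 @[n --> \oo] --> (1 - 0) * G^-1.
    by apply: cvgM lim1 _; exact: cvg_cst.
  by rewrite subr0 mul1r in lim2.
- exact: cvg_cst.
Qed.

End GammaFunction.

(** * Formal power series *)

Record fps (A : Type) := Fps { coefs :> nat -> A }.

HB.instance Definition _ (A : Type) := gen_eqMixin (fps A).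
HB.instance Definition _ (A : Type) := gen_choiceMixin (fps A).

Lemma fpsP (A : Type) (f g : fps A) : (forall n, f n = g n) -> f = g.
Proof. by case: f g => [f] [g] /= /funext ->. Qed.

Section FpsRing.
Variable A : comNzRingType.
Implicit Types f g h k : fps A.

Let zero : fps A := Fps (fun=> 0).
Let one : fps A := Fps (fun n => (n == 0%N)%:R).
Let opp f : fps A := Fps (fun n => - f n).
Let add f g : fps A := Fps (fun n => f n + g n).
Let mul f g : fps A := Fps (fun n => \sum_(i < n.+1) f i * g (n - i)%N).

Let addA : associative add.
Proof. by move=> f g h; apply: fpsP => n; exact: addrA. Qed.
Let addC : commutative add.
Proof. by move=> f g; apply: fpsP => n; exact: addrC. Qed.
Let add0 : left_id zero add.
Proof. by move=> f; apply: fpsP => n; exact: add0r. Qed.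
Let addN : left_inverse zero opp add.
Proof. by move=> f; apply: fpsP => n; exact: addNr. Qed.

HB.instance Definition _ := GRing.isZmodule.Build (fps A) addA addC add0 addN.

(* Each coefficient of a product is a coefficient of a product of truncations,
   so that the ring axioms come from those of polynomials. *)
Let trunc n f : {poly A} := \poly_(i < n) f i.

Let mulE m n f g : (m < n)%N -> mul f g m = (trunc n f * trunc n g)`_m.
Proof.
move=> mn; rewrite coefM; apply: eq_bigr => i _; rewrite !coef_poly.
have -> : (i < n)%N by case: i => i /=; lia.
by have -> : (m - i < n)%N by lia.
Qed.

Let eq_coefM n (p p' q : {poly A}) :
  (forall i, (i <= n)%N -> p`_i = p'`_i) -> (p * q)`_n = (p' * q)`_n.
Proof.
by move=> e; rewrite !coefM; apply: eq_bigr => i _; rewrite e // -ltnS ltn_ord.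
Qed.

Let mulC : commutative mul.
Proof. by move=> f g; apply: fpsP => n; rewrite !(@mulE n n.+1) // mulrC. Qed.

Let mulA : associative mul.
Proof.
have trM f g n i : (i <= n)%N ->
    (trunc n.+1 (mul f g))`_i = (trunc n.+1 f * trunc n.+1 g)`_i.
  by move=> i_n; rewrite coef_poly ltnS i_n (@mulE i n.+1).
move=> f g h; apply: fpsP => n; rewrite !(@mulE n n.+1) //.
rewrite mulrC (eq_coefM _ (@trM g h n)) mulrC mulrA.
exact/esym/eq_coefM/trM.
Qed.

Let mul1 : left_id one mul.
Proof.
move=> f; apply: fpsP => n /=; rewrite big_ord_recl subn0 mul1r big1 ?addr0 //.
by move=> i _; rewrite mul0r.
Qed.

Let mulDl : left_distributive mul add.
Proof.
move=> f g h; apply: fpsP => n /=; rewrite -big_split; apply: eq_bigr => i _.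
exact: mulrDl.
Qed.

Let one_neq0 : one != zero.
Proof.
by apply/eqP => /(congr1 (fun f : fps A => f 0%N))/eqP; rewrite oner_eq0.
Qed.

HB.instance Definition _ :=
  GRing.Zmodule_isComNzRing.Build (fps A) mulA mulC mul1 mulDl one_neq0.

Lemma fpsD f g n : (f + g) n = f n + g n. Proof. by []. Qed.
Lemma fpsN f n : (- f) n = - f n. Proof. by []. Qed.
Lemma fpsB f g n : (f - g) n = f n - g n. Proof. by []. Qed.
Lemma fps1 n : (1 : fps A) n = (n == 0%N)%:R. Proof. by []. Qed.
Lemma fpsM f g n : (f * g) n = \sum_(i < n.+1) f i * g (n - i)%N.
Proof. by []. Qed.

Lemma fpsMn f m n : (f *+ m) n = f n *+ m.
Proof. by elim: m => [|m IH]; rewrite ?mulr0n // !mulrS fpsD IH. Qed.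

Lemma fpsM0 f g : (f * g) 0%N = f 0%N * g 0%N.
Proof. by rewrite fpsM big_ord1. Qed.

Lemma fpsM_lead f g n :
  (forall i, (i < n)%N -> f i = 0) -> (f * g) n = f n * g 0%N.
Proof.
move=> f0; rewrite fpsM big_ord_recr /= subnn big1 ?add0r // => i _.
by rewrite f0 ?mul0r.
Qed.

Lemma eq_fpsM f f' g n :
  (forall i, (i <= n)%N -> f i = f' i) -> (f * g) n = (f' * g) n.
Proof.
by move=> e; rewrite !fpsM; apply: eq_bigr => i _; rewrite e // -ltnS ltn_ord.
Qed.

(** The derivation [x d/dx]. *)
Definition theta f : fps A := Fps (fun n => f n *+ n).

Lemma thetaE f n : theta f n = f n *+ n. Proof. by []. Qed.

Lemma theta1 : theta 1 = 0.
Proof. by apply: fpsP => -[|n]; rewrite thetaE fps1 ?mulr0n ?mul0rn. Qed.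

Lemma thetaB f g : theta (f - g) = theta f - theta g.
Proof. by apply: fpsP => n; rewrite !(thetaE, fpsB) mulrnBl. Qed.

Lemma thetaM f g : theta (f * g) = theta f * g + f * theta g.
Proof.
apply: fpsP => n; rewrite fpsD thetaE !fpsM -sumrMnl -big_split; apply: eq_bigr => i _.
rewrite /= mulrnAl mulrnAr -mulrnDr subnKC //; last by rewrite -ltnS.
Qed.

(** Logarithmic derivatives are additive. *)
Lemma theta_logM f g u v :
  theta f = f * u -> theta g = g * v -> theta (f * g) = f * g * (u + v).
Proof. by move=> fu gv; rewrite thetaM fu gv; ring. Qed.

Lemma theta_logV f g u : f * g = 1 -> theta f = f * u -> theta g = - (g * u).
Proof.
move=> fg fu; have := congr1 theta fg; rewrite thetaM theta1 fu => e.
have {e} : g * (f * u * g + f * theta g) = 0 by rewrite e mulr0.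
have -> : g * (f * u * g + f * theta g) = (f * g) * (g * u + theta g) by ring.
by rewrite fg mul1r addrC => /eqP; rewrite addr_eq0 => /eqP.
Qed.

End FpsRing.

Section FpsMap.
Variables (A B : comNzRingType) (phi : {rmorphism A -> B}) (r : B).
Implicit Types f g : fps A.

(** The substitution [x := r x] composed with a change of coefficients. *)
Definition fps_map f : fps B := Fps (fun n => phi (f n) * r ^+ n).

Lemma fps_mapE f n : fps_map f n = phi (f n) * r ^+ n. Proof. by []. Qed.

Lemma fps_mapD f g : fps_map (f + g) = fps_map f + fps_map g.
Proof. by apply: fpsP => n; rewrite fpsD !fps_mapE fpsD rmorphD mulrDl. Qed.

Lemma fps_mapB f g : fps_map (f - g) = fps_map f - fps_map g.
Proof. by apply: fpsP => n; rewrite fpsB !fps_mapE fpsB rmorphB mulrBl. Qed.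

Lemma fps_map1 : fps_map 1 = 1.
Proof.
by apply: fpsP => -[|n]; rewrite fps_mapE !fps1 /= ?rmorph1 ?rmorph0 ?mul0r ?mulr1.
Qed.

Lemma fps_mapM f g : fps_map (f * g) = fps_map f * fps_map g.
Proof.
apply: fpsP => n; rewrite fps_mapE !fpsM rmorph_sum mulr_suml.
apply: eq_bigr => i _; rewrite rmorphM !fps_mapE mulrACA -exprD subnKC //.
by rewrite -ltnS.
Qed.

Lemma fps_map_theta f : fps_map (theta f) = theta (fps_map f).
Proof. by apply: fpsP => n; rewrite fps_mapE !thetaE rmorphMn mulrnAl. Qed.

End FpsMap.

(** A series is determined by its constant term and its logarithmic
    derivative. *)
Lemma theta_uniq (R : numDomainType) (f g k : fps R) : k 0%N = 0 ->
  f 0%N = g 0%N -> theta f = f * k -> theta g = g * k -> f = g.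
Proof.
move=> k0 fg0 fk gk; apply: fpsP; elim/ltn_ind => -[//|n] IH.
have step h : theta h = h * k ->
    h n.+1 *+ n.+1 = \sum_(i < n.+1) h i * k (n.+1 - i)%N.
  move=> /(congr1 (fun f : fps R => f n.+1)); rewrite thetaE fpsM => ->.
  by rewrite big_ord_recr /= subnn k0 mulr0 addr0.
apply/eqP; rewrite -(eqr_pMn2r (ltn0Sn n)) !step //; apply/eqP.
by apply: eq_bigr => i _; rewrite IH.
Qed.

(** * Wiener-Hopf factorization *)

Section WienerHopf.
Variables (L : comNzRingType) (nn ng : L -> Prop).
Hypotheses (nnB : forall x y, nn x -> nn y -> nn (x - y)).
Hypotheses (nnM : forall x y, nn x -> nn y -> nn (x * y)).
Hypotheses (ngB : forall x y, ng x -> ng y -> ng (x - y)).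
Hypotheses (ngM : forall x y, ng x -> ng y -> ng (x * y)).
Hypotheses (nn0 : nn 0) (ng0 : ng 0).
Hypothesis nn_ng : forall x, nn x -> ng x -> x = 0.

Let addP (P : L -> Prop) : P 0 -> (forall x y, P x -> P y -> P (x - y)) ->
  forall x y, P x -> P y -> P (x + y).
Proof.
move=> P0 PB x y Px Py; have := PB _ _ Px (PB _ _ P0 Py).
by rewrite sub0r opprK.
Qed.

Let sumP (P : L -> Prop) (n : nat) (F : 'I_n -> L) : P 0 ->
  (forall x y, P x -> P y -> P (x - y)) -> (forall i, P (F i)) ->
  P (\sum_i F i).
Proof. by move=> P0 PB PF; apply: big_ind => //; exact: addP. Qed.

Let mulnP (P : L -> Prop) x n : P 0 ->
  (forall x y, P x -> P y -> P (x - y)) -> P x -> P (x *+ n).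
Proof.
move=> P0 PB Px; elim: n => [//|n IH]; rewrite mulrS; exact: addP.
Qed.

(** Let [S (1 - B) = F] where [S] only involves nonnegative exponents and [F]
    only negative ones, besides its constant term, and split the logarithmic
    derivative of [1 / (1 - B)] as [Kp + Kn] in the same way.  Then
    [(theta S - S Kp) F = (theta F + F Kn) S], and by induction on the
    coefficients both brackets are at once nonnegative and negative, hence
    zero. *)
Lemma wiener_hopf (S F C B Kp Kn : fps L) :
  S 0%N = 1 -> F 0%N = 1 -> S * (1 - B) = F -> C * (1 - B) = 1 ->
  theta B * C = Kp + Kn -> Kn 0%N = 0 ->
  (forall n, nn (S n)) -> (forall n, ng (F n.+1)) ->
  (forall n, nn (Kp n)) -> (forall n, ng (Kn n)) ->
  theta S = S * Kp.
Proof.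
move=> S0 F0 SF CB BK Kn0 nnS ngF nnK ngK.
pose D := theta S - S * Kp; pose D' := theta F + F * Kn.
have FK : theta F = theta S * (1 - B) - S * theta B.
  by rewrite -SF thetaM thetaB theta1 sub0r mulrN.
have DD' : D * F = D' * S.
  rewrite /D /D' FK -SF.
  have -> : Kp = theta B * C - Kn by rewrite BK addrK.
  have -> : (theta S - S * (theta B * C - Kn)) * (S * (1 - B)) =
    theta S * S * (1 - B) - S * S * theta B * (C * (1 - B)) +
    S * S * Kn * (1 - B) by ring.
  by rewrite CB; ring.
have nnD n : nn (D n).
  rewrite fpsB fpsM; apply: nnB; first exact: mulnP.
  by apply: sumP => // i; exact: nnM.
have ngD n : ng (D' n).
  rewrite fpsD fpsM big_ord_recl F0 mul1r subn0.
  apply: (addP ng0 ngB); first by case: n => [|n]; rewrite thetaE ?mulr0n //; exact: mulnP.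
  apply: (addP ng0 ngB) => //; apply: sumP => // i.
  by apply: ngM; [exact: (ngF i)|exact: ngK].
suff D0 n : D n = 0 /\ D' n = 0.
  by apply/eqP; rewrite -subr_eq0; apply/eqP/fpsP => n; case: (D0 n).
elim/ltn_ind: n => n IH.
have e : D n = D' n.
  have := congr1 (fun f : fps L => f n) DD'.
  rewrite fpsM_lead; last by move=> i /IH[].
  by rewrite fpsM_lead ?F0 ?S0 ?mulr1 // => i /IH[].
suff : D n = 0 by rewrite -e.
by apply: nn_ng => //; rewrite e.
Qed.

End WienerHopf.

(** * Limits of convolutions *)

Section Convolution.
Variable R : realType.
Implicit Types (a b f g : nat -> R) (W : fps R).

Definition abs_summable b := cvgn (series (fun n => `|b n|)).

Lemma series_tail_small b (e : R) : abs_summable b -> 0 < e ->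
  exists N : nat, forall n, \sum_(N <= k < n) `|b k| <= e.
Proof.
move=> sb e0; have nd : nondecreasing_seq (series (fun n => `|b n|)).
  by apply: nondecreasing_series => i _ _.
have /cvgrPdist_le /(_ e e0) [N _ HN] := sb.
exists N => n; have [nN|Nn] := leqP n N; first by rewrite big_geq // ltW.
have := HN N (leqnn N); have := nondecreasing_cvgn_le nd sb n.
set l := limn _ => h1; rewrite ler_norml => /andP[_ h2].
have : series (fun n => `|b n|) n =
    series (fun n => `|b n|) N + \sum_(N <= k < n) `|b k|.
  by rewrite /series /= -big_cat_nat // ltnW.
move=> h3; rewrite h3 in h1; lra.
Qed.

Lemma cvg_sum_ord N (f : nat -> nat -> R) (l : nat -> R) :
  (forall k, f k n @[n --> \oo] --> l k) ->
  \sum_(k < N) f k n @[n --> \oo] --> \sum_(k < N) l k.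
Proof.
move=> fl; elim: N => [|N IH].
  by under eq_fun do rewrite big_ord0; rewrite big_ord0; exact: cvg_cst.
under eq_fun do rewrite big_ord_recr.
by rewrite big_ord_recr; apply: cvgD.
Qed.

(** Tannery's theorem: dominated convergence for sums. *)
Lemma tannery0 (v : nat -> nat -> R) b (M : R) :
  (forall n k, (k <= n)%N -> `|v n k| <= M) ->
  (forall k, v n k @[n --> \oo] --> (0 : R)) -> abs_summable b ->
  \sum_(k < n.+1) v n k * b k @[n --> \oo] --> (0 : R).
Proof.
move=> vM v0 sb; have M0 : 0 <= M by apply: le_trans (vM 0%N 0%N isT).
apply/cvgr0Pnorm_le => e e0.
pose d := e / 2 / (M + 1); have d0 : 0 < d by rewrite !divr_gt0 //; lra.
have [N HN] := series_tail_small sb d0.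
have head : \sum_(k < N) v n k * b k @[n --> \oo] --> (0 : R).
  have := @cvg_sum_ord N (fun k n => v n k * b k) (fun k => 0 * b k).
  rewrite [X in _ --> X]big1; last by move=> k _; rewrite mul0r.
  by apply=> k; apply: cvgM; [exact: v0|exact: cvg_cst].
have e20 : 0 < e / 2 by lra.
have /cvgr0Pnorm_le /(_ _ e20) := head.
apply: filterS2 (nbhs_infty_ge N) => n /= Nn Hhead.
rewrite -(big_mkord xpredT (fun k => v n k * b k)) (@big_cat_nat _ _ _ N) //=; last first.
  exact: leqW.
rewrite big_mkord; apply: le_trans (ler_normD _ _) _.
suff : `|\sum_(N <= k < n.+1) v n k * b k| <= e / 2 by lra.
apply: le_trans (ler_norm_sum _ _ _) _.
apply: (@le_trans _ _ (\sum_(N <= k < n.+1) M * `|b k|)).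
  rewrite !big_nat; apply: ler_sum => k /andP[_ kn]; rewrite normrM.
  by apply: ler_wpM2r => //; exact: vM.
rewrite -mulr_sumr; apply: le_trans (ler_wpM2l M0 (HN _)) _.
have -> : e / 2 = d * (M + 1) by rewrite /d divfK // gt_eqF //; lra.
by rewrite mulrC ler_wpM2l //; lra.
Qed.

Lemma tannery (w : nat -> nat -> R) b (c M : R) :
  (forall n k, (k <= n)%N -> `|w n k| <= M) ->
  (forall k, w n k @[n --> \oo] --> c) -> abs_summable b ->
  \sum_(k < n.+1) w n k * b k @[n --> \oo] --> c * limn (series b).
Proof.
move=> wM wc sb.
have -> : (fun n => \sum_(k < n.+1) w n k * b k) =
  (fun n => \sum_(k < n.+1) (w n k - c) * b k + c * series b n.+1).
  apply/funext => n; rewrite /series /= big_mkord mulr_sumr -big_split /=.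
  by apply: eq_bigr => k _; rewrite -mulrDl subrK.
have h0 : \sum_(k < n.+1) (w n k - c) * b k @[n --> \oo] --> (0 : R).
  apply: (@tannery0 (fun n k => w n k - c) b (M + `|c|)) => // [n k kn|k].
    by apply: le_trans (ler_normB _ _) _; rewrite lerD2r wM.
  have h : w n k - c @[n --> \oo] --> c - c.
    by apply: cvgB; [exact: wc|exact: cvg_cst].
  by rewrite subrr in h.
have h1 : c * series b n.+1 @[n --> \oo] --> c * limn (series b).
  apply: cvgM; first exact: cvg_cst.
  have := @normed_cvg _ _ _ sb; rewrite -cvg_shiftS; exact.
by rewrite -[c * limn _]add0r; exact: cvgD h0 h1.
Qed.

Lemma cvg_bounded_seq a (l : R) : a @ \oo --> l ->
  exists2 M, 0 <= M & forall n, `|a n| <= M.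
Proof.
move=> al; have /cvg_seq_bounded [M [_ HM]] : cvgn a by apply/cvg_ex; exists l.
exists (`|M| + 1) => [|n]; first by rewrite addr_ge0.
by apply: (HM (`|M| + 1)) => //; rewrite (le_lt_trans (ler_norm _)) // ltrDl.
Qed.

Lemma cvg_subn_shift a (l : R) k : a @ \oo --> l ->
  a (n - k)%N @[n --> \oo] --> l.
Proof.
move=> al; rewrite -(cvg_shiftn k) /=.
by under eq_fun do rewrite addnK.
Qed.

(** A convolution of a convergent with a summable sequence. *)
Lemma conv_cvg (f g : fps R) (l : R) : f @ \oo --> l -> abs_summable g ->
  (f * g) n @[n --> \oo] --> l * limn (series g).
Proof.
move=> fl sg; have [M _ fM] := cvg_bounded_seq fl.
under eq_fun do rewrite mulrC fpsM.
under eq_fun do under eq_bigr do rewrite mulrC.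
apply: (@tannery (fun n k => f (n - k)%N) g l M) => // k.
exact: cvg_subn_shift.
Qed.

(** Partial sums are convolutions with the constant sequence. *)
Definition fps_ones : fps R := Fps (fun=> 1).

Lemma fps_onesM (f : fps R) n : (fps_ones * f) n = series f n.+1.
Proof.
rewrite mulrC fpsM /series /= big_mkord; apply: eq_bigr => i _.
by rewrite mulr1.
Qed.

Lemma cauchy_product (f g : fps R) :
  abs_summable f -> abs_summable g ->
  series (f * g) @ \oo --> limn (series f) * limn (series g).
Proof.
move=> sf sg; rewrite -(cvg_shiftS (series (f * g))).
have -> : (fun n => series (f * g) n.+1) = (fps_ones * f * g : fps R).
  by apply/funext => n; rewrite -mulrA fps_onesM.
apply: (@conv_cvg (fps_ones * f)) => //.
have -> : ((fps_ones * f : fps R) : nat -> R) = (fun n => series f n.+1).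
  by apply/funext => n; exact: fps_onesM.
have := @normed_cvg _ _ _ sf; rewrite -(cvg_shiftS (series f)); exact.
Qed.

Lemma abs_summableM (f g : fps R) :
  abs_summable f -> abs_summable g -> abs_summable (f * g).
Proof.
move=> sf sg.
pose af : fps R := Fps (fun n => `|f n|); pose ag : fps R := Fps (fun n => `|g n|).
have saf : abs_summable af by rewrite /abs_summable; under eq_fun do rewrite normr_id.
have sag : abs_summable ag by rewrite /abs_summable; under eq_fun do rewrite normr_id.
have c : cvgn (series (af * ag)) by apply/cvg_ex; eexists; exact: cauchy_product.
apply: series_le_cvg c => [n|n|n] //.
  by rewrite fpsM; apply: sumr_ge0 => i _; rewrite mulr_ge0 //=.
rewrite !fpsM; apply: le_trans (ler_norm_sum _ _ _) _.
by apply: ler_sum => i _; rewrite normrM.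
Qed.

(** * The exponential of a series *)

Definition fps_exp W : fps R :=
  Fps (fun n => \sum_(m < n.+1) (W ^+ m) n / m`!%:R).

Lemma fpsX_small W m n : W 0%N = 0 -> (n < m)%N -> (W ^+ m) n = 0.
Proof.
move=> W0; elim: m n => [//|m IH] n nm; rewrite exprS fpsM big1 // => -[i /= i_n] _.
case: i i_n => [|i] i_n; first by rewrite W0 mul0r.
by rewrite IH ?mulr0 //; lia.
Qed.

Lemma fps_expE W M n : W 0%N = 0 -> (n < M)%N ->
  fps_exp W n = \sum_(m < M) (W ^+ m) n / m`!%:R.
Proof.
move=> W0 nM; rewrite /= -!(big_mkord xpredT (fun m => (W ^+ m) n / m`!%:R)).
have tail0 : \sum_(n.+1 <= m < M) (W ^+ m) n / m`!%:R = 0.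
  by rewrite big_nat big1 // => m /andP[nm _]; rewrite fpsX_small ?mul0r.
by rewrite [RHS](@big_cat_nat _ _ _ n.+1) //= tail0 addr0.
Qed.

Lemma fps_exp0 W : fps_exp W 0%N = 1.
Proof. by rewrite /= big_ord1 expr0 fps1 fact0 divr1. Qed.

Lemma theta_exprS W m : theta (W ^+ m.+1) = (W ^+ m * theta W) *+ m.+1.
Proof.
elim: m => [|m IH]; first by rewrite expr1 expr0 mul1r.
rewrite exprS thetaM IH mulrnAr mulrCA mulrA -exprSr [RHS]mulrS mulrC.
by congr (_ + _); rewrite mulrC.
Qed.

Lemma theta_exp W : W 0%N = 0 -> theta (fps_exp W) = fps_exp W * theta W.
Proof.
move=> W0; apply: fpsP => n; rewrite thetaE (@fps_expE _ n.+2) // -sumrMnl.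
pose E : fps R := Fps (fun k => \sum_(m < n.+1) (W ^+ m) k / m`!%:R).
rewrite (@eq_fpsM _ _ E); last by move=> i i_n; rewrite (@fps_expE _ n.+1).
rewrite big_ord_recl [X in X + _](_ : _ = 0); last first.
  by rewrite /= fact0 divr1; case: (n) => [|k]; rewrite ?mulr0n ?mul0rn.
rewrite add0r fpsM /E /=.
under [RHS]eq_bigr => i _ do rewrite mulr_suml.
rewrite exchange_big /=; apply: eq_bigr => m _; rewrite /bump /= add1n.
have /(congr1 (fun f : fps R => f n)) := theta_exprS W m.
rewrite thetaE fpsMn fpsM -mulrnAl => ->.
rewrite factS natrM invfM mulrA -[X in X / _ / _]mulr_natr mulfK ?pnatr_eq0 //.
rewrite mulr_suml; apply: eq_bigr => i _.
by rewrite mulrAC.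
Qed.

Lemma series_fps_expr W m : abs_summable W ->
  abs_summable (W ^+ m) /\ series (W ^+ m) @ \oo --> limn (series W) ^+ m.
Proof.
move=> sW; elim: m => [|m [sm cm]].
  have one1 n : (0 < n)%N -> series (1 : fps R) n = 1.
    case: n => // n _; by rewrite /series /= big_nat_recl //= big1 ?addr0.
  have lim1 : series (1 : fps R) @ \oo --> (1 : R).
    rewrite -(cvg_shiftS (series (1 : fps R))).
    by under eq_fun do rewrite one1 //; exact: cvg_cst.
  rewrite !expr0; split => //.
  rewrite /abs_summable; under eq_fun do rewrite fps1 normr_nat.
  by apply/cvg_ex; exists 1; exact: lim1.
rewrite !exprS; split; first exact: abs_summableM.
by rewrite -(cvg_lim _ cm) //; exact: cauchy_product.
Qed.

Section NonnegExp.
Variable W : fps R.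
Hypotheses (W0 : W 0%N = 0) (W_ge0 : forall n, 0 <= W n).
Hypothesis sW : cvgn (series W).

Let absW : abs_summable W.
Proof.
rewrite /abs_summable; have -> : (fun n => `|W n|) = W => //.
by apply/funext => n; rewrite ger0_norm.
Qed.

Lemma fps_expr_ge0 m n : 0 <= (W ^+ m) n.
Proof.
elim: m n => [|m IH] n; first by rewrite expr0 fps1.
by rewrite exprS fpsM sumr_ge0 // => i _; rewrite mulr_ge0.
Qed.

Lemma fps_exp_ge0 n : 0 <= fps_exp W n.
Proof. by rewrite sumr_ge0 // => m _; rewrite divr_ge0 ?fps_expr_ge0. Qed.

Let w := limn (series W).

Let pow_le m N : series (W ^+ m) N <= w ^+ m.
Proof.
have [sm cm] := series_fps_expr m absW.
rewrite -(cvg_lim _ cm) //; apply: nondecreasing_cvgn_le.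
  by apply: nondecreasing_series => i _ _; exact: fps_expr_ge0.
by apply/cvg_ex; eexists; exact: cm.
Qed.

Let series_exp M N : (N <= M)%N ->
  series (fps_exp W) N = \sum_(m < M) series (W ^+ m) N / m`!%:R.
Proof.
move=> NM; rewrite /series /=; under [RHS]eq_bigr => m _ do rewrite mulr_suml.
rewrite exchange_big /= !big_nat; apply: eq_bigr => n /= nN.
by rewrite -(@fps_expE W M n) // (leq_trans nN NM).
Qed.

(** Expanding the exponential, both bounds come from
    [series (W ^+ m) @ \oo --> (limn (series W)) ^+ m]. *)
Lemma series_fps_exp : series (fps_exp W) @ \oo --> expR (limn (series W)).
Proof.
have nd : nondecreasing_seq (series (fps_exp W)).
  by apply: nondecreasing_series => i _ _; exact: fps_exp_ge0.
have ub N : series (fps_exp W) N <= expR w.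
  rewrite (@series_exp N) //.
  apply: (@le_trans _ _ (series (exp_coeff w) N)).
    rewrite /series /= big_mkord; apply: ler_sum => m _.
    by apply: ler_wpM2r; [rewrite invr_ge0|exact: pow_le].
  apply: nondecreasing_cvgn_le; last exact: is_cvg_series_exp_coeff.
  apply: nondecreasing_series => i _ _; apply: exp_coeff_ge0.
  by have := pow_le 1 0; rewrite expr1 /series /= big_geq.
have cv : cvgn (series (fps_exp W)).
  apply: nondecreasing_is_cvgn => //.
  by exists (expR w) => _ [N _ <-].
suff -> : expR w = limn (series (fps_exp W)) by [].
apply/eqP; rewrite eq_le; apply/andP; split; last first.
  by apply: limr_le => //; apply: nearW.
apply: limr_le; first exact: is_cvg_series_exp_coeff.
apply: nearW => M.
have -> : series (exp_coeff w) M = \sum_(m < M) exp_coeff w m.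
  by rewrite /series /= big_mkord.
have c : \sum_(m < M) series (W ^+ m) N / m`!%:R @[N --> \oo] -->
    \sum_(m < M) exp_coeff w m.
  apply: (@cvg_sum_ord _ (fun m N => series (W ^+ m) N / m`!%:R)) => m.
  apply: cvgM; last exact: cvg_cst.
  by have [] := series_fps_expr m absW.
rewrite -(cvg_lim _ c) //; apply: ler_lim => //.
  by apply/cvg_ex; eexists; exact: c.
apply: filterS (nbhs_infty_ge M) => N MN.
rewrite (@series_exp N) // -!(big_mkord xpredT (fun m => series (W ^+ m) N / m`!%:R)).
rewrite (@big_cat_nat _ _ _ M 0 N) //= lerDl sumr_ge0 // => m _.
by rewrite divr_ge0 // /series /= sumr_ge0 // => i _; exact: fps_expr_ge0.
Qed.

End NonnegExp.
End Convolution.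

(** * Series with a small logarithmic derivative *)

Section LogDerivative.
Variable R : realType.

Lemma cvg_eq_lim (u : nat -> R) (l l' : R) : l = l' ->
  u @ \oo --> l -> u @ \oo --> l'.
Proof. by move=> ->. Qed.

Lemma cvg_ext (u v : nat -> R) (l : R) : (forall n, u n = v n) ->
  u @ \oo --> l -> v @ \oo --> l.
Proof. by move=> /funext ->. Qed.

Definition fps_int (tau : fps R) : fps R := Fps (fun n => tau n / n%:R).

Lemma theta_int (tau : fps R) : tau 0%N = 0 -> theta (fps_int tau) = tau.
Proof.
move=> t0; apply: fpsP => -[|n]; rewrite thetaE; first by rewrite mulr0n t0.
by rewrite /= -[LHS]mulr_natr divfK // pnatr_eq0.
Qed.

(** The coefficients of [(1 - x) `^ (- z)] have logarithmic derivative
    [z x / (1 - x)]. *)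
Lemma theta_rising (f : fps R) (z : R) :
  (forall n, f n.+1 * n.+1%:R = f n * (n%:R + z)) ->
  theta f = f * Fps (fun n => (n != 0%N)%:R * z).
Proof.
move=> fz; apply: fpsP => -[|n]; rewrite thetaE.
  by rewrite mulr0n fpsM0 /= mul0r mulr0.
rewrite fpsM big_ord_recr /= subnn eqxx mul0r mulr0 addr0 -[LHS]mulr_natr.
have -> : \sum_(i < n.+1) f i * ((n.+1 - i != 0)%N%:R * z) = \sum_(i < n.+1) f i * z.
  apply: eq_bigr => -[i i_n] _ /=.
  by rewrite -lt0n subn_gt0 i_n mul1r.
elim: n => [|n IH]; first by rewrite big_ord1 fz add0r.
by rewrite big_ord_recr /= -IH fz mulrDr.
Qed.

Lemma invn_cvg0 (C : R) : C * n%:R^-1 @[n --> \oo] --> (0 : R).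
Proof.
apply: (cvg_eq_lim (mulr0 C)); apply: cvgM; first exact: cvg_cst.
rewrite -cvg_shiftS; exact: cvg_harmonic.
Qed.

Lemma series_inv_sqr_le n :
  series (fun k => k%:R^-1 * k%:R^-1 : R) n.+2 <= 2 - n.+1%:R^-1.
Proof.
rewrite /series /=; elim: n => [|n IH].
  by rewrite !big_nat_recr //= big_geq // invr0 invr1; lra.
rewrite big_nat_recr //=.
have n1 : 0 < n.+1%:R :> R by [].
have -> : n.+2%:R = n.+1%:R + 1 :> R by rewrite -[n.+2]addn1 natrD.
move: IH; set x := n.+1%:R in n1 *; set y := \sum_(_ <= _ < _) _ => IH.
apply: le_trans (lerD IH (lexx _)) _.
have x1 : 0 < x + 1 by lra.
have -> : 2 - (x + 1)^-1 =
  2 - x^-1 + (x + 1)^-1 * (x + 1)^-1 + (x + 1)^-1 * ((x + 1)^-1 * x^-1).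
  by field; rewrite !gt_eqF.
by rewrite lerDl !mulr_ge0 // invr_ge0 ltW.
Qed.

Section SmallTau.
Variables (tau : fps R) (C : R).
Hypothesis tauC : forall n, `|tau n| <= C * n%:R^-1.

Lemma small_tau0 : tau 0%N = 0.
Proof.
by apply/eqP; rewrite -normr_le0; have := tauC 0; rewrite invr0 mulr0.
Qed.

Lemma small_tau_cvg0 : tau @ \oo --> (0 : R).
Proof.
apply/norm_cvg0P; apply: (@squeeze_cvgr _ _ _ _ (fun=> 0) (fun n => C * n%:R^-1)).
- by apply: nearW => n; rewrite normr_ge0 tauC.
- exact: cvg_cst.
- exact: invn_cvg0.
Qed.

Lemma small_tau_summable : abs_summable (fps_int tau).
Proof.
have C0 : 0 <= C.
  by have := tauC 1; rewrite invr1 mulr1; apply: le_trans.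
apply: (@series_le_cvg _ _ (fun n => C * (n%:R^-1 * n%:R^-1))) => [n|n|n|].
- by [].
- by rewrite !mulr_ge0.
- rewrite /= normrM mulrA normfV normr_nat; exact: ler_wpM2r.
- have -> : series (fun n => C * (n%:R^-1 * n%:R^-1)) =
    (fun n => C * series (fun n => n%:R^-1 * n%:R^-1 : R) n).
    by apply/funext => n; rewrite /series /= mulr_sumr.
  apply: is_cvgMr; apply: nondecreasing_is_cvgn.
    by apply: nondecreasing_series => i _ _; rewrite mulr_ge0.
  exists 2 => _ [n _ <-].
  apply: (@le_trans _ _ (series (fun k => k%:R^-1 * k%:R^-1 : R) n.+2)).
    apply: nondecreasing_series; last by rewrite leqW // leqW.
    by move=> i _ _; rewrite mulr_ge0.
  apply: le_trans (series_inv_sqr_le n) _.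
  by rewrite gerBl invr_ge0.
Qed.

(** Such a series is dominated by the exponential of a summable one. *)
Variable f : fps R.
Hypotheses (f0 : f 0%N = 1) (ff : theta f = f * tau).

Lemma small_log_summable : abs_summable f.
Proof.
pose at_ : fps R := Fps (fun n => `|tau n|).
pose W := fps_int at_.
have at0 : at_ 0%N = 0 by rewrite /= small_tau0 normr0.
have W0 : W 0%N = 0 by rewrite /= small_tau0 normr0 mul0r.
have W_ge0 n : 0 <= W n by rewrite /W /= mulr_ge0 // invr_ge0.
have sW : cvgn (series W).
  have := small_tau_summable; rewrite /abs_summable.
  by under eq_fun do rewrite /= normrM normfV normr_nat.
have gg := theta_exp W0; rewrite (theta_int at0) in gg.
have dom : forall n, `|f n| <= fps_exp W n.
  elim/ltn_ind => -[|n] IH; first by rewrite f0 fps_exp0 normr1.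
  rewrite -(ler_pMn2r (ltn0Sn n)) -[leRHS]/(theta (fps_exp W) n.+1) -normrMn.
  rewrite -[X in `|X|]/(theta f n.+1) ff gg !fpsM.
  apply: le_trans (ler_norm_sum _ _ _) _; apply: ler_sum => i _; rewrite normrM.
  have [i_n|] := ltnP i n.+1; first by apply: ler_wpM2r => //; exact: IH.
  move=> n_i; have -> : (n.+1 - i)%N = 0%N by lia.
  by rewrite at0 small_tau0 normr0 !mulr0.
apply: (@series_le_cvg _ _ (fps_exp W)) => // [n|].
  exact: fps_exp_ge0.
by apply/cvg_ex; eexists; exact: (series_fps_exp W0 W_ge0 sW).
Qed.

Lemma small_log_coef : n%:R * f n @[n --> \oo] --> (0 : R).
Proof.
have -> : (fun n => n%:R * f n) = (tau * f : fps R).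
  by apply/funext => n; rewrite [tau * f]mulrC -ff thetaE mulr_natl.
apply: (cvg_eq_lim (mul0r (limn (series f)))).
by apply: conv_cvg; [exact: small_tau_cvg0|exact: small_log_summable].
Qed.

End SmallTau.

(** * The central binomial coefficients *)

Definition central : fps R := Fps (fun n => 'C(n.*2, n)%:R / 4 ^+ n).

Lemma central_binS n : ('C(n.+1.*2, n.+1) * n.+1 = 'C(n.*2, n) * (4 * n + 2))%N.
Proof.
have h1 : ('C(n.*2.+2, n.+1) * n.+1 = n.*2.+2 * 'C(n.*2.+1, n))%N.
  by rewrite mul_bin_diag mulnC.
have h2 : ('C(n.*2.+1, n) * n.+1 = n.*2.+1 * 'C(n.*2, n))%N.
  have := mul_bin_down n.*2.+1 n; rewrite /=.
  have -> : (n.*2.+1 - n = n.+1)%N by lia.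
  by rewrite [RHS]mulnC => ->; rewrite mulnC.
have : ('C(n.+1.*2, n.+1) * n.+1 * n.+1 = 'C(n.*2, n) * (4 * n + 2) * n.+1)%N.
  by rewrite doubleS h1 -!mulnA h2; lia.
by move/eqP; rewrite eqn_pmul2r // => /eqP.
Qed.

Lemma centralS n : central n.+1 * n.+1%:R = central n * (n%:R + 1 / 2).
Proof.
have /(congr1 (fun m => m%:R : R)) := central_binS n.
rewrite !natrM natrD natrM /= exprS => e.
have p0 : 4 ^+ n != 0 :> R by rewrite expf_neq0 // pnatr_eq0.
rewrite mulrAC e.
by field.
Qed.

Lemma central_sqr_le n : central n ^+ 2 * n.*2.+1%:R <= 1.
Proof.
elim: n => [|n IH]; first by rewrite /= bin0 divr1 expr1n mul1r.
have n1 : 0 < n.+1%:R :> R by [].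
have e : central n.+1 = central n * (n%:R + 1 / 2) / n.+1%:R.
  by rewrite -centralS mulfK // gt_eqF.
rewrite e; apply: le_trans _ IH.
have -> : n.+1.*2.+1%:R = 2 * n%:R + 3 :> R by rewrite -addn1 -addnn !natrD -[n.+1]addn1 natrD; lra.
have -> : n.*2.+1%:R = 2 * n%:R + 1 :> R by rewrite -addn1 -addnn !natrD; lra.
have -> : n.+1%:R = n%:R + 1 :> R by rewrite -[n.+1]addn1 natrD.
have n0 : 0 <= n%:R :> R by [].
set x := n%:R in n0 *; have x1 : 0 < x + 1 by lra.
move: (central n) => y.
have -> : (y * (x + 1 / 2) / (x + 1)) ^+ 2 * (2 * x + 3) =
  y ^+ 2 * ((x + 1 / 2) ^+ 2 * (2 * x + 3) / (x + 1) ^+ 2).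
  by field; rewrite gt_eqF.
apply: ler_wpM2l; first exact: sqr_ge0.
rewrite ler_pdivrMr ?exprn_gt0 //.
have -> : (2 * x + 1) * (x + 1) ^+ 2 =
  (x + 1 / 2) ^+ 2 * (2 * x + 3) + (x / 2 + 1 / 4) by field.
by rewrite lerDl; lra.
Qed.

Lemma central_ge0 n : 0 <= central n.
Proof. by rewrite divr_ge0 // exprn_ge0. Qed.

Lemma central_cvg0 : central @ \oo --> (0 : R).
Proof.
apply: (@squeeze_cvgr _ _ _ _ (fun=> 0) (fun n => Num.sqrt (harmonic n))).
- apply: nearW => n; rewrite central_ge0 /= -[leLHS]ger0_norm ?central_ge0 //.
  rewrite -sqrtr_sqr ler_wsqrtr // -[leRHS]mul1r ler_pdivlMr //.
  apply: le_trans _ (central_sqr_le n); apply: ler_wpM2l; first exact: sqr_ge0.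
  by rewrite ler_nat -addnn ltnS leq_addr.
- exact: cvg_cst.
- apply: (cvg_eq_lim (sqrtr0 R)); apply: continuous_cvg; last exact: cvg_harmonic.
  exact: sqrt_continuous.
Qed.

Let half : fps R := Fps (fun n => (n != 0%N)%:R * (1 / 2)).

Section CentralInverse.
Variable b : fps R.
Hypothesis cb : central * b = 1.

Let b0 : b 0%N = 1.
Proof.
have := congr1 (fun f : fps R => f 0%N) cb.
by rewrite fpsM0 /= bin0 divr1 mul1r.
Qed.

Let tb : theta b = b * (- half).
Proof. by rewrite mulrN; exact: theta_logV cb (theta_rising centralS). Qed.

Lemma series_central_inv n : series b n.+1 = central n.
Proof.
rewrite -fps_onesM; suff -> : fps_ones R * b = central by [].
have t1 : theta (fps_ones R) = fps_ones R * Fps (fun n => (n != 0%N)%:R * 1).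
  by apply: theta_rising => m; rewrite /= !mul1r -natr1.
apply: (@theta_uniq _ _ _ half) => //.
- by rewrite /= mul0r.
- by rewrite fpsM0 b0 mulr1 /= bin0 divr1.
- rewrite (theta_logM t1 tb); congr (_ * _); apply: fpsP => m.
  rewrite fpsB /=; lra.
- exact: theta_rising centralS.
Qed.

Lemma central_inv_coef n : b n.+1 * n.+1%:R = - (central n / 2).
Proof.
rewrite mulr_natr -[LHS]/(theta b n.+1) tb mulrN fpsN mulrC -series_central_inv.
congr (- _); rewrite fpsM big_ord_recl /= !mul0r add0r.
rewrite /series /= big_mkord mulr_suml.
under eq_bigr => i _ do rewrite /bump /= add1n subSS mul1r.
rewrite (reindex_inj rev_ord_inj) /=; apply: eq_bigr => -[i i_n] _ /=.
have -> : (n - (n.+1 - i.+1) = i)%N by lia.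
by rewrite mulrC; lra.
Qed.

Lemma central_inv_summable : abs_summable b.
Proof.
have neg n : b n.+1 <= 0.
  have n1 : 0 < n.+1%:R :> R by [].
  rewrite -(pmulr_lle0 _ n1) central_inv_coef oppr_le0 divr_ge0 //.
  exact: central_ge0.
apply: nondecreasing_is_cvgn.
  by apply: nondecreasing_series => i _ _.
exists 2 => _ [n _ <-]; case: n => [|n]; first by rewrite /series /= big_geq.
have -> : series (fun n => `|b n|) n.+1 = 2 - series b n.+1.
  rewrite /series /= !big_nat_recl // b0 normr1.
  under eq_bigr => i _ do rewrite ler0_norm ?neg //.
  by rewrite sumrN; lra.
by rewrite series_central_inv gerBl central_ge0.
Qed.

Lemma central_inv_sum : limn (series b) = 0.
Proof.
apply/cvg_lim => //; rewrite -cvg_shiftS.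
under eq_fun do rewrite series_central_inv; exact: central_cvg0.
Qed.

Lemma central_inv_small : n%:R * b n @[n --> \oo] --> (0 : R).
Proof.
rewrite -cvg_shiftS; under eq_fun do rewrite mulrC central_inv_coef.
apply: (cvg_eq_lim (oppr0 R)); apply: cvgN.
apply: (cvg_eq_lim (mul0r 2^-1)); apply: cvgM; last exact: cvg_cst.
exact: central_cvg0.
Qed.

End CentralInverse.
End LogDerivative.

(** * Convolutions with the coefficients of an inverse fourth root *)

Section QuarterConvolution.
Variable R : realType.

Definition quarter_fps : fps R := Fps (@quarter_coef R).
Definition quarter_log : fps R := Fps (fun n => (n != 0%N)%:R * (1 / 4)).

Lemma quarter_coefS n :
  quarter_fps n.+1 * n.+1%:R = quarter_fps n * (n%:R + 1 / 4).
Proof.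
rewrite /= /quarter_coef big_ord_recr /= -mulrA; congr (_ * _).
by rewrite divfK // pnatr_eq0.
Qed.

Lemma theta_quarter : theta quarter_fps = quarter_fps * quarter_log.
Proof. exact: theta_rising quarter_coefS. Qed.

Lemma quarter_coef_ge0 n : 0 <= quarter_fps n.
Proof.
rewrite /= /quarter_coef; apply: prodr_ge0 => k _.
by rewrite divr_ge0 // addr_ge0 // divr_ge0.
Qed.

Lemma quarter_coef_le1 n : quarter_fps n <= 1.
Proof.
rewrite /= /quarter_coef; elim: n => [|n IH]; first by rewrite big_ord0.
have a0 := quarter_coef_ge0 n; rewrite /= /quarter_coef in a0.
rewrite big_ord_recr /=; apply: mulr_ile1 => //.
by rewrite ler_pdivrMr // mul1r -[n.+1%:R]natr1; lra.
Qed.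

Lemma sum_quarter n :
  \sum_(k < n.+1) quarter_fps k = 4 * (quarter_fps n.+1 * n.+1%:R).
Proof.
elim: n => [|n IH]; first by rewrite big_ord1 quarter_coefS add0r; lra.
by rewrite big_ord_recr -[X in _ + X = _]/(quarter_fps n.+1) IH [in RHS]quarter_coefS; field.
Qed.

Let r (n : nat) : R := n%:R `^ (1 / 4).

Let r_gt0 n : 0 < r n.+1.
Proof. by apply: powR_gt0. Qed.

Let r_mono m n : (m <= n)%N -> r m <= r n.
Proof.
move=> mn; apply: ge0_ler_powR; rewrite ?nnegrE ?ler_nat //; lra.
Qed.

Let n34E n : n.+1%:R `^ (3 / 4) = n.+1%:R / r n.+1 :> R.
Proof.
apply: (@mulIf _ (r n.+1)); first by rewrite gt_eqF.
rewrite divfK ?gt_eqF // -powRD; last by rewrite pnatr_eq0 implybT.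
have -> : 3 / 4 + 1 / 4 = 1 :> R by lra.
by rewrite powRr1.
Qed.

Let r_inv_cvg0 : (r n.+1)^-1 @[n --> \oo] --> (0 : R).
Proof.
have -> : (fun n => (r n.+1)^-1) = (fun n => (harmonic n) `^ (1 / 4)).
  apply/funext => n.
  by rewrite /r -[LHS]powR_inv1 ?powR_ge0 // powRAC [_ `^ (-1)]powR_inv1.
have q0 : 0 < 1 / 4 :> R by lra.
have /cvg_at_rightP := powR_cvg0 q0; apply; split; last exact: cvg_harmonic.
by move=> i; exact: harmonic_gt0.
Qed.

Let ratio_cvg k : r (n.+1 - k) / r n.+1 @[n --> \oo] --> (1 : R).
Proof.
apply: (@squeeze_cvgr _ _ _ _ (fun n => 1 - k%:R * harmonic n) (fun=> 1)).
- apply: filterS (nbhs_infty_ge k) => n kn.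
  have kn1 : (k <= n.+1)%N by exact: leqW.
  have n1 : 0 < n.+1%:R :> R by [].
  rewrite ler_pdivrMr // mul1r r_mono ?leq_subr // andbT.
  have -> : r (n.+1 - k) / r n.+1 = ((n.+1 - k)%N%:R / n.+1%:R) `^ (1 / 4).
    rewrite powRM ?invr_ge0 // /r; congr (_ * _).
    by rewrite -[LHS]powR_inv1 ?powR_ge0 // powRAC [_ `^ (-1)]powR_inv1.
  apply: (@le_trans _ _ ((n.+1 - k)%N%:R / n.+1%:R)).
    by rewrite /harmonic natrB // mulrBl divff ?gt_eqF.
  apply: ger1_powR; last lra.
  rewrite divr_gt0 ?ltr0n ?subn_gt0 //= ler_pdivrMr // mul1r ler_nat.
  exact: leq_subr.
- apply: (@cvg_eq_lim _ _ (1 - k%:R * 0)); first by rewrite mulr0 subr0.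
  apply: cvgB; first exact: cvg_cst.
  by apply: cvgM; [exact: cvg_cst|exact: cvg_harmonic].
- exact: cvg_cst.
Qed.

(** Toeplitz's theorem for null sequences. *)
Lemma toeplitz0 (v : nat -> nat -> R) (y : nat -> R) (M : R) :
  (forall n, \sum_(k < n.+1) `|v n k| <= M) ->
  (forall k, v n k @[n --> \oo] --> (0 : R)) -> y @ \oo --> (0 : R) ->
  \sum_(k < n.+1) v n k * y k @[n --> \oo] --> (0 : R).
Proof.
move=> vM v0 y0; have M0 : 0 <= M by apply: le_trans (vM 0%N); rewrite sumr_ge0.
apply/cvgr0Pnorm_le => e e0.
pose d := e / 2 / (M + 1); have d0 : 0 < d by rewrite !divr_gt0 //; lra.
have /cvgr0Pnorm_le /(_ d d0) [N _ HN] := y0.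
have head : \sum_(k < N) v n k * y k @[n --> \oo] --> (0 : R).
  have := @cvg_sum_ord R N (fun k n => v n k * y k) (fun k => 0 * y k).
  rewrite [X in _ --> X]big1; last by move=> k _; rewrite mul0r.
  by apply=> k; apply: cvgM; [exact: v0|exact: cvg_cst].
have e20 : 0 < e / 2 by lra.
have /cvgr0Pnorm_le /(_ _ e20) := head.
apply: filterS2 (nbhs_infty_ge N) => n /= Nn Hhead.
rewrite -(big_mkord xpredT (fun k => v n k * y k)) (@big_cat_nat _ _ _ N) //=; last first.
  exact: leqW.
rewrite big_mkord; apply: le_trans (ler_normD _ _) _.
suff : `|\sum_(N <= k < n.+1) v n k * y k| <= e / 2 by lra.
apply: le_trans (ler_norm_sum _ _ _) _.
apply: (@le_trans _ _ (\sum_(N <= k < n.+1) `|v n k| * d)).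
  rewrite !big_nat; apply: ler_sum => k /andP[Nk _]; rewrite normrM.
  by apply: ler_wpM2l => //; exact: HN.
rewrite -mulr_suml; apply: (@le_trans _ _ (M * d)).
  apply: ler_wpM2r; first exact: ltW.
  apply: le_trans _ (vM n).
  rewrite -(big_mkord xpredT (fun k => `|v n k|)) (@big_cat_nat _ _ _ N 0 n.+1) //=; last first.
    exact: leqW.
  by rewrite lerDr sumr_ge0.
have -> : e / 2 = d * (M + 1) by rewrite /d divfK // gt_eqF //; lra.
by rewrite mulrC ler_wpM2l //; lra.
Qed.

(** Multiplying [(1 - x) `^ (- 1 / 4)] by a series with summable small
    coefficients multiplies the asymptotics by its sum.  Writing
    [n = (n - k) + k] in [n `^ (3 / 4) = n / n `^ (1 / 4)] splits the
    convolution into a part with increasing weights [(n - k) `^ (1 / 4)], where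
    Tannery's theorem applies, and one with the null sequence [k b_k]. *)
Lemma quarter_conv_cvg (b : fps R) : abs_summable b ->
  n%:R * b n @[n --> \oo] --> (0 : R) ->
  n%:R `^ (3 / 4) * (quarter_fps * b) n @[n --> \oo] -->
  (Gamma (1 / 4 : R))^-1 * limn (series b).
Proof.
move=> sb b0; have [M M0 aM] := cvg_bounded_seq (@quarter_coef_cvg R).
set a := quarter_fps.
have aM' m : m%:R * a m <= M * r m.
  case: m => [|m]; first by rewrite mul0r mulr_ge0 // powR_ge0.
  have := aM m.+1; rewrite n34E => /(le_trans (ler_norm _)).
  by rewrite mulrAC ler_pdivrMr.
have e34 n : n.+1%:R `^ (3 / 4) * (a * b) n.+1 =
  \sum_(k < n.+2) ((n.+1 - k)%N%:R * a (n.+1 - k)%N / r n.+1) * b k +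
  \sum_(k < n.+2) (a (n.+1 - k)%N / r n.+1) * (k%:R * b k).
  rewrite n34E mulrC mulrC [a * b]mulrC fpsM mulr_sumr -big_split /=.
  apply: eq_bigr => -[k /= kn] _.
  have e : n.+1%:R = (n.+1 - k)%N%:R + k%:R :> R by rewrite -natrD subnK.
  by rewrite [X in X / _]e; field; rewrite gt_eqF.
rewrite -cvg_shiftS; under eq_fun do rewrite e34.
rewrite -[(Gamma (1 / 4 : R))^-1 * limn (series b)]addr0; apply: cvgD.
- have := @tannery R (fun n k => (n - k)%N%:R * a (n - k)%N / r n) b
    (Gamma (1 / 4 : R))^-1 M.
  move=> T; have {T} := T _ _ sb; rewrite -cvg_shiftS; apply.
  + move=> [|n] k kn.
      by rewrite sub0n mul0r mul0r normr0.
    rewrite ger0_norm; last by rewrite !mulr_ge0 ?quarter_coef_ge0 ?invr_ge0 ?powR_ge0.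
    rewrite ler_pdivrMr //; apply: le_trans (aM' _) _.
    by apply: ler_wpM2l => //; exact/r_mono/leq_subr.
  + move=> k; rewrite -(cvg_shiftn k.+1) /=.
    have sub n : (n + k.+1 - k = n.+1)%N by lia.
    have c1 : n.+1%:R `^ (3 / 4) * a n.+1 @[n --> \oo] --> (Gamma (1 / 4 : R))^-1.
      by have := @quarter_coef_cvg R; rewrite -cvg_shiftS.
    have c2 : r n.+1 / r (n + k.+1)%N @[n --> \oo] --> (1 : R).
      have := ratio_cvg k; rewrite -(cvg_shiftn k); apply: cvg_ext => n.
      by rewrite /= addnS; congr (r _ / _); lia.
    apply: (@cvg_ext _ (fun n => (n.+1%:R `^ (3 / 4) * a n.+1) *
      (r n.+1 / r (n + k.+1)%N))).
      move=> n; rewrite sub addnS n34E -[quarter_coef R n.+1]/(a n.+1).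
      by field; rewrite !gt_eqF.
    by apply: (cvg_eq_lim (mulr1 _)); apply: cvgM.
- have := @toeplitz0 (fun n k => a (n - k)%N / r n) (fun k => k%:R * b k)
    (8 * M + 1).
  move=> T; have {T} := T _ _ b0; rewrite -cvg_shiftS; apply.
  + move=> [|n].
      rewrite big_ord1 /r powR0; last by rewrite gt_eqF //; lra.
      by rewrite invr0 mulr0 normr0; lra.
    have -> : \sum_(k < n.+2) `|a (n.+1 - k)%N / r n.+1| =
        (\sum_(k < n.+2) a k) / r n.+1.
      rewrite mulr_suml (reindex_inj rev_ord_inj) /=.
      apply: eq_bigr => -[k kn] _ /=.
      have -> : (n.+1 - (n.+2 - k.+1) = k)%N by lia.
      by rewrite ger0_norm // divr_ge0 ?quarter_coef_ge0 ?powR_ge0.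
    rewrite ler_pdivrMr // sum_quarter.
    have rr : r n.+2 <= 2 * r n.+1.
      apply: (@le_trans _ _ (r (2 * n.+1)%N)); first by apply: r_mono; lia.
      rewrite /r natrM powRM //; apply: ler_wpM2r; first exact: powR_ge0.
      by apply: ler1_powR; lra.
    have := aM' n.+2; have := ler_wpM2l M0 rr; have := r_gt0 n.
    rewrite -/a [n.+2%:R * _]mulrC; lra.
  + move=> k; rewrite -(cvg_shiftn k.+1) /=.
    apply: (@squeeze_cvgr _ _ _ _ (fun=> 0) (fun n => (r (n + k).+1)^-1)).
    * apply: nearW => n; rewrite addnS divr_ge0 ?quarter_coef_ge0 ?powR_ge0 //=.
      by rewrite ler_pdivrMr // mulVf ?gt_eqF // quarter_coef_le1.
    * exact: cvg_cst.
    * by have := r_inv_cvg0; rewrite -(cvg_shiftn k).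
Qed.

Lemma abs_summableD (f g : fps R) :
  abs_summable f -> abs_summable g -> abs_summable (f + g).
Proof.
move=> sf sg.
apply: (@series_le_cvg _ _ (fun n => `|f n| + `|g n|)) => [n|n|n|] //.
- exact: ler_normD.
have -> : series (fun n => `|f n| + `|g n|) =
    (fun n => series (fun n => `|f n|) n + series (fun n => `|g n|) n).
  by apply/funext => n; rewrite /series /= big_split.
exact: is_cvgD.
Qed.

Lemma small_power (u : nat -> R) : n%:R * u n @[n --> \oo] --> (0 : R) ->
  n%:R `^ (3 / 4) * u n @[n --> \oo] --> (0 : R).
Proof.
move=> nu; apply/norm_cvg0P.
apply: (@squeeze_cvgr _ _ _ _ (fun=> 0) (fun n => `|n%:R * u n|)).
- apply: nearW => n; rewrite normr_ge0 /= !normrM; apply: ler_wpM2r => //.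
  case: n => [|n]; first by rewrite powR0 // gt_eqF //; lra.
  rewrite !ger0_norm ?powR_ge0 //; apply: ler1_powR; rewrite ?ler1n //; lra.
- exact: cvg_cst.
- exact/norm_cvg0P.
Qed.

(** The first two terms are [(1 - x) `^ (- 1 / 4) * g'] where the coefficients
    of [g'] are summable and small; the last two have coefficients [o(1 / n)]. *)
Lemma combined_asymptotics (t kap s st b ft bt : fps R) (G : nat -> R) :
  (forall n, 0 <= t n <= n%:R^-1) -> (forall n, `|kap n| <= n%:R^-1) ->
  s 0%N = 1 -> theta s = s * (quarter_log + t) -> central R * b = 1 ->
  st 0%N = 1 -> theta st = st * (kap + t) ->
  ft 0%N = 1 -> theta ft = ft * (kap + kap) -> ft * bt = 1 ->
  (forall n, 4 * G n.+1 = s n.+1 + (s * b) n.+1 + st n.+1 + (st * bt) n.+1) ->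
  n%:R `^ (3 / 4) * G n @[n --> \oo] -->
  (Gamma (1 / 4 : R))^-1 * expR (limn (series (fps_int t))) / 4.
Proof.
move=> t01 kap1 s0 ts cb st0 tst ft0 tft fb GE.
have tC n : `|t n| <= 1 * n%:R^-1.
  by have /andP[t0 t1] := t01 n; rewrite mul1r ger0_norm.
have t0 := small_tau0 tC.
pose g := fps_exp (fps_int t).
have W0 : fps_int t 0%N = 0 by rewrite /= t0 mul0r.
have W_ge0 n : 0 <= fps_int t n.
  by have /andP[h _] := t01 n; rewrite /= mulr_ge0 // invr_ge0.
have sW : cvgn (series (fps_int t)) by exact: normed_cvg (small_tau_summable tC).
have g0 : g 0%N = 1 := fps_exp0 _.
have tg : theta g = g * t by rewrite (theta_exp W0) theta_int.
have sg := small_log_summable tC g0 tg.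
have ng := small_log_coef tC g0 tg.
have sb := central_inv_summable cb.
have nb := central_inv_small cb.
have sE : s = quarter_fps * g.
  apply: (@theta_uniq _ _ _ (quarter_log + t)) => //.
  - by rewrite fpsD t0 /= mul0r addr0.
  - by rewrite s0 fpsM0 g0 mulr1 /= /quarter_coef big_ord0.
  - exact: theta_logM theta_quarter tg.
pose g' := g + g * b.
have lim_gb : series (g * b) @ \oo --> (0 : R).
  apply: (@cvg_eq_lim _ _ (limn (series g) * limn (series b))).
    by rewrite (central_inv_sum cb) mulr0.
  exact: cauchy_product.
have sgb := abs_summableM sg sb.
have sg' : abs_summable g' by exact: abs_summableD.
have lim_g' : limn (series g') = expR (limn (series (fps_int t))).
  apply/cvg_lim => //.
  apply: (@cvg_ext _ (fun n => series g n + series (g * b) n)).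
    by move=> n; rewrite /series /= -big_split.
  apply: (cvg_eq_lim (addr0 _)); apply: cvgD lim_gb.
  exact: (series_fps_exp W0 W_ge0 sW).
have theta_cvg (f : fps R) : n%:R * f n @[n --> \oo] --> (0 : R) ->
    theta f @ \oo --> (0 : R).
  by apply: cvg_ext => n; rewrite thetaE mulr_natl.
have ng' : n%:R * g' n @[n --> \oo] --> (0 : R).
  apply: (@cvg_ext _ (fun n => n%:R * g n + ((theta g * b) n + (theta b * g) n))).
    move=> n; rewrite -fpsD [theta b * g]mulrC -thetaM thetaE fpsD.
    by rewrite mulrDr mulr_natl mulr_natl.
  apply: (cvg_eq_lim (addr0 0)); apply: cvgD => //.
  apply: (cvg_eq_lim (addr0 0)); apply: cvgD.
    apply: (cvg_eq_lim (mul0r (limn (series b)))).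
    by apply: conv_cvg => //; exact: theta_cvg.
  apply: (cvg_eq_lim (mul0r (limn (series g)))).
  by apply: conv_cvg => //; exact: theta_cvg.
have main := quarter_conv_cvg sg' ng'; rewrite lim_g' in main.
have nst : n%:R * st n @[n --> \oo] --> (0 : R).
  apply: (@small_log_coef _ (kap + t) 2) => // n.
  rewrite fpsD (le_trans (ler_normD _ _)) //.
  by have := tC n; have := kap1 n; lra.
have nstbt : n%:R * (st * bt) n @[n --> \oo] --> (0 : R).
  have bt0 : bt 0%N = 1.
    by have := congr1 (fun f : fps R => f 0%N) fb; rewrite fpsM0 ft0 mul1r.
  have tbt : theta bt = bt * (- (kap + kap)).
    by rewrite mulrN; exact: theta_logV fb tft.
  apply: (@small_log_coef _ (kap + t - (kap + kap)) 2) => [n||].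
  - rewrite fpsB !fpsD; have -> : kap n + t n - (kap n + kap n) = t n - kap n.
      by ring.
    rewrite (le_trans (ler_normB _ _)) //.
    by have := tC n; have := kap1 n; lra.
  - by rewrite fpsM0 st0 bt0 mulr1.
  - exact: theta_logM tst tbt.
have := small_power nst; have := small_power nstbt => h2 h1.
rewrite -cvg_shiftS.
apply: (@cvg_ext _ (fun n => (n.+1%:R `^ (3 / 4) * (quarter_fps * g') n.+1 +
  (n.+1%:R `^ (3 / 4) * st n.+1 + n.+1%:R `^ (3 / 4) * (st * bt) n.+1)) / 4)).
  move=> n; rewrite -[RHS]/(n.+1%:R `^ (3 / 4) * G n.+1).
  have -> : G n.+1 = 4 * G n.+1 / 4 by field.
  rewrite GE sE /g' mulrDr fpsD mulrA; ring.
apply: cvgM; last exact: cvg_cst.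
apply: (@cvg_eq_lim _ _ ((Gamma (1 / 4 : R))^-1 *
  expR (limn (series (fps_int t))) + (0 + 0))); first by rewrite !addr0.
apply: cvgD; first by rewrite -cvg_shiftS in main.
by apply: cvgD; [rewrite -cvg_shiftS in h1|rewrite -cvg_shiftS in h2].
Qed.

End QuarterConvolution.

(** * Walks and their areas *)

Section Words.

Definition letter : Type := (bool * bool)%type.
Implicit Types (x : letter) (u v w : seq letter) (h : int).

(* Locked, so that rewriting with associativity does not look inside. *)
Definition step : letter -> int :=
  locked (fun x => (x.1 : nat)%:Z - (x.2 : nat)%:Z).

Lemma stepE x : step x = (x.1 : nat)%:Z - (x.2 : nat)%:Z.
Proof. by rewrite /step -lock. Qed.

Fixpoint hts h w : seq int :=
  if w is x :: w' then (h + step x) :: hts (h + step x) w' else [::].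

Definition height w : int := \sum_(x <- w) step x.
Definition area w : int := \sum_(y <- hts 0 w) y.
Definition bridge w : bool := height w == 0.

(** One less than the number of steps up to the first return to height 0. *)
Definition ret w : nat := index 0 (hts 0 w).
Definition flen w : nat := minn (ret w).+1 (size w).

(** An excursion: a nonempty bridge that only returns to 0 at its end. *)
Definition block w : bool := (ret w).+1 == size w.

(** The bridges of Sinai's problem on integrated random walks. *)
Definition sinai w : bool :=
  bridge w && all (fun j => 0 <= \sum_(y <- take j (hts 0 w)) y) (iota 0 (size w).+1).

Lemma size_hts h w : size (hts h w) = size w.
Proof. by elim: w h => //= x w IH h; rewrite IH. Qed.

Lemma height_cat u v : height (u ++ v) = height u + height v.
Proof. by rewrite /height big_cat. Qed.

Lemma hts_cat h u v : hts h (u ++ v) = hts h u ++ hts (h + height u) v.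
Proof.
elim: u h => [|x u IH] h; first by rewrite /height big_nil addr0.
by rewrite /= IH /height big_cons addrA.
Qed.

Lemma hts_add h w : hts h w = [seq h + y | y <- hts 0 w].
Proof.
elim: w h => //= x w IH h; rewrite add0r IH [hts (step x) w]IH -map_comp.
by congr (_ :: _); apply: eq_map => y /=; rewrite addrA.
Qed.

Lemma nth_hts h w i : (i < size w)%N ->
  nth 0 (hts h w) i = h + height (take i.+1 w).
Proof.
elim: w h i => //= x w IH h [|i] i_w /=.
  by rewrite take0 /height big_seq1.
by rewrite IH // /height [in RHS]big_cons addrA.
Qed.

Lemma area_cat u v : bridge u -> area (u ++ v) = area u + area v.
Proof. by move=> /eqP hu; rewrite /area hts_cat hu addr0 big_cat. Qed.

Lemma bridge_cat u v : bridge u -> bridge (u ++ v) = bridge v.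
Proof. by move=> /eqP hu; rewrite /bridge height_cat hu add0r. Qed.

Lemma blockP w : reflect
  [/\ (0 < size w)%N, bridge w &
     forall i, (0 < i < size w)%N -> height (take i w) != 0] (block w).
Proof.
apply: (iffP eqP) => [e|[w0 /eqP hw nz]].
  have w0 : (0 < size w)%N by rewrite -e.
  have iw : (ret w < size w)%N by rewrite -[X in (_ < X)%N]e.
  split=> //.
    have : nth 0 (hts 0 w) (ret w) = 0.
      by apply: nth_index; rewrite -index_mem size_hts.
    by rewrite nth_hts // e take_size add0r => /eqP.
  move=> [//|i] /= iw'; apply/negP => /eqP h0.
  have := @before_find _ 0 (pred1 0) (hts 0 w) i.
  rewrite -/(index 0 (hts 0 w)) -/(ret w) nth_hts ?(ltn_trans _ iw') //.
  by rewrite h0 addr0 /= eqxx => H; have := H ltac:(lia).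
have mem : 0 \in hts 0 w.
  have := @nth_hts 0 w (size w).-1; rewrite prednK // take_size hw add0r.
  move=> /(_ (leqnn _)) e; rewrite -[X in X \in _]e.
  by rewrite mem_nth // size_hts prednK.
apply/eqP; rewrite eqn_leq; apply/andP; split.
  by rewrite -(size_hts 0 w) index_mem.
rewrite leqNgt; apply/negP => lt.
have := nz (ret w).+1; rewrite lt => /(_ isT) /negP; apply.
have := nth_index 0 mem; rewrite -/(ret w) nth_hts ?add0r; first by move=> ->.
by rewrite ltnW.
Qed.

Lemma block_bridge w : block w -> bridge w.
Proof. by case/blockP. Qed.

(** Between two visits at 0 the height keeps its sign, since it changes by at
    most one at each step. *)
Lemma hts_gt0 h w : 0 < h ->
  all (fun y => 0 < y) (take (index 0 (hts h w)) (hts h w)).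
Proof.
elim: w h => //= x w IH h h0.
have h1 : 0 <= h + step x by case: x => [[] []]; rewrite stepE /=; lia.
have [->|nz] := eqVneq (h + step x) 0; first by rewrite ?eqxx.
have h2 : 0 < h + step x by lia.
by rewrite /= h2 IH.
Qed.

(** This reflects the walk, a step being the difference of its components. *)
Definition neg x : letter := (~~ x.1, ~~ x.2).

Lemma negK : involutive neg.
Proof. by move=> [[] []]. Qed.

Lemma step_neg x : step (neg x) = - step x.
Proof. by case: x => [[] []]; rewrite !stepE. Qed.

Lemma hts_neg h w : hts (- h) (map neg w) = map -%R (hts h w).
Proof.
by elim: w h => //= x w IH h; rewrite step_neg -opprD IH.
Qed.

Lemma hts_neg0 w : hts 0 (map neg w) = map -%R (hts 0 w).
Proof. by rewrite -hts_neg oppr0. Qed.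

Lemma ret_neg w : ret (map neg w) = ret w.
Proof.
rewrite /ret hts_neg0 -[X in index X _]oppr0 index_map //; exact: oppr_inj.
Qed.

Lemma block_neg w : block (map neg w) = block w.
Proof. by rewrite /block ret_neg size_map. Qed.

Lemma flen_neg w : flen (map neg w) = flen w.
Proof. by rewrite /flen ret_neg size_map. Qed.

Lemma height_neg w : height (map neg w) = - height w.
Proof.
rewrite /height big_map -sumrN; apply: eq_bigr => x _; exact: step_neg.
Qed.

Lemma bridge_neg w : bridge (map neg w) = bridge w.
Proof. by rewrite /bridge height_neg oppr_eq0. Qed.

Lemma area_neg w : area (map neg w) = - area w.
Proof. by rewrite /area hts_neg0 big_map sumrN. Qed.

Lemma block_step1 x w : block (x :: w) -> step x = 1 ->
  all (fun y => 0 <= y) (hts 0 (x :: w)).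
Proof.
move=> /eqP e sx; have := @hts_gt0 1 w ltr01.
move: e; rewrite /ret /= add0r sx /= => -[e] /(all_nthP 0) pos.
apply/(all_nthP 0) => i i_w.
have [i_r|r_i] := ltnP i (index (0 : int) (hts 1 w)).
  have := pos i; rewrite nth_take // => /(_ _)/ltW; apply.
  by rewrite size_takel ?index_size.
have : nth (0 : int) (hts 1 w) i = 0; last by move=> ->.
rewrite size_hts in i_w.
have -> : i = index (0 : int) (hts 1 w).
  by apply/eqP; rewrite eqn_leq r_i andbT -ltnS e.
by apply: nth_index; rewrite -index_mem size_hts -[X in (_ < X)%N]e.
Qed.

Lemma block_sign w : block w ->
  all (fun y => 0 <= y) (hts 0 w) \/ all (fun y => y <= 0) (hts 0 w).
Proof.
case: w => [|x w] bw; first by left.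
have [sx|[sx|sx]] : step x = 0 \/ step x = 1 \/ step x = -1.
- by case: x {bw} => [[] []]; rewrite stepE /=; auto.
- left; move/eqP: bw; rewrite /ret /= add0r sx /= => -[].
  by case: w.
- by left; exact: block_step1.
- right; have := @block_step1 (neg x) (map neg w).
  rewrite -map_cons block_neg step_neg sx => /(_ bw erefl).
  rewrite hts_neg0 all_map; apply: sub_all => y /=.
  by rewrite oppr_ge0.
Qed.

(** The last step of an excursion cannot leave a negative height downwards, nor
    be flat unless it is the only step. *)
Lemma block_last_ge0 w : block w -> (last (false, false) w).2 ->
  all (fun y => 0 <= y) (hts 0 w).
Proof.
case/lastP: w => [//|w x]; rewrite last_rcons => bw x2.
have [//|np] := block_sign bw.
have /blockP [_ /eqP hw nz] := bw.
have hx : height w = - step x.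
  apply/eqP; rewrite -addr_eq0; apply/eqP.
  by rewrite -hw -cats1 height_cat /height big_seq1.
have h0 : 0 <= height w.
  by rewrite hx; case: x x2 {bw np hw nz hx} => [[] []] //; rewrite stepE.
case: (lastP w) hx h0 np bw nz => [|w' y] hx h0 np bw nz.
  by move: hx; rewrite /height big_nil /= => e; rewrite add0r -[step x]opprK -e.
set w1 := rcons w' y in np nz h0 *.
have sw : (0 < size w1)%N by rewrite size_rcons.
suff : height w1 = 0.
  move=> h00; have := nz (size w1); rewrite size_rcons sw ltnSn -cats1 take_size_cat //.
  by rewrite h00 eqxx => /(_ isT).
apply/eqP; rewrite eq_le h0 andbT.
have lt : (size w' < size (rcons w1 x))%N by rewrite !size_rcons.
move/(all_nthP 0): np => /(_ (size w')); rewrite size_hts => /(_ lt).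
by rewrite nth_hts // add0r -cats1 take_size_cat // size_rcons.
Qed.

Lemma prefix_sum_ge0 (l : seq int) (z : int) : 0 <= z -> 0 <= z + \sum_(y <- l) y ->
  all (fun y => 0 <= y) l \/ all (fun y => y <= 0) l ->
  forall j, 0 <= z + \sum_(y <- take j l) y.
Proof.
move=> z0 zl [|] /allP sg j.
  rewrite addr_ge0 // big_seq sumr_ge0 // => y yl; apply: sg.
  exact: mem_take yl.
apply: le_trans zl _; rewrite lerD2l -{1}(cat_take_drop j l) big_cat /=.
rewrite gerDl big_seq sumr_le0 // => y yl; apply: sg.
exact: mem_drop yl.
Qed.

Lemma sinaiP w : reflect
  (bridge w /\ forall j, 0 <= \sum_(y <- take j (hts 0 w)) y) (sinai w).
Proof.
apply: (iffP andP) => -[bw H]; split=> //.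
  move=> j; have [jw|wj] := leqP j (size w).
    by move/allP: H => /(_ j); apply; rewrite mem_iota.
  move/allP: H => /(_ (size w)); rewrite !take_oversize ?size_hts // 1?ltnW //.
  by apply; rewrite mem_iota /=.
by apply/allP => j _.
Qed.

Lemma sinai_area w : sinai w -> 0 <= area w.
Proof. by case/sinaiP => _ /(_ (size w)); rewrite take_oversize ?size_hts. Qed.

(** By monotonicity of the area during an excursion, only its value at the
    end matters. *)
Lemma sinai_cat u v : bridge u -> block v ->
  sinai (u ++ v) = sinai u && (0 <= area u + area v).
Proof.
move=> bu bv; have buv : bridge (u ++ v) by rewrite bridge_cat // block_bridge.
apply/idP/andP => [suv|[su auv]].
  split; last by rewrite -area_cat // sinai_area.
  apply/sinaiP; split=> // j; case/sinaiP: suv => _ /(_ (minn j (size u))).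
  rewrite hts_cat takel_cat ?size_hts ?geq_minr //.
  by have [ju|uj] := leqP j (size u); rewrite // !take_oversize ?size_hts // ltnW.
apply/sinaiP; split=> // j.
rewrite hts_cat (eqP bu) addr0 take_cat size_hts; case: ltnP => ju.
  by case/sinaiP: su.
rewrite big_cat; apply: prefix_sum_ge0 => //; first exact: sinai_area su.
exact: block_sign.
Qed.

Lemma sinai_cat_up u v : bridge u -> block v -> (last (false, false) v).2 ->
  sinai (u ++ v) = sinai u.
Proof.
move=> bu bv v2; rewrite sinai_cat //; apply: andb_idr => su.
apply: addr_ge0; first exact: sinai_area.
rewrite /area big_seq; apply: sumr_ge0 => y yv.
exact: (allP (block_last_ge0 bv v2)).
Qed.

(** * Enumeration of words *)

Definition letters : seq letter :=
  [:: (false, false); (false, true); (true, false); (true, true)].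

Fixpoint words (n : nat) : seq (seq letter) :=
  if n is n'.+1 then [seq x :: w | x <- letters, w <- words n'] else [:: [::]].

#[global] Arguments words : simpl never.

Lemma mem_words n w : (w \in words n) = (size w == n).
Proof.
elim: n w => [|n IH] w; first by rewrite inE; case: w.
apply/idP/idP => [|].
  by case/allpairsP => -[x v] /= [_ + ->]; rewrite IH.
case: w => // x w; rewrite eqSS -IH => wn.
by apply/allpairsP; exists (x, w); split=> //=; case: x => [[] []].
Qed.

Lemma words_uniq n : uniq (words n).
Proof.
elim: n => [//|n IH]; apply: allpairs_uniq => //.
by move=> [x u] [y v] _ _ /= [-> ->].
Qed.

Section BigWords.
Variables (T : Type) (idx : T) (op : Monoid.com_law idx).

Lemma big_words_cat m k (F : seq letter -> T) :
  \big[op/idx]_(w <- words (m + k)) F w =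
  \big[op/idx]_(u <- words m) \big[op/idx]_(v <- words k) F (u ++ v).
Proof.
elim: m F => [|m IH] F; first by rewrite big_seq1.
rewrite addSn [LHS]big_allpairs_dep [RHS]big_allpairs_dep.
by apply: eq_bigr => x _; rewrite IH.
Qed.

Lemma big_words_split n (P : pred (seq letter)) (key : seq letter -> nat) F :
  (forall w, size w = n -> P w -> (key w <= n)%N) ->
  \big[op/idx]_(w <- words n | P w) F w =
  \big[op/idx]_(k < n.+1) \big[op/idx]_(u <- words k)
    \big[op/idx]_(v <- words (n - k) | P (u ++ v) && (key (u ++ v) == k))
      F (u ++ v).
Proof.
move=> keyP.
transitivity (\big[op/idx]_(k < n.+1)
    \big[op/idx]_(w <- words n | P w && (key w == k)) F w).
  rewrite (exchange_big_dep P) /=; last by move=> k w _ /andP[].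
  rewrite big_seq_cond [RHS]big_seq_cond; apply: eq_bigr => w /andP[].
  rewrite mem_words => /eqP wn Pw.
  have kn : (key w < n.+1)%N by rewrite ltnS; exact: keyP.
  rewrite (big_pred1 (Ordinal kn)) // => k.
  by rewrite Pw /= eq_sym; apply/eqP/eqP => [e|->] //; apply: val_inj.
apply: eq_bigr => k _.
have {1}-> : n = (k + (n - k))%N by rewrite subnKC // -ltnS.
rewrite big_mkcond big_words_cat; apply: eq_bigr => u _.
by rewrite [RHS]big_mkcond.
Qed.

Lemma big_words_neg n (P : pred (seq letter)) F :
  \big[op/idx]_(w <- words n | P w) F w =
  \big[op/idx]_(w <- words n | P (map neg w)) F (map neg w).
Proof.
rewrite -(big_map (map neg) P F); apply: perm_big.
have negmK : involutive (map neg) by move=> w; rewrite mapK //; exact: negK.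
apply: uniq_perm; rewrite ?words_uniq ?map_inj_uniq ?words_uniq //.
  exact: inv_inj.
move=> w; rewrite mem_words; apply/idP/mapP => [wn|[v + ->]].
  by exists (map neg w); rewrite ?negmK // mem_words size_map.
by rewrite mem_words size_map.
Qed.

End BigWords.

Definition last0 w : nat := \max_(j < size w | height (take j w) == 0) j.

Lemma last0_cat u v : (0 < size (u ++ v))%N ->
  bridge (u ++ v) && (last0 (u ++ v) == size u) = bridge u && block v.
Proof.
move=> s0; apply/andP/andP => [[buv /eqP lu]|[bu bv]].
  have [j hj ej] : exists2 j : 'I_(size (u ++ v)),
      height (take j (u ++ v)) == 0 & last0 (u ++ v) = j.
    have := @eq_bigmax_cond _ [pred j : 'I_(size (u ++ v)) |
      height (take j (u ++ v)) == 0] (fun j => j : nat).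
    case; last by move=> j hj ej; exists j.
    by apply/card_gt0P; exists (Ordinal s0); rewrite inE /= take0 /height big_nil.
  have uj : j = size u :> nat by rewrite -ej.
  have bu : bridge u by move: hj; rewrite uj take_size_cat.
  split=> //; apply/blockP; split.
  - by have := ltn_ord j; rewrite uj size_cat; lia.
  - by rewrite -(bridge_cat v bu).
  move=> i /andP[i0 iv]; apply/negP => hi.
  have iuv : (size u + i < size (u ++ v))%N by rewrite size_cat ltn_add2l.
  have := @leq_bigmax_cond _ [pred j : 'I_(size (u ++ v)) |
      height (take j (u ++ v)) == 0] (fun j => j : nat) (Ordinal iuv).
  rewrite /= -/(last0 (u ++ v)) lu takeD take_size_cat // drop_size_cat //.
  by rewrite height_cat (eqP hi) addr0 => /(_ bu); lia.
split; first by rewrite bridge_cat // block_bridge.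
have /blockP [v0 _ nz] := bv.
rewrite eqn_leq; apply/andP; split.
  apply/bigmax_leqP => j hj; rewrite leqNgt; apply/negP => uj.
  apply: (negP (nz (j - size u)%N _)).
    have : (j < size u + size v)%N by rewrite -size_cat.
    by lia.
  have e : (size u + (j - size u) = j)%N by rewrite subnKC // ltnW.
  move: hj; rewrite -{1}e takeD take_size_cat // drop_size_cat //.
  by rewrite height_cat (eqP bu) add0r.
have uuv : (size u < size (u ++ v))%N by rewrite size_cat; lia.
have := @leq_bigmax_cond _ [pred j : 'I_(size (u ++ v)) |
      height (take j (u ++ v)) == 0] (fun j => j : nat) (Ordinal uuv).
by apply; rewrite /= take_size_cat.
Qed.

Lemma flen_cat u v : (0 < size (u ++ v))%N ->
  bridge (u ++ v) && (flen (u ++ v) == size u) = block u && bridge v.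
Proof.
move=> s0; have [u0|u0] := posnP (size u).
  have -> : u = [::] by case: u u0 {s0}.
  have f0 : (0 < flen v)%N.
    rewrite /flen leq_min /=; have u_nil : u = [::] by case: u u0 {s0}.
    by rewrite u_nil in s0.
  by rewrite cat0s /= gtn_eqF // andbF.
have sh : (ret (u ++ v)).+1 = size u -> (ret u).+1 = size u.
  rewrite /ret hts_cat index_cat; case: ifP => // _.
  by rewrite size_hts; lia.
have sh' : (ret u).+1 = size u -> ret (u ++ v) = ret u.
  move=> e; rewrite /ret hts_cat index_cat -index_mem size_hts.
  by rewrite -/(ret u) -[X in (_ < X)%N]e ltnSn.
apply/andP/andP => [[buv /eqP fu]|[bu bv]].
  have bu : block u.
    rewrite /block; move: fu; rewrite /flen size_cat /minn.
    case: ifP => [_ /sh ->|nr e]; first by [].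
    have v0 : v = [::] by case: (v) e => // x w /=; lia.
    move: buv nr; rewrite v0 cats0 => buv.
    have [w0 mem] : (0 < size u)%N /\ 0 \in hts 0 u.
      split=> //; have := @nth_hts 0 u (size u).-1.
      rewrite prednK // take_size (eqP buv) add0r leqnn => /(_ isT) e'.
      by rewrite -[X in X \in _]e' mem_nth // size_hts prednK.
    move: mem; rewrite -index_mem size_hts -/(ret u) addn0; lia.
  by split=> //; rewrite -(bridge_cat v (block_bridge bu)).
split; first by rewrite bridge_cat // block_bridge.
rewrite /flen sh'; last exact/eqP.
by rewrite (eqP bu) size_cat (minn_idPl _) // leq_addr.
Qed.

End Words.

(** * The factorization of bridges *)

Section Weights.
Implicit Types (u v w : seq letter).

Definition posn (y : int) : nat := if y is Posz n then n else 0.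
Definition negn (y : int) : nat := if y is Negz n then n.+1 else 0.
Definition posa w : nat := (\sum_(y <- hts 0%R w) posn y)%N.
Definition nega w : nat := (\sum_(y <- hts 0%R w) negn y)%N.

Lemma posa_cat u v : bridge u -> posa (u ++ v) = (posa u + posa v)%N.
Proof. by move=> /eqP hu; rewrite /posa hts_cat hu addr0 big_cat. Qed.

Lemma nega_cat u v : bridge u -> nega (u ++ v) = (nega u + nega v)%N.
Proof. by move=> /eqP hu; rewrite /nega hts_cat hu addr0 big_cat. Qed.

Lemma areaE w : area w = (posa w)%:Z - (nega w)%:Z.
Proof.
rewrite /area /posa /nega; elim: (hts 0 w) => [|y l IH]; first by rewrite !big_nil.
rewrite !big_cons IH !PoszD.
have e : y = (posn y)%:Z - (negn y)%:Z by case: y => n //=; lia.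
rewrite {1}e; lia.
Qed.

Lemma posa_neg w : posa (map neg w) = nega w.
Proof.
by rewrite /posa /nega hts_neg0 big_map; apply: eq_bigr => -[[|n]|n] _.
Qed.

Lemma nega_neg w : nega (map neg w) = posa w.
Proof.
by rewrite /posa /nega hts_neg0 big_map; apply: eq_bigr => -[[|n]|n] _.
Qed.

(** Two variables record the positive and the negative part of the area, which
    keeps Laurent polynomials out of the way. *)
Definition mon w : {poly {poly int}} := ('X^(posa w))%:P * 'X^(nega w).

Lemma mon_cat u v : bridge u -> mon (u ++ v) = mon u * mon v.
Proof.
move=> bu; rewrite /mon posa_cat // nega_cat // !exprD polyCM.
by rewrite mulrACA.
Qed.

Lemma coef_mon w i j :
  (mon w)`_j`_i = ((j == nega w) && (i == posa w))%:R.
Proof.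
rewrite /mon coefCM coefXn; case: (j == nega w) => /=.
  by rewrite mulr1 coefXn.
by rewrite mulr0 coef0.
Qed.

Definition nonneg_supp (p : {poly {poly int}}) : Prop :=
  forall i j, (i < j)%N -> p`_j`_i = 0.
Definition neg_supp (p : {poly {poly int}}) : Prop :=
  forall i j, (j <= i)%N -> p`_j`_i = 0.

Lemma nonneg_suppB p q : nonneg_supp p -> nonneg_supp q -> nonneg_supp (p - q).
Proof. by move=> hp hq i j ij; rewrite !coefB hp // hq // subr0. Qed.

Lemma neg_suppB p q : neg_supp p -> neg_supp q -> neg_supp (p - q).
Proof. by move=> hp hq i j ij; rewrite !coefB hp // hq // subr0. Qed.

Lemma coef2M (p q : {poly {poly int}}) i j : (p * q)`_j`_i =
  \sum_(k < j.+1) \sum_(l < i.+1) p`_k`_l * q`_(j - k)`_(i - l).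
Proof. by rewrite coefM coef_sum; apply: eq_bigr => k _; rewrite coefM. Qed.

Lemma nonneg_suppM p q : nonneg_supp p -> nonneg_supp q -> nonneg_supp (p * q).
Proof.
move=> hp hq i j ij; rewrite coef2M big1 // => k _; rewrite big1 // => l _.
have [lk|kl] := ltnP l k; first by rewrite hp ?mul0r.
rewrite hq ?mulr0 //; have := ltn_ord k; have := ltn_ord l; lia.
Qed.

Lemma neg_suppM p q : neg_supp p -> neg_supp q -> neg_supp (p * q).
Proof.
move=> hp hq i j ij; rewrite coef2M big1 // => k _; rewrite big1 // => l _.
have [kl|lk] := leqP k l; first by rewrite hp ?mul0r.
rewrite hq ?mulr0 //; have := ltn_ord k; have := ltn_ord l; lia.
Qed.

Lemma supp_disjoint p : nonneg_supp p -> neg_supp p -> p = 0.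
Proof.
move=> h1 h2; apply/polyP => j; apply/polyP => i; rewrite !coef0.
by have [/h1|/h2] := ltnP i j.
Qed.

Lemma nonneg_supp_sum n (P : pred (seq letter)) (f : seq letter -> nat) :
  (forall w, P w -> 0 <= area w) ->
  nonneg_supp (\sum_(w <- words n | P w) mon w *+ f w).
Proof.
move=> Pa i j ij; rewrite !coef_sum big1 // => w /Pa.
rewrite !coefMn coef_mon areaE subr_ge0 lez_nat => h.
case: eqP => [ej|] /=; last by rewrite mul0rn.
by case: eqP => [ei|]; rewrite ?mul0rn //; lia.
Qed.

Lemma neg_supp_sum n (P : pred (seq letter)) (f : seq letter -> nat) :
  (forall w, P w -> area w < 0) ->
  neg_supp (\sum_(w <- words n | P w) mon w *+ f w).
Proof.
move=> Pa i j ij; rewrite !coef_sum big1 // => w /Pa.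
rewrite !coefMn coef_mon areaE subr_lt0 ltz_nat => h.
case: eqP => [ej|] /=; last by rewrite mul0rn.
by case: eqP => [ei|]; rewrite ?mul0rn //; lia.
Qed.

Lemma big_words_conv (A : comNzRingType) n (P Pu Pv : pred (seq letter))
    (key : seq letter -> nat) (F G H : seq letter -> A) :
  (forall w, size w = n -> P w -> (key w <= n)%N) ->
  (forall u v, size (u ++ v) = n ->
     P (u ++ v) && (key (u ++ v) == size u) = Pu u && Pv v) ->
  (forall u v, Pu u -> Pv v -> H (u ++ v) = F u * G v) ->
  \sum_(w <- words n | P w) H w = \sum_(k < n.+1)
    (\sum_(u <- words k | Pu u) F u) * (\sum_(v <- words (n - k) | Pv v) G v).
Proof.
move=> keyP PP HH; rewrite (big_words_split _ _ keyP); apply: eq_bigr => k _.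
rewrite big_distrl /= [RHS]big_mkcond [LHS]big_seq [RHS]big_seq.
apply: eq_bigr => u; rewrite mem_words => /eqP uk.
transitivity (\sum_(v <- words (n - k) | Pu u && Pv v) F u * G v).
  rewrite [LHS]big_seq_cond [RHS]big_seq_cond; apply: eq_big => [v|v].
    rewrite mem_words; apply: andb_id2l => /eqP vk.
    rewrite -PP ?uk // size_cat uk vk subnKC // -ltnS; exact: ltn_ord.
  rewrite mem_words => /and3P[/eqP vk p1 p2].
  have : Pu u && Pv v.
    rewrite -PP ?uk ?p1 //  size_cat uk vk subnKC // -ltnS; exact: ltn_ord.
  by case/andP; exact: HH.
case: (Pu u) => /=; last by rewrite big_pred0.
by rewrite big_distrr.
Qed.

(** * The generating functions *)

Definition bridges_fps : fps {poly {poly int}} :=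
  Fps (fun n => \sum_(w <- words n | bridge w) mon w).
Definition blocks_fps : fps {poly {poly int}} :=
  Fps (fun n => \sum_(w <- words n | block w) mon w).
Definition sinai_fps : fps {poly {poly int}} :=
  Fps (fun n => \sum_(w <- words n | sinai w) mon w).
Definition flen_nonneg_fps : fps {poly {poly int}} :=
  Fps (fun n => \sum_(w <- words n | bridge w && (0 <= area w)) mon w *+ flen w).
Definition flen_neg_fps : fps {poly {poly int}} :=
  Fps (fun n => \sum_(w <- words n | bridge w && (area w < 0)) mon w *+ flen w).

Lemma mon_nil : mon [::] = 1.
Proof. by rewrite /mon /posa /nega !big_nil !expr0 mul1r. Qed.

Lemma bridge_nil : bridge [::]. Proof. by rewrite /bridge /height big_nil. Qed.

Lemma area_nil : area [::] = 0. Proof. by rewrite /area big_nil. Qed.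

Lemma bridges_fps0 : bridges_fps 0%N = 1.
Proof. by rewrite /= big_mkcond big_seq1 bridge_nil mon_nil. Qed.

Lemma blocks_fps0 : blocks_fps 0%N = 0.
Proof. by rewrite /= big_mkcond big_seq1. Qed.

Lemma sinai_nil : sinai [::].
Proof. by rewrite /sinai bridge_nil /= big_nil. Qed.

Lemma sinai_fps0 : sinai_fps 0%N = 1.
Proof. by rewrite /= big_mkcond big_seq1 sinai_nil mon_nil. Qed.

Lemma flen_le w : (flen w <= size w)%N.
Proof. exact: geq_minr. Qed.

(** First-passage decomposition. *)
Lemma bridges_blocks : bridges_fps * (1 - blocks_fps) = 1.
Proof.
suff e : bridges_fps = 1 + blocks_fps * bridges_fps.
  by rewrite mulrBr mulr1 {1}e mulrC addrK.
apply: fpsP => -[|n].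
  by rewrite fpsD fps1 fpsM0 bridges_fps0 blocks_fps0 mul0r addr0.
rewrite fpsD fps1 add0r fpsM [LHS]/=.
apply: (@big_words_conv _ n.+1 bridge block bridge flen mon mon mon) => [w <- _|u v uvn|u v bu _].
- exact: flen_le.
- by rewrite flen_cat // uvn.
- by rewrite mon_cat // block_bridge.
Qed.

Lemma theta_blocks_bridges :
  theta blocks_fps * bridges_fps = flen_nonneg_fps + flen_neg_fps.
Proof.
apply: fpsP => -[|n].
  rewrite fpsM0 thetaE mulr0n mul0r fpsD /= big_mkcond big_seq1 [X in _ + X]big_mkcond big_seq1.
  have -> : flen [::] = 0%N by rewrite /flen minn0.
  by rewrite !mulr0n !if_same addr0.
rewrite fpsD [RHS]/=.
have -> : \sum_(w <- words n.+1 | bridge w && (0 <= area w)) mon w *+ flen w +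
    \sum_(w <- words n.+1 | bridge w && (area w < 0)) mon w *+ flen w =
    \sum_(w <- words n.+1 | bridge w) mon w *+ flen w.
  rewrite !(big_mkcond (fun w => bridge w && _)) [RHS]big_mkcond -big_split.
  apply: eq_bigr => w _ /=; case: (bridge w); rewrite /= ?addr0 //.
  by case: ltP; rewrite ?addr0 ?add0r.
rewrite fpsM; symmetry.
rewrite (@big_words_conv _ n.+1 bridge block bridge flen
  (fun u => mon u *+ size u) mon).
- apply: eq_bigr => k _; congr (_ * _); rewrite thetaE /= -sumrMnl.
  rewrite big_seq_cond [RHS]big_seq_cond; apply: eq_bigr => u.
  by rewrite mem_words => /andP[/eqP-> _].
- by move=> w <- _; exact: flen_le.
- by move=> u v uvn; rewrite flen_cat // uvn.
- move=> u v bu bv.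
  have uv0 : (0 < size (u ++ v))%N by case: u bu.
  have : block u && bridge v by rewrite bu.
  rewrite -flen_cat // => /andP[_ /eqP ->].
  by rewrite mon_cat ?block_bridge // mulrnAl.
Qed.

(** The initial bridge before the last excursion. *)
Definition init0 w := take (last0 w) w.

Lemma last0_lt w : (0 < size w)%N -> (last0 w < size w)%N.
Proof.
by move=> w0; rewrite -(prednK w0) ltnS; apply/bigmax_leqP => j _; have := ltn_ord j; lia.
Qed.

Lemma init0_spec w : (0 < size w)%N -> bridge w ->
  bridge (init0 w) && block (drop (last0 w) w).
Proof.
move=> w0 bw; rewrite -last0_cat /init0 cat_take_drop // bw.
by rewrite size_takel ?eqxx // ltnW // last0_lt.
Qed.

Lemma init0_cat u v : (0 < size (u ++ v))%N -> bridge u -> block v ->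
  init0 (u ++ v) = u.
Proof.
move=> s0 bu bv; have : bridge u && block v by rewrite bu.
by rewrite -last0_cat // => /andP[_ /eqP e]; rewrite /init0 e take_size_cat.
Qed.

Lemma sinai_init0 w : (0 < size w)%N -> bridge w ->
  sinai w = sinai (init0 w) && (0 <= area w).
Proof.
move=> w0 bw; have /andP[bu bv] := init0_spec w0 bw.
by rewrite -{1 3}(cat_take_drop (last0 w) w) sinai_cat // area_cat.
Qed.

Lemma sinai_blocks n : (sinai_fps * blocks_fps) n.+1 =
  \sum_(w <- words n.+1 | bridge w && sinai (init0 w)) mon w.
Proof.
rewrite fpsM; symmetry.
apply: (@big_words_conv _ n.+1 (fun w => bridge w && sinai (init0 w)) sinai block
  last0 mon mon mon).
- by move=> w wn _; rewrite ltnW // -wn last0_lt // wn.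
- move=> u v uvn; have s0 : (0 < size (u ++ v))%N by rewrite uvn.
  apply/idP/idP => [/andP[/andP[b si] l]|/andP[su bv]].
    have : bridge (u ++ v) && (last0 (u ++ v) == size u) by rewrite b.
    rewrite last0_cat // => /andP[bu bv].
    by rewrite init0_cat // in si; rewrite si.
  have /andP[bu _] := su.
  rewrite init0_cat // su andbT last0_cat // bu //.
- by move=> u v /andP[bu _] _; rewrite mon_cat.
Qed.

(** The factorization [S (1 - B)] of bridges with nonnegative partial areas. *)
Lemma sinai_blocksB n : neg_supp ((sinai_fps * (1 - blocks_fps)) n.+1).
Proof.
rewrite mulrBr mulr1 fpsB sinai_blocks [X in X - _]/=.
have -> : \sum_(w <- words n.+1 | bridge w && sinai (init0 w)) mon w =
   \sum_(w <- words n.+1 | sinai w) mon w +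
   \sum_(w <- words n.+1 | [&& bridge w, sinai (init0 w) & area w < 0]) mon w *+ 1.
  rewrite (bigID (fun w => 0 <= area w)) /=; congr (_ + _).
    rewrite [LHS]big_seq_cond [RHS]big_seq_cond; apply: eq_bigl => w.
    rewrite mem_words; apply: andb_id2l => /eqP wn.
    have [bw|bw] := boolP (bridge w); last by rewrite /sinai (negPf bw).
    by rewrite (sinai_init0 _ bw) // wn.
  by apply: eq_big => [w|w _]; rewrite ?mulr1n // -andbA -ltNge.
rewrite opprD addrA subrr add0r => i j ij.
rewrite !coefN; apply/eqP; rewrite oppr_eq0; apply/eqP.
by apply: neg_supp_sum ij => w /and3P[].
Qed.

(** The analogue for areas of the Sparre Andersen identity. *)
Lemma theta_sinai : theta sinai_fps = sinai_fps * flen_nonneg_fps.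
Proof.
have supp0 : forall i j, (0 : {poly {poly int}})`_j`_i = 0.
  by move=> i j; rewrite !coef0.
apply: (@wiener_hopf _ nonneg_supp neg_supp nonneg_suppB nonneg_suppM
  neg_suppB neg_suppM _ _ supp_disjoint _ _ bridges_fps blocks_fps _ flen_neg_fps
  sinai_fps0 _ erefl bridges_blocks theta_blocks_bridges).
- by move=> i j _.
- by move=> i j _.
- by rewrite fpsM0 fpsB blocks_fps0 sinai_fps0 fps1 subr0 mulr1.
- by rewrite /= big_mkcond big_seq1 /= area_nil ltxx andbF.
- move=> n /=; under eq_bigr => w _ do rewrite -[mon w]mulr1n.
  by apply: nonneg_supp_sum => w; exact: sinai_area.
- exact: sinai_blocksB.
- by move=> n; apply: nonneg_supp_sum => w /andP[].
- by move=> n; apply: neg_supp_sum => w /andP[].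
Qed.

End Weights.

(** * Walks signed by the parity of the area *)

Lemma theta_bridges :
  theta bridges_fps = bridges_fps * (theta blocks_fps * bridges_fps).
Proof.
have := congr1 (@theta _) bridges_blocks.
rewrite thetaM thetaB !theta1 sub0r => /eqP.
rewrite mulrN subr_eq0 => /eqP e.
have -> : theta bridges_fps =
    theta bridges_fps * (bridges_fps * (1 - blocks_fps)).
  by rewrite bridges_blocks mulr1.
have -> : theta bridges_fps * (bridges_fps * (1 - blocks_fps)) =
    theta bridges_fps * (1 - blocks_fps) * bridges_fps by ring.
by rewrite e; ring.
Qed.

Section Evaluation.
Variable e : int.
Hypothesis e2 : e * e = 1.
Implicit Types (u v w : seq letter).

Definition ev_hom : {rmorphism {poly {poly int}} -> int} :=
  horner_eval e \o horner_eval e%:P.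

Definition ev w : int := e ^+ (posa w + nega w).

Lemma ev_mon w : ev_hom (mon w) = ev w.
Proof.
rewrite /= /horner_eval /mon hornerM hornerC hornerXn hornerM hornerXn.
by rewrite horner_exp hornerC -exprD.
Qed.

Lemma ev_neg w : ev (map neg w) = ev w.
Proof. by rewrite /ev posa_neg nega_neg addnC. Qed.

Lemma ev_cat u v : bridge u -> ev (u ++ v) = ev u * ev v.
Proof. by move=> bu; rewrite -!ev_mon mon_cat // rmorphM. Qed.

Lemma ev_area0 w : area w = 0 -> ev w = 1.
Proof.
rewrite areaE => /eqP; rewrite subr_eq0 => /eqP[a0].
by rewrite /ev a0 addnn -mul2n exprM expr2 e2 expr1n.
Qed.

Definition ev_fps : fps {poly {poly int}} -> fps int := fps_map ev_hom 1.

Lemma ev_fps_sum n (P : pred (seq letter)) :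
  ev_hom (\sum_(w <- words n | P w) mon w) = \sum_(w <- words n | P w) ev w.
Proof. by rewrite rmorph_sum; apply: eq_bigr => w _; exact: ev_mon. Qed.

Lemma ev_sinaiE n : ev_fps sinai_fps n = \sum_(w <- words n | sinai w) ev w.
Proof. by rewrite fps_mapE expr1n mulr1 ev_fps_sum. Qed.

Lemma ev_blocksE n : ev_fps blocks_fps n = \sum_(w <- words n | block w) ev w.
Proof. by rewrite fps_mapE expr1n mulr1 ev_fps_sum. Qed.

Lemma ev_bridgesE n : ev_fps bridges_fps n = \sum_(w <- words n | bridge w) ev w.
Proof. by rewrite fps_mapE expr1n mulr1 ev_fps_sum. Qed.

Definition ev_log : fps int := ev_fps (theta blocks_fps * bridges_fps).

Lemma theta_ev_bridges :
  theta (ev_fps bridges_fps) = ev_fps bridges_fps * ev_log.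
Proof. by rewrite -fps_map_theta theta_bridges fps_mapM. Qed.

Lemma ev_bridges_blocks : ev_fps bridges_fps * (1 - ev_fps blocks_fps) = 1.
Proof.
by rewrite -[RHS](fps_map1 ev_hom 1) -bridges_blocks fps_mapM fps_mapB fps_map1.
Qed.

Lemma theta_ev_sinai :
  theta (ev_fps sinai_fps) = ev_fps sinai_fps * ev_fps flen_nonneg_fps.
Proof. by rewrite -fps_map_theta theta_sinai fps_mapM. Qed.

Lemma ev_flen_sum n (P : pred (seq letter)) :
  ev_hom (\sum_(w <- words n | P w) mon w *+ flen w) =
  \sum_(w <- words n | P w) ev w *+ flen w.
Proof.
by rewrite rmorph_sum; apply: eq_bigr => w _; rewrite rmorphMn; congr (_ *+ _); exact: ev_mon.
Qed.

(** By symmetry, bridges of positive area contribute half of what all the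
    bridges of nonzero area do. *)
Lemma ev_flen_nonneg n : 2 * ev_fps flen_nonneg_fps n =
  ev_log n + (\sum_(w <- words n | bridge w && (area w == 0)) flen w)%N%:Z.
Proof.
have -> : ev_log n = ev_fps flen_nonneg_fps n + ev_fps flen_neg_fps n.
  by rewrite /ev_log theta_blocks_bridges /ev_fps fps_mapD.
rewrite !fps_mapE expr1n !mulr1 [flen_nonneg_fps n]/= [flen_neg_fps n]/=.
rewrite !ev_flen_sum.
have -> : \sum_(w <- words n | bridge w && (area w < 0)) ev w *+ flen w =
   \sum_(w <- words n | bridge w && (0 < area w)) ev w *+ flen w.
  rewrite big_words_neg; apply: eq_big => [w|w _].
    by rewrite bridge_neg area_neg oppr_lt0.
  by rewrite ev_neg flen_neg.
have -> : (\sum_(w <- words n | bridge w && (area w == 0)) flen w)%N%:Z =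
   \sum_(w <- words n | bridge w && (area w == 0)) ev w *+ flen w.
  rewrite -[LHS]natz natr_sum; apply: eq_bigr => w /andP[_ /eqP a0].
  by rewrite ev_area0.
rewrite mulr2n mulrDl !mul1r -addrA; congr (_ + _).
rewrite !(big_mkcond (fun w => bridge w && _)) -big_split; apply: eq_bigr => w _ /=.
case: (bridge w) => //=.
by case: ltgtP; rewrite ?addr0 ?add0r.
Qed.

Lemma sinai_blocks_up n :
  \sum_(w <- words n.+1 | sinai w && (last (false, false) w).2) ev w =
  \sum_(k < n.+2) (\sum_(u <- words k | sinai u) ev u) *
    (\sum_(v <- words (n.+1 - k) | block v && (last (false, false) v).2) ev v).
Proof.
apply: (@big_words_conv _ n.+1 (fun w => sinai w && (last (false, false) w).2)
  sinai (fun v => block v && (last (false, false) v).2) last0 ev ev ev).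
- by move=> w wn _; rewrite ltnW // -wn last0_lt // wn.
- move=> u v uvn; have s0 : (0 < size (u ++ v))%N by rewrite uvn.
  have lastE : block v -> last (false, false) (u ++ v) = last (false, false) v.
    by case: v {uvn s0} => // x v _; rewrite last_cat.
  apply/idP/idP => [/andP[/andP[si l2] l]|/andP[su /andP[bv l2]]].
    have /andP[b _] := si.
    have : bridge (u ++ v) && (last0 (u ++ v) == size u) by rewrite b.
    rewrite last0_cat // => /andP[bu bv].
    rewrite lastE // in l2.
    by rewrite sinai_cat_up // in si; rewrite si bv l2.
  have /andP[bu _] := su.
  have := last0_cat s0; rewrite bu bv => /andP[_ ->].
  by rewrite sinai_cat_up // su lastE // l2.
- by move=> u v /andP[bu _] _; rewrite ev_cat.
Qed.

Definition sinai_down n : int :=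
  \sum_(w <- words n | sinai w && ~~ (last (false, false) w).2) ev w.

(** Negating the letters exchanges the excursions whose last letter has a given
    second component. *)
Lemma sinai_downE n : 2 * sinai_down n.+1 = 2 * ev_fps sinai_fps n.+1 -
  (ev_fps sinai_fps * ev_fps blocks_fps) n.+1.
Proof.
have -> : ev_fps sinai_fps n.+1 = sinai_down n.+1 +
    \sum_(w <- words n.+1 | sinai w && (last (false, false) w).2) ev w.
  rewrite ev_sinaiE (bigID (fun w => ~~ (last (false, false) w).2)) /=.
  by congr (_ + _); apply: eq_bigl => w; rewrite negbK.
have -> : (ev_fps sinai_fps * ev_fps blocks_fps) n.+1 =
    2 * \sum_(w <- words n.+1 | sinai w && (last (false, false) w).2) ev w.
  rewrite sinai_blocks_up mulr_sumr fpsM; apply: eq_bigr => k _.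
  rewrite ev_sinaiE ev_blocksE mulrCA; congr (_ * _).
  rewrite (bigID (fun w => (last (false, false) w).2)) /=.
  rewrite [X in _ + X]big_words_neg.
  have -> : \sum_(w <- words (n.+1 - k) | block (map neg w) &&
      ~~ (last (false, false) (map neg w)).2) ev (map neg w) =
      \sum_(w <- words (n.+1 - k) | block w && (last (false, false) w).2) ev w.
    apply: eq_big => [w|w _]; last exact: ev_neg.
    rewrite block_neg; apply: andb_id2l; case: w => // x w _ /=.
    by rewrite last_map /= negbK.
  by rewrite mulr2n mulrDl !mul1r.
by rewrite mulrDr addrK.
Qed.

End Evaluation.

Definition good (w : seq letter) : bool :=
  [&& sinai w, ~~ (last (false, false) w).2 & ~~ odd `|area w|%N].

Lemma count_good n :
  2 * (count good (words n))%:Z = sinai_down 1 n + sinai_down (-1) n.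
Proof.
rewrite -sum1_count -[(\sum_(i <- _ | _) 1)%N%:Z]natz natr_sum mulr_sumr.
rewrite /sinai_down (big_mkcond good) !(big_mkcond (fun w => _ && ~~ _)) -big_split.
apply: eq_bigr => w _; rewrite /good /=.
case: (sinai w) => //=; case: (last _ w).2 => //=.
rewrite /ev expr1n -signr_odd areaE.
have -> : odd `|(posa w)%:Z - (nega w)%:Z|%N = odd (posa w + nega w) by lia.
by case: odd.
Qed.

(** * Rotations *)

Section Rotation.
Implicit Types (u v w : seq letter).

Lemma area_rot w j : bridge w ->
  area (rot j w) = area w - (size w)%:Z * height (take j w).
Proof.
move=> bw; rewrite /rot -{3 4}(cat_take_drop j w).
set u := take j w; set v := drop j w.
have huv : height v = - height u.
  apply/eqP; rewrite -addr_eq0 addrC -height_cat cat_take_drop; exact: bw.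
have shift h l : \sum_(y <- hts h l) y = (size l)%:Z * h + area l.
  rewrite hts_add big_map big_split /= big_const_seq count_predT iter_addr_0.
  by rewrite size_hts -mulr_natl natz.
rewrite /area !hts_cat !big_cat /= !add0r !shift size_cat huv PoszD /area; lia.
Qed.

Lemma bridge_rot w j : bridge (rot j w) = bridge w.
Proof.
by rewrite /bridge /rot height_cat addrC -height_cat cat_take_drop.
Qed.

Lemma height_takeD w j m : height (take (j + m) w) =
  height (take j w) + height (take m (drop j w)).
Proof. by rewrite takeD height_cat. Qed.

(** The walk does not jump over a level. *)
Lemma hts_no_jump (h c : int) w : h != c -> all (fun y => y != c) (hts h w) ->
  if h < c then all (fun y => y < c) (hts h w) else all (fun y => c < y) (hts h w).
Proof.
elim: w h => [|x w IH] h hc /=; first by rewrite if_same.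
move=> /andP[nx aw]; have := IH _ nx aw.
have sx : (h + step x < c) = (h < c).
  by move: hc nx; case: x {aw} => [[] []]; rewrite stepE /=; lia.
rewrite sx; case: ifP => hlt ->; rewrite andbT ?sx // lt_neqAle eq_sym nx.
by rewrite leNgt sx hlt.
Qed.

Lemma sum_lt_const (l : seq int) (c : int) : (0 < size l)%N ->
  all (fun y => y < c) l -> \sum_(y <- l) y < (size l)%:Z * c.
Proof.
elim: l => [//|y l IH] _ /= /andP[yc al]; rewrite big_cons -addn1 PoszD mulrDl mul1r addrC.
case: l IH al => [|z l] IH al; first by rewrite big_nil mul0r !add0r.
by apply: ltrD => //; exact: IH.
Qed.

(** A closed walk visits its mean level, if that is an integer. *)
Lemma visits_mean w (c : int) : (0 < size w)%N -> bridge w ->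
  area w = (size w)%:Z * c ->
  exists j, [&& (0 < j)%N, (j <= size w)%N & height (take j w) == c].
Proof.
move=> w0 bw aw.
have [/hasP[y yw /eqP yc]|] := boolP (has (fun y => y == c) (hts 0 w)).
  exists (index y (hts 0 w)).+1.
  have iw : (index y (hts 0 w) < size w)%N by rewrite -(size_hts 0 w) index_mem.
  rewrite iw /=; have := nth_index 0 yw; rewrite nth_hts // add0r => ->.
  exact/eqP.
move=> /hasPn no; exfalso.
have no' : all (fun y => y != c) (hts 0 w) by apply/allP => y /no.
have c0 : 0 != c.
  have := @nth_hts 0 w (size w).-1.
  rewrite prednK // leqnn take_size (eqP bw) => /(_ isT) e.
  by have /allP := no'; apply; rewrite -[X in X \in _]e mem_nth // size_hts prednK.
have := hts_no_jump c0 no'; case: ifP => _ al.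
  have := sum_lt_const (_ : (0 < size (hts 0 w))%N) al.
  by rewrite size_hts -/(area w) aw ltxx => /(_ w0).
have := @sum_lt_const (map -%R (hts 0 w)) (- c).
rewrite size_map size_hts big_map sumrN -/(area w) aw mulrN ltxx => H.
suff : false by [].
apply: H => //; rewrite all_map.
by apply: sub_all al => y /=; rewrite ltrN2.
Qed.

Lemma flen_rot_gt w j i : bridge w -> (j + i = size w)%N -> (0 < j)%N ->
  (i < flen (rot j w))%N =
  [forall m : 'I_i, height (take (j + m.+1) w) != height (take j w)].
Proof.
move=> bw ji j0; have sj : (j <= size w)%N by lia.
rewrite /flen leq_min size_rot -ji.
have -> : (i < j + i)%N by lia.
rewrite andbT ltnS /ret; set l := hts 0 (rot j w).
have nthl m : (m < i)%N -> nth 0 l m = height (take (j + m.+1) w) - height (take j w).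
  move=> mi; rewrite /l nth_hts ?size_rot ?add0r; last by lia.
  rewrite height_takeD addrC addKr /rot takel_cat // size_drop; lia.
have sl : size l = size w by rewrite size_hts size_rot.
apply/idP/forallP => [il m|H].
  have mi := ltn_ord m; have := @before_find _ 0 (pred1 0) l m.
  rewrite -/(index 0 l) nthl // => /(_ (leq_trans mi il)) /=.
  by rewrite subr_eq0 => /negbT.
rewrite leqNgt; apply/negP => li.
have mem : 0 \in l by rewrite -index_mem sl -ji (leq_trans li) // leq_addl.
have := nth_index 0 mem; rewrite nthl // => /eqP; rewrite subr_eq0.
by have := H (Ordinal li); move=> /negPf ->.
Qed.

Lemma sum_ltn_ord m n : (\sum_(i < n) (i < m))%N = minn n m.
Proof.
elim: n => [|n IH]; first by rewrite big_ord0 min0n.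
by rewrite big_ord_recr /= IH; case: (ltnP n m) => h; lia.
Qed.

Lemma sum_words_rot n j (P : pred (seq letter)) (F : seq letter -> nat) :
  (\sum_(w <- words n | P w) F w = \sum_(w <- words n | P (rot j w)) F (rot j w))%N.
Proof.
rewrite -(big_map (rot j) P F); apply: perm_big.
apply: uniq_perm; rewrite ?words_uniq ?map_inj_uniq ?words_uniq //.
  exact: rot_inj.
move=> w; rewrite mem_words; apply/idP/mapP => [wn|[v + ->]].
  by exists (rotr j w); rewrite ?rotrK // mem_words size_rotr.
by rewrite mem_words size_rot.
Qed.

(** A bridge of area 0 with a mark on its first excursion is the same as a
    closed walk of length [n] whose area is a multiple of [n]: the mark tells
    where to cut, and conversely the walk is to be started at its last visit to
    its mean level. *)
Lemma sum_flen_area0 n : (0 < n)%N ->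
  (\sum_(w <- words n | bridge w && (area w == 0)) flen w =
   count (fun w => bridge w && (n%:Z %| area w)%Z) (words n))%N.
Proof.
move=> n0.
pose cut w i := bridge w && (area (rot (n - i) w) == 0)
  && (i < flen (rot (n - i) w))%N.
transitivity (\sum_(i < n) \sum_(w <- words n) cut w i)%N.
  transitivity (\sum_(i < n) \sum_(w <- words n | bridge w && (area w == 0))
      (i < flen w))%N.
    rewrite exchange_big /=.
    rewrite big_seq_cond [RHS]big_seq_cond; apply: eq_bigr => w.
    rewrite mem_words => /andP[/eqP wn _]; rewrite sum_ltn_ord.
    by apply/esym/minn_idPr; rewrite -wn flen_le.
  apply: eq_bigr => i _; rewrite (@sum_words_rot n (n - i)) big_mkcond.
  by apply: eq_bigr => w _; rewrite /cut bridge_rot; case: (_ && _).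
rewrite exchange_big /= -sum1_count [RHS]big_mkcond /=.
rewrite big_seq [RHS]big_seq; apply: eq_bigr => w; rewrite mem_words => /eqP wn.
rewrite /cut; have [bw|_] := boolP (bridge w); last by rewrite big1.
have areaj j : area (rot j w) = area w - n%:Z * height (take j w).
  by rewrite area_rot // wn.
have [/dvdzP[c wc]|ndv] := boolP (n%:Z %| area w)%Z; last first.
  rewrite /= big1 // => i _; case: eqP => //= /eqP; rewrite areaj subr_eq0 => /eqP e.
  by rewrite e dvdz_mulr in ndv.
have n0' : n%:Z != 0 by rewrite eqz_nat -lt0n.
pose Q j := [&& (0 < j)%N, (j <= n)%N & height (take j w) == c].
have Qex : exists j, Q j.
  have [||j] := @visits_mean w c _ bw; rewrite ?wn // 1?mulrC //.
  by exists j.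
have Qle j : Q j -> (j <= n)%N by case/and3P.
case: (ex_maxnP Qex Qle) => J /and3P[J0 Jn /eqP hJ] Jmax.
have iP : (n - J < n)%N by lia.
rewrite /= (bigD1 (Ordinal iP)) //= big1 => [|i ne].
  have -> : (n - (n - J) = J)%N by lia.
  rewrite areaj hJ wc mulrC subrr eqxx /=.
  rewrite (flen_rot_gt bw) ?wn //; last by lia.
  have -> : [forall m : 'I_(n - J), height (take (J + m.+1) w) != height (take J w)].
    apply/forallP => m; apply/negP => hm; have := ltn_ord m => mn.
    have := Jmax (J + m.+1)%N; rewrite /Q -hJ hm.
    by move=> /(_ ltac:(lia)); lia.
  by [].
case: eqP => //= /eqP; rewrite areaj wc [c * _]mulrC -mulrBr mulf_eq0 (negPf n0') /=.
rewrite subr_eq0 eq_sym => hi.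
have i_n := ltn_ord i.
have niJ : (n - i <= J)%N by apply: Jmax; rewrite /Q hi; lia.
have ltJ : (n - i < J)%N.
  rewrite ltn_neqAle niJ andbT; apply: contra ne => /eqP e.
  by apply/eqP/val_inj => /=; lia.
rewrite (flen_rot_gt bw) ?wn //; [|lia|lia].
have mP : ((J - (n - i)).-1 < i)%N by lia.
case: forallP => // /(_ (Ordinal mP)) /=.
have -> : (n - i + (J - (n - i)).-1.+1 = J)%N by lia.
by rewrite hJ (eqP hi) eqxx.
Qed.

End Rotation.

(** * Areas modulo the length *)

Section LetterProducts.
Variables (F : fieldType) (x y : nat -> F).
Implicit Types (u v w : seq letter).

(** The letter at distance [m] from the end of the word is weighted by [x m]
    and [y m]. *)
Definition letter_poly (m : nat) (l : letter) : {poly F} :=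
  (if l.1 then x m *: 'X else 1) * (if l.2 then (y m)%:P else 'X).

Fixpoint word_poly w : {poly F} :=
  if w is l :: w' then letter_poly (size w) l * word_poly w' else 1.

Fixpoint word_weight w : F :=
  if w is l :: w' then
    (if l.1 then x (size w) else 1) * (if l.2 then y (size w) else 1) * word_weight w'
  else 1.

Lemma word_polyE w : exists2 k : nat, k%:Z = (size w)%:Z + height w &
  word_poly w = word_weight w *: 'X^k.
Proof.
elim: w => [|l w [k kE IH]] /=.
  by exists 0%N; rewrite /height ?big_nil ?scale1r ?expr0.
exists (k + l.1 + ~~ l.2)%N.
  by rewrite /height big_cons -/(height w) stepE; case: l => [[] []] /=; lia.
rewrite IH /letter_poly; case: l => [[] []] /=;
  rewrite ?addn0 ?addn1 ?exprS -!mul_polyC ?polyCM ?polyC1; ring.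
Qed.

Lemma sum_letter_poly m :
  \sum_(l <- letters) letter_poly m l = (1 + x m *: 'X) * ('X + (y m)%:P).
Proof. by rewrite /letters !big_cons big_nil /letter_poly /=; ring. Qed.

Lemma sum_word_poly n : \sum_(w <- words n) word_poly w =
  \prod_(1 <= m < n.+1) ((1 + x m *: 'X) * ('X + (y m)%:P)).
Proof.
elim: n => [|n IH]; first by rewrite big_seq1 big_geq.
rewrite big_nat_recr //= -IH [LHS]big_allpairs_dep -sum_letter_poly big_distrr /=.
apply: eq_bigr => l _; rewrite mulrC big_distrr /=.
rewrite big_seq [RHS]big_seq; apply: eq_bigr => w.
by rewrite mem_words => /eqP ->.
Qed.

Lemma sum_bridge_weight n : \sum_(w <- words n | bridge w) word_weight w =
  (\prod_(1 <= m < n.+1) ((1 + x m *: 'X) * ('X + (y m)%:P)))`_n.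
Proof.
rewrite -sum_word_poly coef_sum big_mkcond big_seq [RHS]big_seq.
apply: eq_bigr => w; rewrite mem_words => /eqP wn.
have [k kE ->] := word_polyE w; rewrite coefZ coefXn /bridge.
have -> : (height w == 0) = (n == k).
  by apply/eqP/eqP => h; move: kE; rewrite wn; lia.
by case: ifP; rewrite ?mulr1 ?mulr0.
Qed.

End LetterProducts.

Lemma area_cons (l : letter) w : area (l :: w) = (size w).+1%:Z * step l + area w.
Proof.
rewrite /area /= big_cons add0r hts_add big_map big_split /= big_const_seq.
rewrite count_predT iter_addr_0 size_hts -mulr_natl natz -[(size w).+1]addn1 PoszD.
ring.
Qed.

Section RootsOfUnity.
Variable F : numFieldType.

Lemma word_weight_exp (z : F) w : z != 0 ->
  word_weight (fun m => z ^ m%:Z) (fun m => z ^ (- m%:Z)) w = z ^ area w.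
Proof.
move=> z0; elim: w => [|l w IH]; first by rewrite /area big_nil.
rewrite [LHS]/= IH area_cons expfzDr //; congr (_ * _).
rewrite stepE; case: l => [[] []] /=.
- by rewrite subrr mulr0 expr0z -expfzDr // subrr expr0z.
- by rewrite subr0 !mulr1.
- by rewrite sub0r mulrN1 mul1r.
- by rewrite subrr mulr0 expr0z mulr1.
Qed.

Lemma prod_periodic (f : nat -> {poly F}) r d :
  (forall m, f (m + r)%N = f m) ->
  \prod_(1 <= m < (r * d).+1) f m = (\prod_(0 <= m < r) f m) ^+ d.
Proof.
move=> fr.
have frd m k : f (m + r * k)%N = f m.
  by elim: k => [|k IH]; rewrite ?muln0 ?addn0 // mulnS addnCA addnC fr.
elim: d => [|d IH]; first by rewrite muln0 big_geq.
rewrite exprSr -IH mulnS addnC.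
rewrite (@big_cat_nat _ _ _ (r * d).+1) //=; last by rewrite ltnS leq_addr.
congr (_ * _).
rewrite -addnS -{1}[(r * d).+1]add1n big_addn.
have -> : ((r * d) + r.+1 - r * d = r.+1)%N by lia.
under eq_bigr => i _ do rewrite frd.
case: r fr {frd IH} => [|r] fr; first by rewrite !big_geq.
rewrite big_nat_recr //= [RHS]big_nat_recl //= mulrC.
have -> : f r.+1 = f 0%N by rewrite -{1}[r.+1]add0n fr.
by congr (_ * _); rewrite big_add1.
Qed.

Variables (r : nat) (z : F).
Hypothesis zr : r.-primitive_root z.

Let r0 : (0 < r)%N := prim_order_gt0 zr.
Let eps : F := (-1) ^+ r.
Let eps2 : eps * eps = 1.
Proof. by rewrite /eps -exprMn mulrNN mulr1 expr1n. Qed.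

Lemma prod_XD (t : F) : r.-primitive_root t ->
  \prod_(i < r) ('X + (t ^+ i)%:P) = 'X^r - eps%:P.
Proof.
move=> /factor_Xn_sub_1/(congr1 (fun p => p \Po (- 'X))).
rewrite big_mkord rmorph_prod rmorphB rmorph1 /= comp_Xn_poly exprNn.
under eq_bigr => i _ do rewrite comp_polyB comp_polyX comp_polyC -opprD.
rewrite prodrN card_ord => /(congr1 (fun p => (-1) ^+ r * p)).
rewrite mulrA -exprMn mulrNN mulr1 expr1n mul1r => ->.
by rewrite mulrBr mulrA -exprMn mulrNN mulr1 expr1n mul1r mulr1 /eps polyC_exp polyCN.
Qed.

Lemma prod_roots (t : F) : r.-primitive_root t -> \prod_(i < r) t ^+ i = - eps.
Proof.
move=> /prod_XD/(congr1 (fun p => p.[0])).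
rewrite horner_prod !hornerE expr0n.
have -> : (r == 0%N) = false by lia.
rewrite sub0r => <-; apply: eq_bigr => i _.
by rewrite hornerD hornerX hornerC add0r.
Qed.

Lemma primV : r.-primitive_root z^-1.
Proof.
have -> : z^-1 = z ^+ r.-1.
  have z0 : z != 0 by rewrite (prim_root_eq0 zr) -lt0n.
  by apply: (mulfI z0); rewrite mulfV // -exprS prednK // prim_expr_order.
by rewrite prim_root_exp_coprime // coprime_sym coprimenP // prednK.
Qed.

(** One period of the letter polynomials; it is a square up to a sign. *)
Lemma prod_period : \prod_(0 <= m < r)
    ((1 + (z ^ m%:Z) *: 'X) * ('X + (z ^ (- m%:Z))%:P)) =
  (- eps) *: ('X^r - eps%:P) ^+ 2.
Proof.
have z0 : z != 0 by rewrite (prim_root_eq0 zr) -lt0n.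
rewrite big_mkord.
transitivity (\prod_(i < r)
    (z ^+ i *: (('X + (z^-1 ^+ i)%:P) * ('X + (z^-1 ^+ i)%:P)))).
  apply: eq_bigr => i _; rewrite -exprz_inv -!exprnP exprVn scalerAl; congr (_ * _).
  by rewrite scalerDr scale_polyC mulfV ?expf_neq0 // addrC.
rewrite scaler_prod prod_roots // big_split /= !prod_XD ?expr2 //; exact: primV.
Qed.

Lemma coef_period d : (((- eps) *: ('X^r - eps%:P) ^+ 2) ^+ d)`_(r * d) =
  'C(d.*2, d)%:R :> F.
Proof.
rewrite exprZn -exprM mul2n coefZ.
have -> : ('X^r - eps%:P) ^+ d.*2 = (('X - eps%:P) ^+ d.*2) \Po 'X^r.
  by rewrite [RHS]rmorphXn /= comp_polyB comp_polyX comp_polyC.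
rewrite coef_comp_poly_Xn // dvdn_mulr // mulKn // addrC -polyCN exprDn coef_sum.
have dlt : (d < d.*2.+1)%N by rewrite -addnn ltnS leq_addr.
rewrite (bigD1 (Ordinal dlt)) //= big1 ?addr0.
  rewrite coefMn -polyC_exp coefCM coefXn eqxx mulr1 -[X in _ * X]mulr_natr mulrA.
  have -> : (d.*2 - d = d)%N by rewrite -addnn addnK.
  by rewrite -exprMn mulrNN eps2 expr1n mul1r.
move=> i ne; rewrite coefMn -polyC_exp coefCM coefXn.
by have -> : (d == i) = false; [apply/negbTE; apply: contra ne => /eqP e; apply/eqP/val_inj|rewrite mulr0 mul0rn].
Qed.

Lemma sum_bridge_root d :
  \sum_(w <- words (r * d) | bridge w) z ^ area w = 'C(d.*2, d)%:R.
Proof.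
have z0 : z != 0 by rewrite (prim_root_eq0 zr) -lt0n.
rewrite -coef_period -prod_period -prod_periodic => [|m]; last first.
  rewrite PoszD opprD !expfzDr //.
  have -> : z ^ r%:Z = 1 by exact: prim_expr_order.
  have -> : z ^ (- r%:Z) = 1 by rewrite -exprz_inv; exact: (prim_expr_order primV).
  by rewrite !mulr1.
rewrite -sum_bridge_weight; apply: eq_bigr => w _.
by rewrite word_weight_exp.
Qed.

End RootsOfUnity.

Lemma count_bridges n : count bridge (words n) = 'C(n.*2, n).
Proof.
have p1 : 1.-primitive_root (1 : rat).
  apply/andP; split=> //; apply/forallP => -[[|i] hi] //=.
  by rewrite unity_rootE expr1n !eqxx.
apply/eqP; rewrite -(eqr_nat rat) -(sum_bridge_root p1) mul1n -sum1_count natr_sum.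
by apply/eqP; apply: eq_bigr => w _; rewrite exp1rz.
Qed.

Lemma prim_root2 : 2.-primitive_root (-1 : rat).
Proof.
apply/andP; split=> //; apply/forallP => -[[|[|i]] hi] //=; rewrite unity_rootE //.
Qed.

Lemma sign_sum_even d :
  \sum_(w <- words d.*2 | bridge w) (-1 : rat) ^ area w = 'C(d.*2, d)%:R.
Proof. by rewrite -(sum_bridge_root prim_root2 d) mul2n. Qed.

(** In odd length one more factor has to be multiplied. *)
Lemma sign_sum_odd d :
  \sum_(w <- words d.*2.+1 | bridge w) (-1 : rat) ^ area w = 2 * 'C(d.*2, d)%:R.
Proof.
pose f (m : nat) : {poly rat} :=
  (1 + ((-1) ^ m%:Z) *: 'X) * ('X + ((-1) ^ (- m%:Z))%:P).
have fr m : f (m + 2)%N = f m.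
  by rewrite /f PoszD opprD !expfzDr // !mulr1.
have -> : \sum_(w <- words d.*2.+1 | bridge w) (-1 : rat) ^ area w =
    (\prod_(1 <= m < d.*2.+2) f m)`_d.*2.+1.
  rewrite -sum_bridge_weight; apply: eq_bigr => w _.
  by rewrite word_weight_exp.
have := prod_periodic d fr; rewrite mul2n => pf.
rewrite big_nat_recr //= pf (prod_period prim_root2).
have -> : f d.*2.+1 = - 'X^2 + (2%:P * 'X - 1).
  have -> : f d.*2.+1 = f 1%N.
    by elim: (d) => [|k IH] //; rewrite -IH doubleS -[in RHS]fr addn2.
  rewrite /f expr1z exprN1 invrN1 scaleN1r polyCN polyC1 polyCMn; ring.
have := coef_period prim_root2 d; rewrite mul2n.
set p := (_ ^+ d).
have podd k : odd k -> p`_k = 0.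
  move=> ko; rewrite /p exprZn -exprM coefZ.
  have -> : ('X^2 - ((-1) ^+ 2)%:P) ^+ (2 * d) =
      (('X - 1) ^+ (2 * d)) \Po 'X^2 :> {poly rat}.
    have -> : (-1) ^+ 2 = 1 :> rat by [].
    by rewrite polyC1 [RHS]rmorphXn /= rmorphB rmorph1 /= comp_polyX.
  by rewrite coef_comp_poly_Xn // dvdn2 ko mulr0.
move=> pd; rewrite mulrDr mulrBr mulr1 mulrN coefD coefN coefB.
have -> : p * (2%:P * 'X) = 2 *: (p * 'X) by rewrite mulrCA mul_polyC.
rewrite coefZ coefMX /= pd podd ?subr0; last by rewrite /= odd_double.
rewrite coefMXn; case: ifPn => [_|]; first by rewrite oppr0 add0r.
by rewrite -leqNgt => d2; rewrite podd ?oppr0 ?add0r //; lia.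
Qed.

Lemma sum_root_powers (F : numFieldType) (z : F) n (a : int) : n.-primitive_root z ->
  \sum_(s < n) (z ^+ s) ^ a = (n * (n%:Z %| a)%Z)%:R.
Proof.
move=> zn; have n0 := prim_order_gt0 zn.
have z0 : z != 0 by rewrite (prim_root_eq0 zn) -lt0n.
have yE : forall s : nat, (z ^+ s) ^ a = (z ^ a) ^+ s.
  by move=> s; rewrite !exprnP !exprz_exp mulrC.
under eq_bigr => s _ do rewrite yE.
have y1 : (z ^ a == 1) = (n%:Z %| a)%Z.
  rewrite dvdzE /=; case: a {yE} => k /=; first by rewrite (prim_order_dvd zn).
  by rewrite NegzE -exprz_inv -exprnP exprVn invr_eq1 (prim_order_dvd zn).
have [y11|yn1] := eqVneq (z ^ a) 1.
  rewrite y11 eqxx in y1; rewrite -y1 muln1 y11.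
  under eq_bigr => s _ do rewrite expr1n.
  by rewrite sumr_const card_ord.
rewrite (negPf yn1) in y1; rewrite -y1 muln0.
apply: (mulfI (_ : z ^ a - 1 != 0)); first by rewrite subr_eq0.
rewrite -subrX1 mulr0 -yE prim_expr_order // exp1rz subrr //.
Qed.

(** Fourier inversion: for an [n]-th root of unity [z] the sum of [z ^ area] over
    the bridges is a central binomial coefficient, since the letter polynomials
    repeat with the order of [z] as period. *)
Lemma closed_walks_count n : (0 < n)%N ->
  (n * count (fun w => bridge w && (n%:Z %| area w)%Z) (words n) =
   \sum_(s < n) 'C((gcdn s n).*2, gcdn s n))%N.
Proof.
move=> n0; have [z zn] := C_prim_root_exists n0.
apply/eqP; rewrite -(eqr_nat algC) natrM natr_sum; apply/eqP.
transitivity (\sum_(s < n) \sum_(w <- words n | bridge w) (z ^+ s) ^ area w).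
  rewrite exchange_big /= -sum1_count natr_sum mulr_sumr.
  rewrite big_mkcondr /=; apply: eq_bigr => w _.
  rewrite (sum_root_powers _ zn); case: ifP; rewrite ?muln1 ?muln0 ?mulr1 //.
apply: eq_bigr => s _.
have g0 : (0 < gcdn s n)%N by rewrite gcdn_gt0 n0 orbT.
have nE : n = (n %/ gcdn s n * gcdn s n)%N by rewrite divnK // dvdn_gcdr.
by rewrite {1}nE (sum_bridge_root (exp_prim_root zn s)).
Qed.

Local Close Scope ring_scope.
Local Close Scope classical_set_scope.
From mathcomp Require Import perm action fintype finset fingraph.
Local Open Scope ring_scope.

(** * Degree sequences of simple graphs *)

(* Abstracting the cardinals and sums keeps arithmetic from comparing them up
   to conversion. *)
Ltac gen_atoms :=
  repeat match goal with
  | |- context [card ?m] => move: (card m) => ?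
  | |- context [bigop.body ?i ?r ?f] => move: (bigop.body i r f) => ?
  end.

Section Realization.
Variable V : finType.
Implicit Types (d : V -> nat) (n : nat) (S T U H X Y : {set V}) (e : rel V).

Definition nbrs e U v : {set V} := [set w in U | e v w].

Definition realizes U d e : Prop :=
  [/\ symmetric e, irreflexive e & {in U, forall v, #|nbrs e U v| = d v}].

(** The excess of the degrees in [S] over what can be absorbed by [S] and [T]
    in a graph with [n] vertices. *)
Definition excess n d S T : int :=
  (\sum_(i in S) d i)%N%:Z - (\sum_(i in T) d i)%N%:Z
  - #|S|%:Z * (n%:Z - 1 - #|T|%:Z).

Lemma disjI (A B : {set V}) : (forall i, i \in A -> i \in B -> false) ->
  [disjoint A & B].
Proof.
move=> AB; rewrite -setI_eq0; apply/eqP/setP => i; rewrite !inE.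
by apply/negP => /andP[iA iB]; have := AB i iA iB.
Qed.

Lemma cardsUd S X : [disjoint S & X] -> #|S :|: X| = (#|S| + #|X|)%N.
Proof. by move=> dj; rewrite cardsU disjoint_setI0 // cards0 subn0. Qed.

Lemma excessUl n d S X T : [disjoint S & X] ->
  excess n d (S :|: X) T = excess n d S T +
  ((\sum_(i in X) d i)%N%:Z - #|X|%:Z * (n%:Z - 1 - #|T|%:Z)).
Proof.
move=> dj; rewrite /excess cardsUd //.
rewrite (eq_bigl [predU S & X]) ?bigU //; last by move=> i; rewrite !inE.
rewrite !PoszD; ring.
Qed.

Lemma excessUr n d S T Y : [disjoint T & Y] ->
  excess n d S (T :|: Y) = excess n d S T +
  (#|Y|%:Z * #|S|%:Z - (\sum_(i in Y) d i)%N%:Z).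
Proof.
move=> dj; rewrite /excess cardsUd //.
rewrite [X in _ - X%:Z](eq_bigl [predU T & Y]) ?bigU //; last by move=> i; rewrite !inE.
rewrite !PoszD; ring.
Qed.

Lemma sum_ge_const S d (c : int) : (forall i, i \in S -> c <= (d i)%:Z) ->
  #|S|%:Z * c <= (\sum_(i in S) d i)%N%:Z.
Proof.
move=> dc; rewrite -[leRHS]natz natr_sum mulrC -[#|S|%:Z]natz.
rewrite mulr_natr -sumr_const; apply: ler_sum => i iS.
by rewrite natz dc.
Qed.

Lemma sum_le_const S d (c : int) : (forall i, i \in S -> (d i)%:Z <= c) ->
  (\sum_(i in S) d i)%N%:Z <= #|S|%:Z * c.
Proof.
move=> dc; rewrite -[leLHS]natz natr_sum mulrC -[#|S|%:Z]natz.
rewrite mulr_natr -sumr_const; apply: ler_sum => i iS.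
by rewrite natz dc.
Qed.

Lemma top_set d U k : (k <= #|U|)%N -> exists H : {set V},
  [/\ H \subset U, #|H| = k &
     forall x y, x \in H -> y \in U :\: H -> (d y <= d x)%N].
Proof.
elim: k => [|k IH] kU.
  exists set0; rewrite sub0set cards0; split=> // x y; by rewrite inE.
have [H [HU Hk top]] := IH (ltnW kU).
have : (0 < #|U :\: H|)%N.
  by rewrite cardsD (setIidPr HU) Hk subn_gt0.
case/card_gt0P => z0 z0U.
have [z zU zmax] := @arg_maxnP _ z0 (fun z => z \in U :\: H) d z0U.
move: (zU); rewrite !inE => /andP[zH zU'].
exists (z |: H); split.
- by rewrite subUset sub1set zU'.
- by rewrite cardsU1 zH Hk.
- move=> x y; rewrite !inE negb_or => /orP[/eqP->|xH] /andP[/andP[yz yH] yU].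
    by apply: zmax; rewrite !inE yH.
  by apply: top => //; rewrite !inE yH.
Qed.

Section RemoveVertex.
Variables (d : V -> nat) (n : nat) (U U' H : {set V}) (v : V).
Hypotheses (nE : #|U| = n) (U'E : U' = U :\ v).
Hypotheses (vU : v \in U) (HU : H \subset U') (Hv : #|H| = d v).
Hypothesis top : forall x y, x \in H -> y \in U' :\: H -> (d y <= d x)%N.
Hypothesis ev : ~~ odd (\sum_(i in U) d i).
Hypothesis ex : forall S T, S \subset U -> T \subset U -> [disjoint S & T] ->
  excess n d S T <= 0.

Let cardU' : n = #|U'|.+1.
Proof. by rewrite U'E -nE (cardsD1 v) vU. Qed.

Let U'U S : S \subset U' -> S \subset U.
Proof. by rewrite U'E => h; apply: subset_trans h (subsetDl _ _). Qed.

Let notinU' S : S \subset U' -> v \notin S.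
Proof. by rewrite U'E => h; apply/negP => /(subsetP h); rewrite !inE eqxx. Qed.

Let sum1v : (\sum_(i in [set v]) d i = d v)%N.
Proof. by rewrite big_set1. Qed.

Let case_b0 S T : S \subset U' -> T \subset U' -> [disjoint S & T] ->
  T :&: H = set0 -> excess n d S T + #|S :\: H|%:Z <= 0.
Proof.
move=> SU TU dj TH.
have dTH : [disjoint H & T] by rewrite -setI_eq0 setIC TH.
have [allH|] := boolP [forall y in H :\: S, n%:Z - 1 - #|T|%:Z <= (d y)%:Z].
  have SHU : S :|: H \subset U' by rewrite subUset SU.
  have dj1 : [disjoint S :|: H & T].
    apply: disjI => i; rewrite inE => /orP[iS|iH] iT.
      by rewrite (disjointFr dj iS) in iT.
    by rewrite (disjointFr dTH iH) in iT.
  have e1 : excess n d S T <= excess n d (S :|: H) T.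
    have -> : S :|: H = S :|: (H :\: S) by apply/setP => i; rewrite !inE; case: (i \in S).
    rewrite excessUl; last first.
      by apply: disjI => i iS; rewrite !inE iS.
    rewrite lerDl subr_ge0; apply: sum_ge_const => i iH.
    by have /forallP/(_ i) := allH; rewrite iH.
  have e2 : excess n d (S :|: H) (T :|: [set v]) <= 0.
    apply: ex; rewrite ?subUset ?(U'U SU) ?(U'U TU) ?(U'U HU) ?sub1set ?vU //.
    apply: disjI => i iSH; rewrite !inE => /orP[iT|/eqP iv].
      by rewrite (disjointFr dj1 iSH) in iT.
    by rewrite iv (negPf (notinU' SHU)) in iSH.
  rewrite excessUr ?disjoints1 in e2; last first.
    by rewrite disjoint_sym disjoints1 notinU'.
  have c1 : #|S :|: H| = (d v + #|S :\: H|)%N.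
    have -> : S :|: H = H :|: (S :\: H) by apply/setP => i; rewrite !inE; case: (i \in H); rewrite ?orbT ?orbF.
    by rewrite cardsUd ?Hv //; apply: disjI => i iH; rewrite !inE iH.
  rewrite cards1 sum1v c1 PoszD in e2.
  by move: e1 e2; rewrite /excess; clear; gen_atoms; lia.
rewrite negb_forall => /existsP[y]; rewrite negb_imply => /andP[].
rewrite !inE -ltNge => /andP[yS yH] dy.
have xle x : x \in S :\: H -> (d x)%:Z <= n%:Z - 1 - #|T|%:Z - 1.
  rewrite inE => /andP[xH xS].
  have := top yH (_ : x \in U' :\: H); rewrite inE xH (subsetP SU) // => /(_ isT).
  by move: dy; clear; gen_atoms; lia.
have djS : [disjoint S :&: H & S :\: H].
  by apply: disjI => i; rewrite !inE => /andP[_ ->].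
have SE : S = (S :&: H) :|: (S :\: H) by rewrite setID.
have := @excessUl n d _ _ T djS; rewrite -SE => ->.
have : excess n d (S :&: H) T <= 0.
  apply: ex; rewrite ?(U'U TU) ?(subset_trans (subsetIl _ _) (U'U SU)) //.
  by apply: disjointWl dj; exact: subsetIl.
have := sum_le_const xle; rewrite /excess; clear; gen_atoms; lia.
Qed.

Let case_a0 S T : S \subset U' -> T \subset U' -> [disjoint S & T] ->
  S :\: H = set0 -> excess n d S T + #|T :&: H|%:Z <= 0.
Proof.
move=> SU TU dj SH.
have SsubH : S \subset H by rewrite -setD_eq0 SH.
have djT : [disjoint T :\: H & T :&: H].
  by apply: disjI => i; rewrite !inE => /andP[/negPf-> _]; rewrite andbF.
have TE : T = (T :\: H) :|: (T :&: H) by rewrite setUC setID.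
have [allT|] := boolP [forall y in T :&: H, #|S|%:Z + 1 <= (d y)%:Z].
  have := @excessUr n d S _ _ djT; rewrite -TE => ->.
  have : excess n d S (T :\: H) <= 0.
    apply: ex; rewrite ?(U'U SU) ?(subset_trans (subsetDl _ _) (U'U TU)) //.
    by apply: disjointWr dj; exact: subsetDl.
  have := @sum_ge_const (T :&: H) d (#|S|%:Z + 1).
  move=> /(_ _)/[swap]; have : forall i, i \in T :&: H -> #|S|%:Z + 1 <= (d i)%:Z.
    by move=> i iT; have /forallP/(_ i) := allT; rewrite iT.
  move=> h e /(_ h); move: e; rewrite /excess; clear; gen_atoms; lia.
rewrite negb_forall => /existsP[y]; rewrite negb_imply => /andP[].
rewrite inE -ltNge => /andP[yT yH] dy.
have zle z : z \in (U' :\: H) :\: T -> (d z)%:Z <= #|S|%:Z.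
  rewrite inE => /andP[zT zU].
  by have := top yH zU; move: dy; clear; gen_atoms; lia.
set T1 := T :|: ((U' :\: H) :\: T).
have djT1 : [disjoint T & (U' :\: H) :\: T].
  by apply: disjI => i iT; rewrite !inE iT.
have T1U : T1 \subset U'.
  by rewrite subUset TU (subset_trans (subsetDl _ _)) // subsetDl.
have T1E : T1 = (U' :\: H) :|: (T :&: H).
  apply/setP => i; rewrite !inE; have := subsetP TU i.
  by case: (i \in T) => [/(_ isT)->|_]; case: (i \in H); rewrite ?andbF ?andbT ?orbF ?orbT.
have dj1 : [disjoint S & T1].
  apply: disjI => i iS; rewrite T1E !inE (subsetP SsubH i iS) /= andbT.
  by rewrite (disjointFr dj iS).
have e1 : excess n d S T <= excess n d S T1.
  by rewrite excessUr // lerDl subr_ge0; exact: sum_le_const.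
have c1 : #|T1| = (#|U'| - d v + #|T :&: H|)%N.
  rewrite T1E cardsUd; last first.
    by apply: disjI => i; rewrite !inE => /andP[/negPf-> _]; rewrite andbF.
  by rewrite cardsD (setIidPr HU) Hv.
have e2 : excess n d (S :|: [set v]) T1 <= 0.
  apply: ex; [by rewrite subUset (U'U SU) sub1set vU|exact: U'U T1U|].
  apply: disjI => i; rewrite in_setU in_set1 => /orP[iS|/eqP iv] iT.
    by rewrite (disjointFr dj1 iS) in iT.
  by rewrite iv (negPf (notinU' T1U)) in iT.
rewrite excessUl in e2; last by rewrite disjoint_sym disjoints1 notinU'.
rewrite cards1 sum1v mul1r c1 in e2.
have := cardU'; have := subset_leq_card HU; rewrite Hv; move: e1 e2.
by rewrite /excess; clear; gen_atoms; lia.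
Qed.

(** The vertex [v] is joined to the set [H] of the [d v] others of largest
    degree.  Let [a = #|S :\: H|] and [b = #|T :&: H|].  If [a, b > 0],
    remove one vertex of [S :\: H] from [S] and one of [T :&: H] from [T]: the
    excess grows by [n - #|S| - #|T|], which is at least 2 unless [S] and [T]
    exhaust the vertices, and then the parity of the degree sum helps.  If only
    [a > 0], either adding the whole of [H] to [S] or removing [S :\: H] from
    [S] is profitable, and similarly for [b]. *)
Lemma remove_vertex S T : S \subset U' -> T \subset U' -> [disjoint S & T] ->
  excess n d S T + #|S :\: H|%:Z + #|T :&: H|%:Z <= 0.
Proof.
move=> SU TU dj.
have [k] := ubnP (#|S :\: H| + #|T :&: H|)%N.
elim: k S T SU TU dj => // k IH S T SU TU dj; rewrite ltnS => le_k.
have [a0|] := eqVneq (S :\: H) set0.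
  by rewrite a0 cards0 addr0; exact: case_a0.
have [b0 _|] := eqVneq (T :&: H) set0.
  by rewrite b0 cards0 addr0; exact: case_b0.
case/set0Pn => y yTH; case/set0Pn => x xSH.
have := xSH; rewrite inE => /andP[xH xS].
have := yTH; rewrite inE => /andP[yT yH].
have dxy : (d x <= d y)%N by apply: top => //; rewrite inE xH (subsetP SU).
have S1U : S :\ x \subset U' by exact: subset_trans (subsetDl _ _) SU.
have T1U : T :\ y \subset U' by exact: subset_trans (subsetDl _ _) TU.
have dj1 : [disjoint S :\ x & T :\ y].
  by apply: (disjointWl (subsetDl _ _)); apply: disjointWr dj; exact: subsetDl.
have cS : #|S :\: H| = #|(S :\ x) :\: H|.+1.
  rewrite (cardsD1 x) xSH; congr (_.+1); apply: eq_card => i; rewrite !inE.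
  by case: (i == x); rewrite ?andbF.
have cT : #|T :&: H| = #|(T :\ y) :&: H|.+1.
  rewrite (cardsD1 y) yTH; congr (_.+1); apply: eq_card => i; rewrite !inE.
  by case: (i == y).
have /= IHxy := IH _ _ S1U T1U dj1 (_ : _ < k)%N.
have {IHxy}IH1 : excess n d (S :\ x) (T :\ y) + #|(S :\ x) :\: H|%:Z + #|(T :\ y) :&: H|%:Z <= 0.
  by apply: IHxy; move: le_k; rewrite cS cT; clear; gen_atoms; lia.
have eS : S = (S :\ x) :|: [set x] by rewrite setUC setD1K.
have eT : T = (T :\ y) :|: [set y] by rewrite setUC setD1K.
have := @excessUr n d S (T :\ y) [set y] _; rewrite -eT.
rewrite disjoint_sym disjoints1 !inE eqxx => /(_ isT) ex1.
have := @excessUl n d (S :\ x) [set x] (T :\ y) _; rewrite -eS.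
rewrite disjoint_sym disjoints1 !inE eqxx => /(_ isT) ex2.
rewrite !cards1 !big_set1 in ex1 ex2.
have cy := cardsD1 y T; rewrite yT in cy.
have cST : (#|S| + #|T| <= #|U'|)%N.
  by rewrite -cardsUd // subset_leq_card // subUset SU.
have [lt|ge] := ltnP (#|S| + #|T|)%N #|U'|; 
  first by move: (excess n d S T) (excess n d S _) (excess n d _ _) ex1 ex2 IH1
    cardU' lt cy cS cT dxy; clear; gen_atoms; nia.
have cE : #|U'| = (#|S| + #|T|)%N by apply/eqP; rewrite eqn_leq ge.
have UE : S :|: T = U'.
  by apply/eqP; rewrite eqEcard subUset SU TU cardsUd // cE /=.
have parity : ~~ odd (\sum_(i in S) d i + \sum_(i in T) d i + d v).
  move: ev; rewrite (bigD1 v vU) /= addnC; congr (~~ odd (_ + _)).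
  rewrite -bigU //=; apply: eq_bigl => i.
  by have := congr1 (fun A : {set V} => i \in A) UE; rewrite U'E !inE andbC => ->.
have pq : exists q : int, excess n d S T + #|S :\: H|%:Z + #|T :&: H|%:Z = 2 * q.
  have hS : (#|S :\: H| + #|S :&: H| = #|S|)%N by rewrite addnC cardsID.
  have hH : (#|S :&: H| + #|T :&: H| = d v)%N.
    rewrite -Hv -cardsUd; last first.
      apply: disjI => i; rewrite !inE => /andP[iS _]; by rewrite (disjointFr dj iS).
    apply: eq_card => i; rewrite !inE -andb_orl.
    have := congr1 (fun A : {set V} => i \in A) UE; rewrite !inE => ->.
    by have := subsetP HU i; case: (i \in H) => [/(_ isT)->|]; rewrite ?andbF.
  rewrite /excess cardU' cE.
  have [q0 q0E] : exists q0, (\sum_(i in S) d i + \sum_(i in T) d i + d v = 2 * q0)%N.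
    exists (\sum_(i in S) d i + \sum_(i in T) d i + d v)./2.
    by rewrite mul2n even_halfK.
  have [q1 q1E] : exists q1, (#|S| * #|S| + #|S| = 2 * q1)%N.
    exists (#|S| * #|S| + #|S|)./2; rewrite mul2n even_halfK //.
    by rewrite oddD oddM; case: odd.
  exists (q0%:Z - (\sum_(i in T) d i)%N%:Z - q1%:Z + #|S|%:Z - #|S :&: H|%:Z).
  by move: hS hH q0E q1E; clear; gen_atoms; nia.
case: pq => q; move: (excess n d S T) (excess n d S _) (excess n d _ _) ex1 ex2 IH1
  cardU' cE cy cS cT dxy; clear; gen_atoms; nia.
Qed.

End RemoveVertex.

(** Havel and Hakimi's construction, one vertex at a time. *)
Lemma realize U d : ~~ odd (\sum_(i in U) d i) ->
  (forall S T, S \subset U -> T \subset U -> [disjoint S & T] ->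
     excess #|U| d S T <= 0) ->
  exists e, realizes U d e.
Proof.
have [k] := ubnP #|U|; elim: k U d => // k IH U d; rewrite ltnS => Uk ev ex.
have [->|/set0Pn[v vU]] := eqVneq U set0.
  by exists (fun _ _ => false); split=> // v; rewrite inE.
pose U' := U :\ v.
have cU : #|U| = #|U'|.+1 by rewrite (cardsD1 v) vU.
have dv : (d v <= #|U'|)%N.
  have dj0 : [disjoint [set v] & (set0 : {set V})].
    by apply: disjI => i _; rewrite inE.
  have := ex [set v] set0; rewrite sub1set vU sub0set => /(_ isT isT dj0).
  rewrite /excess big_set1 big_set0 cards1 cards0 cU; clear; gen_atoms; lia.
have [H [HU Hv top]] := top_set d dv.
have Hpos x : x \in H -> (0 < d x)%N.
  move=> xH; rewrite lt0n; apply/eqP => dx0.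
  pose T := x |: (U' :\: H).
  have TU : T \subset U'.
    by rewrite subUset sub1set (subsetP HU) // subsetDl.
  have dT : (\sum_(i in T) d i = 0)%N.
    apply: big1 => i; rewrite !inE => /orP[/eqP->//|].
    by move=> iUH; have := top x i xH; rewrite !inE iUH dx0 leqn0 => /(_ isT)/eqP.
  have cT : #|T| = (#|U'| - d v).+1.
    by rewrite cardsU1 !inE xH /= add1n cardsD (setIidPr HU) Hv.
  have TsubU : T \subset U by apply: subset_trans TU (subsetDl _ _).
  have vT : v \notin T by apply/negP => /(subsetP TU); rewrite !inE eqxx.
  have := ex [set v] T; rewrite sub1set vU TsubU disjoints1 vT => /(_ isT isT isT).
  rewrite /excess big_set1 dT cards1 cT cU; move: dv; clear; gen_atoms; lia.
pose d' x := (d x - (x \in H))%N.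
have d'E x : (d' x + (x \in H) = d x)%N.
  by rewrite /d' subnK //; case: (boolP (x \in H)) => // /Hpos.
have sumd' S : (\sum_(i in S) d' i + #|S :&: H| = \sum_(i in S) d i)%N.
  have -> : #|S :&: H| = (\sum_(i in S) (i \in H))%N.
    rewrite -sum1_card big_mkcond [RHS]big_mkcond; apply: eq_bigr => i _.
    by rewrite inE; case: (i \in S); case: (i \in H).
  by rewrite -big_split; apply: eq_bigr => i _; exact: d'E.
have [|||e [es ei ed]] := IH U' d'.
- by rewrite -ltnS -cU.
- have := sumd' U'; rewrite (setIidPr HU) Hv => h.
  move: ev; rewrite (big_setD1 v vU) /= -/U' -h; clear; gen_atoms; lia.
- move=> S T SU TU dj.
  have := remove_vertex erefl erefl vU HU Hv top ev ex SU TU dj.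
  have := sumd' S; have := sumd' T; have := cardsID H S.
  rewrite /excess cU; clear; gen_atoms; nia.
pose e' x y := [|| [&& x \in U', y \in U' & e x y], (x == v) && (y \in H) |
  (y == v) && (x \in H)].
have vU' : v \in U' = false by rewrite !inE eqxx.
have vH : v \in H = false by apply/negbTE/negP => /(subsetP HU); rewrite vU'.
exists e'; split.
- by move=> x y; rewrite /e' es [X in _ || X]orbC andbCA.
- move=> x; rewrite /e' ei !andbF /= orbb; case: eqP => // ->; exact: vH.
move=> x xU; have [->|xv] := eqVneq x v.
  rewrite -Hv; apply: eq_card => w; rewrite !inE /e' vU' eqxx /= vH andbF orbF.
  by apply: andb_idl => /(subsetP HU); rewrite !inE => /andP[].
have xU' : x \in U' by rewrite !inE xv.
rewrite -(d'E x) -(ed x xU').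
have -> : nbrs e' U x = nbrs e U' x :|: (if x \in H then [set v] else set0).
  apply/setP => w; rewrite inE in_setU inE.
  have -> : (w \in (if x \in H then [set v] else set0)) = (w == v) && (x \in H).
    by case: (x \in H); rewrite !inE ?andbT ?andbF.
  rewrite /e' xU' (negPf xv) /=.
  have [->|wv] := eqVneq w v; first by rewrite vU' /= vU.
  by rewrite !inE wv /= orbF; case: (w \in U).
case: (x \in H); last by rewrite setU0 addn0.
rewrite cardsUd ?cards1 //; apply: disjI => w; rewrite !inE.
by case: (w == v).
Qed.

Lemma card_nbrs e U v : #|nbrs e U v| = (\sum_(w in U) e v w)%N.
Proof.
rewrite -sum1_card big_mkcond [RHS]big_mkcond; apply: eq_bigr => w _.
by rewrite inE; case: (w \in U); case: (e v w).
Qed.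

(** An edge from [S] ends in [T], where it is counted by the degrees in [T], or
    among the other vertices, of which there are [#|V| - 1 - #|T|] for each
    vertex of [S]. *)
Lemma excess_degree e S T : symmetric e -> irreflexive e -> [disjoint S & T] ->
  excess #|V| (fun v => #|nbrs e setT v|) S T <= 0.
Proof.
move=> es ei dj.
have h1 : forall v, v \in S ->
    (#|nbrs e setT v| + #|T| + 1 <= #|nbrs e T v| + #|V|)%N.
  move=> v vS; have vT := disjointFr dj vS.
  have -> : nbrs e setT v = nbrs e T v :|: nbrs e (~: T) v.
    by apply/setP => w; rewrite !inE; case: (w \in T); rewrite ?orbF.
  rewrite cardsUd; last by apply: disjI => w; rewrite !inE => /andP[->].
  rewrite -!addnA leq_add2l.
  have : (#|nbrs e (~: T) v| <= #|(~: T) :\ v|)%N.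
    apply: subset_leq_card; apply/subsetP => w; rewrite !inE => /andP[wT vw].
    by rewrite wT andbT; apply/eqP => wv; rewrite wv ei in vw.
  have := cardsD1 v (~: T); rewrite !inE vT /= => h2.
  have := cardsC T; move: h2; clear; gen_atoms; lia.
have h2 : (\sum_(v in S) #|nbrs e T v| <= \sum_(w in T) #|nbrs e setT w|)%N.
  rewrite (eq_bigr _ (fun v _ => card_nbrs e T v)) exchange_big /=.
  apply: leq_sum => w _; rewrite card_nbrs [leqRHS]big_mkcond /=.
  rewrite big_mkcond; apply: leq_sum => v _; rewrite inE es.
  by case: (v \in S).
have h3 : (\sum_(v in S) #|nbrs e setT v| + #|S| * (#|T| + 1) <=
    \sum_(v in S) #|nbrs e T v| + #|S| * #|V|)%N.
  rewrite -!sum_nat_const -!big_split /=; apply: leq_sum => v vS.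
  by rewrite addnA h1.
move: h2 h3; rewrite /excess; clear; gen_atoms; nia.
Qed.

Lemma handshake e : symmetric e -> irreflexive e ->
  ~~ odd (\sum_v #|nbrs e setT v|).
Proof.
move=> es ei.
pose up (v w : V) := (enum_rank v < enum_rank w)%N.
have -> : (\sum_v #|nbrs e setT v| = \sum_v \sum_(w | up v w) e v w
    + \sum_v \sum_(w | up w v) e v w)%N.
  rewrite -big_split; apply: eq_bigr => v _ /=; rewrite card_nbrs.
  rewrite [X in (X + _)%N]big_mkcond [X in (_ + X)%N]big_mkcond -big_split /=.
  apply: eq_big => [w|w _]; first by rewrite inE.
  rewrite /up; case: ltngtP => h; rewrite ?addn0 ?add0n //.
  by have -> : v = w; [exact/enum_rank_inj/val_inj|rewrite ei].
have -> : (\sum_v \sum_(w | up w v) e v w = \sum_v \sum_(w | up v w) e v w)%N.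
  rewrite (exchange_big_dep xpredT) //=; apply: eq_bigr => v _.
  by apply: eq_bigr => w _; rewrite es.
by rewrite addnn odd_double.
Qed.

End Realization.

Lemma graphical_excess n (d : seq nat) : graphical n d ->
  ~~ odd (\sum_(i < n) nth 0%N d i) /\
  (forall S T : {set 'I_n}, [disjoint S & T] ->
     excess n (fun i : 'I_n => nth 0%N d i) S T <= 0).
Proof.
move=> [E [[es ei] dE]].
have degE v : degree E v = #|nbrs (adj E) setT v|.
  by apply: eq_card => w; rewrite !inE.
have dn : size d == n by rewrite -dE size_sort size_map -cardE card_ord.
have : perm_eq (Tuple dn) [tuple degree E i | i < n].
  by rewrite /= -dE perm_sort perm_refl.
case/tuple_permP => p dp.
have dpi (i : 'I_n) : nth 0%N d i = #|nbrs (adj E) setT (p i)|.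
  by rewrite -(tnth_nth 0%N (Tuple dn)) (val_inj dp) !tnth_mktuple -degE.
split.
  rewrite (eq_bigr _ (fun i _ => dpi i)).
  have := handshake es ei; rewrite (reindex_inj (@perm_inj _ p)) /=.
  by [].
move=> S T dj.
have im (A : {set 'I_n}) : (\sum_(i in A) nth 0 d i =
    \sum_(j in p @: A) #|nbrs (adj E) setT j|)%N.
  by rewrite big_imset /=; [apply: eq_bigr => i _; exact: dpi|move=> i j _ _; exact: perm_inj].
have := @excess_degree _ (adj E) (p @: S) (p @: T) es ei.
rewrite /excess !im card_ord !card_imset //; try exact: perm_inj.
apply; apply: disjI => _ /imsetP[i iS ->] /imsetP[j jT /perm_inj ij].
by rewrite ij (disjointFl dj jT) in iS.
Qed.

Lemma excess_graphical n (d : seq nat) : sorted leq d -> size d = n ->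
  ~~ odd (\sum_(i < n) nth 0%N d i) ->
  (forall S T : {set 'I_n}, [disjoint S & T] ->
     excess n (fun i : 'I_n => nth 0%N d i) S T <= 0) ->
  graphical n d.
Proof.
move=> sd dn ev ex.
have [||e [es ei ed]] := @realize 'I_n setT (fun i : 'I_n => nth 0%N d i).
- by rewrite (eq_bigl xpredT) // => i; rewrite inE.
- by move=> S T _ _; rewrite cardsT card_ord; exact: ex.
exists [set x | e x.1 x.2]; split.
  by split=> [x y|x]; rewrite /adj !inE /=; [exact: es|exact: ei].
rewrite /degree_sequence.
have -> : [seq degree [set x | e x.1 x.2] v | v : 'I_n] = d.
  apply: (@eq_from_nth _ 0%N); first by rewrite size_map -cardE card_ord.
  move=> i; rewrite size_map -cardE card_ord => i_n.
  rewrite (nth_map (Ordinal i_n)) ?size_enum_ord //.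
  have -> : nth (Ordinal i_n) (enum 'I_n) i = Ordinal i_n.
    by apply: val_inj; rewrite /= nth_enum_ord.
  rewrite -(ed (Ordinal i_n)) ?inE //; apply: eq_card => w.
  by rewrite !inE /adj inE.
by apply: sorted_sort => //; exact: leq_trans.
Qed.

(** * Degree sequences as words *)

Lemma low_sum n (f : nat -> nat) (T : {set 'I_n}) :
  (forall i j, (i <= j < n)%N -> (f i <= f j)%N) ->
  (\sum_(i < #|T|) f i <= \sum_(i in T) f i)%N.
Proof.
move=> f_nd; have Tn : (#|T| <= n)%N by rewrite -[leqRHS]card_ord max_card.
have [->|T0] := eqVneq #|T| 0%N; first by rewrite big_ord0.
pose I := [set i : 'I_n | (i < #|T|)%N].
pose c := f #|T|.-1.
have -> : (\sum_(i < #|T|) f i = \sum_(i in I) f i)%N.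
  rewrite (big_ord_widen n (fun i => f i) Tn); apply: eq_bigl => i.
  by rewrite inE.
have cI : #|I| = #|T|.
  have : (\sum_(i < #|T|) 1 = #|I|)%N.
    rewrite (big_ord_widen n (fun i => 1%N) Tn) -[RHS]sum1_card; apply: eq_bigl => i.
    by rewrite inE.
  by rewrite sum1_card card_ord.
rewrite (big_setID T) [leqRHS](big_setID I) /= setIC leq_add2l.
apply: (@leq_trans (#|I :\: T| * c)).
  rewrite -sum_nat_const; apply: leq_sum => i; rewrite !inE => /andP[_ iT].
  by apply: f_nd; move: iT T0 Tn; clear; gen_atoms; lia.
have -> : #|I :\: T| = #|T :\: I|.
  have := cardsID T I; have := cardsID I T; rewrite cI setIC.
  by clear; gen_atoms; lia.
rewrite -sum_nat_const; apply: leq_sum => i; rewrite !inE => /andP[iT _].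
by apply: f_nd; have := ltn_ord i; move: iT T0; clear; gen_atoms; lia.
Qed.

Lemma high_sum n (f : nat -> nat) (S : {set 'I_n}) :
  (forall i j, (i <= j < n)%N -> (f i <= f j)%N) ->
  (\sum_(i in S) f i <= \sum_(i < #|S|) f (n - i.+1))%N.
Proof.
move=> f_nd; have := low_sum (~: S) f_nd.
have cS : (#|S| + #|~: S| = n)%N by rewrite cardsC card_ord.
have [Sn S'n] : (#|S| <= n)%N /\ (#|~: S| <= n)%N.
  by move: cS; clear; gen_atoms; lia.
have -> : (\sum_(i in ~: S) f i = \sum_(i < n) f i - \sum_(i in S) f i)%N.
  rewrite [X in (X - _)%N](bigID (mem S)) /= addKn; apply: eq_bigl => i.
  by rewrite inE.
have -> : (\sum_(i < #|~: S|) f i = \sum_(i < n) f i - \sum_(i < #|S|) f (n - i.+1))%N.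
  rewrite -(big_mkord xpredT f) -(big_mkord xpredT f).
  rewrite [X in _ = (X - _)%N](@big_cat_nat _ _ _ #|~: S|) /=; [|by []|by []].
  suff -> : (\sum_(#|~: S| <= i < n) f i = \sum_(i < #|S|) f (n - i.+1))%N.
    by rewrite addnK.
  rewrite big_rev_mkord /=; have -> : (n - #|~: S| = #|S|)%N
      by move: cS; clear; gen_atoms; lia.
    apply: eq_bigr => i _.
  by congr f; move: cS; have := ltn_ord i; clear; gen_atoms; lia.
have : (\sum_(i in S) f i <= \sum_(i < n) f i)%N.
  by rewrite [leqRHS](bigID (mem S)) /= leq_addr.
have : (\sum_(i < #|S|) f (n - i.+1) <= \sum_(i < n) f i)%N.
  rewrite -[leqRHS](big_mkord xpredT f) big_rev_mkord subn0 /=.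
  rewrite (big_ord_widen n (fun i => f (n - i.+1)%N) Sn).
  by rewrite big_mkcond leq_sum // => i _; case: ifP.
clear; gen_atoms; lia.
Qed.

Lemma sum_take_hts w N : (N <= size w)%N ->
  \sum_(y <- take N (hts 0 w)) y =
  \sum_(j < N) (N - j)%N%:Z * step (nth (false, false) w j).
Proof.
elim: N => [|N IH] Nw; first by rewrite take0 big_nil big_ord0.
rewrite (take_nth 0) ?size_hts // -cats1 big_cat big_seq1 IH ?(ltnW Nw) //=.
rewrite nth_hts // add0r /height.
have -> : \sum_(x <- take N.+1 w) step x =
    \sum_(j < N.+1) step (nth (false, false) w j).
  rewrite -(big_mkord xpredT (fun j => step (nth (false, false) w j))).
  rewrite (big_nth (false, false)) size_takel //.
  rewrite !big_mkord; apply: eq_bigr => i _; by rewrite nth_take.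
rewrite !big_ord_recr /= addrA -big_split /= subSn // subnn mul1r.
congr (_ + _); apply: eq_bigr => i _ /=.
by rewrite subSn ?(ltnW (ltn_ord i)) // -addn1 PoszD mulrDl mul1r.
Qed.

Lemma sum_trunc_uniq (s : seq nat) N : uniq s ->
  (\sum_(x <- s) (N - x) = \sum_(j < N) (N - j) * (val j \in s))%N.
Proof.
elim: s => [|x s IH] /=.
  by rewrite big_nil big1 // => i _; rewrite ?in_nil muln0.
move=> /andP[xs us]; rewrite big_cons IH //.
have -> : (N - x = \sum_(j < N) (N - j) * (j == x :> nat))%N.
  have [xN|Nx] := ltnP x N.
    rewrite (bigD1 (Ordinal xN)) //= eqxx muln1 big1 ?addn0 // => i ix.
    by rewrite (_ : (_ == _) = false) ?muln0 //; apply: negbTE.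
  rewrite big1 => [|i _]; first by apply/eqP; rewrite subn_eq0.
  by rewrite (ltn_eqF (leq_trans (ltn_ord i) Nx)) muln0.
rewrite -big_split /=; apply: eq_bigr => j _; rewrite -mulnDr; congr (_ * _)%N.
rewrite inE; case: eqP => [->|_] /=; first by rewrite (negPf xs).
by rewrite add0n.
Qed.

Lemma sum_step_up N : (2 * \sum_(j < N) (N - j) = N * N.+1)%N.
Proof.
elim: N => [|N IH]; first by rewrite big_ord0.
rewrite big_ord_recl subn0 mulnDr.
rewrite (eq_bigr (fun j : 'I_N => N - j)%N) ?IH; first by lia.
by move=> i _; rewrite /bump /= subSS.
Qed.

Section PositionWord.
Variable m : nat.
Implicit Types (Y : pred nat) (d : seq nat).

Definition pword Y : seq letter :=
  [seq (~~ Y j, (j != m) && Y (m.*2 - j)%N) | j <- iota 0 m.+1].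

Lemma nth_pword Y j : (j <= m)%N ->
  nth (false, false) (pword Y) j = (~~ Y j, (j != m) && Y (m.*2 - j)%N).
Proof. by move=> jm; rewrite (nth_map 0%N) ?size_iota // nth_iota. Qed.

Lemma size_pword Y : size (pword Y) = m.+1.
Proof. by rewrite size_map size_iota. Qed.

Lemma last_pword Y : (last (false, false) (pword Y)).2 = false.
Proof.
by rewrite (last_nth (false, false)) size_pword /= -/(pword Y) nth_pword // eqxx.
Qed.

Lemma height_pword Y :
  height (pword Y) = m.+1%:Z - (count Y (iota 0 m.*2.+1))%:Z.
Proof.
have -> : height (pword Y) =
    \sum_(0 <= j < m.+1) (1 - (Y j)%:Z - ((j != m) && Y (m.*2 - j)%N)%:Z).
  rewrite /height big_map /index_iota subn0; apply: eq_bigr => j _.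
  by rewrite stepE /=; case: (Y j) => /=; ring.
rewrite !sumrB -addrA -opprD; congr (_ - _).
  by rewrite sumr_const_nat subn0 -natz.
have -> : (count Y (iota 0 m.*2.+1) =
   \sum_(0 <= i < m.+1) Y i + \sum_(0 <= i < m.+1) ((i != m) && Y (m.*2 - i)))%N.
  have -> : iota 0 m.*2.+1 = index_iota 0 m.*2.+1 by rewrite /index_iota subn0.
  rewrite -sum1_count big_mkcond (eq_bigr (fun i => nat_of_bool (Y i))); last first.
    by move=> i _; case: (Y i).
  rewrite (@big_cat_nat _ _ _ m.+1) //=; last by lia.
  congr addn.
  rewrite [RHS]big_nat_recr //= eqxx addn0 big_nat_rev /=.
  have -> : m.*2.+1 = (m + m.+1)%N by lia.
  rewrite -{1}[m.+1]add0n big_addn addnK big_nat [RHS]big_nat.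
  apply: eq_bigr => i /andP[_ im].
  have -> : (m.+1 + (m + m.+1) - (i + m.+1).+1 = m.*2 - i)%N by lia.
  by rewrite neq_ltn im.
by rewrite PoszD !(big_morph Posz PoszD erefl).
Qed.

Lemma word_pword w : size w = m.+1 -> (last (false, false) w).2 = false ->
  exists Y, w = pword Y.
Proof.
move=> sw lw.
exists (fun j => if (j <= m)%N then ~~ (nth (false, false) w j).1
  else (nth (false, false) w (m.*2 - j)).2).
apply: (@eq_from_nth _ (false, false)); first by rewrite size_pword.
move=> j; rewrite sw ltnS => jm; rewrite nth_pword // jm negbK.
have [->|jnm] /= := eqVneq j m.
  by move: lw; rewrite (last_nth (false, false)) sw /=; case: (nth _ w m) => a b /= ->.
have -> : (m.*2 - j <= m)%N = false by lia.
have -> : (m.*2 - (m.*2 - j) = j)%N by lia.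
by case: nth.
Qed.

Lemma pword_eq Y Y' : (forall j, (j <= m.*2)%N -> Y j = Y' j) <-> pword Y = pword Y'.
Proof.
split=> [YY|cc].
  apply/eq_in_map => j; rewrite mem_iota => /andP[_ jm].
  by rewrite !YY //; lia.
have h j : (j <= m)%N -> Y j = Y' j /\ (j != m -> Y (m.*2 - j)%N = Y' (m.*2 - j)%N).
  move=> jm; have := congr1 (fun w => nth (false, false) w j) cc.
  rewrite !nth_pword // => -[/negb_inj -> e]; split=> // jnm; by rewrite jnm in e.
move=> j j2; have [jm|mj] := leqP j m; first by case: (h j jm).
have [|_] := h (m.*2 - j)%N; first by lia.
have -> : (m.*2 - (m.*2 - j) = j)%N by lia.
by apply; lia.
Qed.

(** For a sorted [d] these are distinct numbers up to [2 m], so that [d] is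
    replaced by a set of [m.+1] numbers.  The letter at position [j] of its word
    compares the positions [j] and [2 m - j]; the middle one is only read
    once. *)
Definition shifted d : seq nat := [seq (nth 0 d i + i)%N | i <- iota 0 (size d)].

Definition encode d : seq letter := pword [in shifted d].

Section Encode.
Variable d : seq nat.
Hypotheses (sd : sorted leq d) (dn : size d = m.+1) (dlt : all (fun k => k < m.+1)%N d).

Let y i : nat := (nth 0 d i + i)%N.

Lemma nth_deg_le i j : (i <= j < m.+1)%N -> (nth 0 d i <= nth 0 d j)%N.
Proof.
move=> /andP[ij jn]; apply: (sorted_leq_nth leq_trans leqnn) => //.
- by rewrite inE dn (leq_ltn_trans ij).
- by rewrite inE dn.
Qed.

Lemma shifted_le i : (i < m.+1)%N -> (y i <= m + i)%N.
Proof.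
move=> im; rewrite leq_add2r -ltnS.
by move/all_nthP: dlt; apply; rewrite dn.
Qed.

Lemma shifted_sorted : sorted ltn (shifted d).
Proof.
have e i : (i < m.+1)%N -> nth 0%N (shifted d) i = y i.
  by move=> im; rewrite (nth_map 0%N) ?size_iota ?dn // nth_iota.
apply/(sortedP 0%N) => i; rewrite size_map size_iota dn => im.
rewrite !e ?(ltnW im) // /y /= addnS ltnS leq_add2r; apply: nth_deg_le.
by rewrite leqnSn.
Qed.

Lemma shifted_uniq : uniq (shifted d).
Proof. exact: (sorted_uniq ltn_trans ltnn) shifted_sorted. Qed.

Lemma sum_shifted (F : nat -> nat) :
  (\sum_(x <- shifted d) F x = \sum_(i < m.+1) F (y i))%N.
Proof.
rewrite big_map dn -{1}(subn0 m.+1) -/(index_iota 0 m.+1) big_mkord.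
by [].
Qed.

Lemma mem_shifted x : x \in shifted d -> exists2 i, (i < m.+1)%N & x = y i.
Proof. by case/mapP => i; rewrite mem_iota dn => /andP[_ im] ->; exists i. Qed.

Lemma shifted_bound x : x \in shifted d -> (x <= m.*2)%N.
Proof. by case/mem_shifted => i im ->; have := shifted_le im; lia. Qed.

Lemma encode_bridge : bridge (encode d).
Proof.
rewrite /bridge height_pword.
have -> : count [in shifted d] (iota 0 m.*2.+1) = size (shifted d).
  rewrite -size_filter; apply: perm_size; apply: uniq_perm.
  - by rewrite filter_uniq ?iota_uniq.
  - exact: shifted_uniq.
  move=> x; rewrite mem_filter mem_iota /= add0n ltnS andb_idr //.
  exact: shifted_bound.
by rewrite size_map size_iota dn subrr.
Qed.

(** The area under the walk compares, at each prefix length, the number of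
    shifted degrees close to one end of their range with those close to the
    other end. *)
Lemma encode_area N : (N <= m)%N ->
  2 * \sum_(z <- take N (hts 0 (encode d))) z = (N * N.+1)%N%:Z
   - 2 * (\sum_(i < m.+1) (N - y i))%N%:Z
   - 2 * (\sum_(i < m.+1) (N - (m.*2 - y i)))%N%:Z.
Proof.
move=> Nm; rewrite sum_take_hts ?size_pword ?(leqW Nm) //.
pose s' := [seq (m.*2 - x)%N | x <- shifted d].
have us' : uniq s'.
  rewrite map_inj_in_uniq ?shifted_uniq // => a b /shifted_bound ha /shifted_bound hb.
  lia.
have hs' j : (j <= m)%N -> (m.*2 - j \in shifted d)%N = (j \in s').
  move=> jm; apply/idP/mapP => [h|[x xs ->]].
    by exists (m.*2 - j)%N => //; lia.
  by rewrite subKn // shifted_bound.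
rewrite -(sum_shifted (fun x => N - x)%N) -(sum_shifted (fun x => N - (m.*2 - x))%N).
rewrite sum_trunc_uniq ?shifted_uniq // -(big_map (fun x => m.*2 - x)%N xpredT (fun x => N - x)%N).
rewrite -/s' sum_trunc_uniq // -sum_step_up.
rewrite (eq_bigr (fun j : 'I_N => (N - j)%N%:Z - ((N - j) * (val j \in shifted d))%N%:Z -
    ((N - j) * (val j \in s'))%N%:Z)); last first.
  move=> j _; have jm : (j < m)%N by exact: leq_trans (ltn_ord j) Nm.
  rewrite nth_pword ?(ltnW jm) // stepE /= neq_ltn jm /= -hs' ?(ltnW jm) //.
  by rewrite ?inE; case: (val j \in _); case: (_ \in _); rewrite /= ?muln0 ?muln1; ring.
rewrite !sumrB !(big_morph Posz PoszD erefl) PoszM !(big_morph Posz PoszD erefl).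
ring.
Qed.

Lemma last_area : area (encode d) = \sum_(z <- take m (hts 0 (encode d))) z.
Proof.
have sh : size (hts 0 (encode d)) = m.+1 by rewrite size_hts size_pword.
rewrite /area -{1}(cat_take_drop m (hts 0 (encode d))) big_cat.
rewrite (drop_nth 0) ?sh // [drop m.+1 _]drop_oversize ?sh // big_seq1.
rewrite nth_hts ?size_pword // [take m.+1 _]take_oversize ?size_pword // add0r.
by have /eqP -> := encode_bridge; exact: addr0.
Qed.

Lemma encode_sinai : sinai (encode d) =
  all (fun N => 0 <= \sum_(z <- take N (hts 0 (encode d))) z) (iota 0 m.+1).
Proof.
rewrite /sinai encode_bridge andTb [size _]size_pword -[m.+2]addn1 iotaD all_cat.
rewrite add0n [X in _ && X]andbT take_oversize ?size_hts ?size_pword //.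
rewrite -/(area _) last_area andb_idr // => /allP -> //.
by rewrite mem_iota add0n ltnSn.
Qed.

Lemma encode_parity : odd `|area (encode d)|%N = odd (\sum_(i < m.+1) nth 0 d i).
Proof.
have := encode_area (leqnn m); rewrite -last_area => aE.
have e1 : (\sum_(i < m.+1) (m - y i) + \sum_(i < m.+1) (m - (m.*2 - y i)) + \sum_(i < m.+1) y i =
   m.+1 * m + 2 * \sum_(i < m.+1) (y i - m))%N.
  rewrite big_distrr /= -[X in (X * m)%N]card_ord -sum_nat_const -!big_split /=.
  apply: eq_bigr => i _; have := shifted_le (ltn_ord i); have := ltn_ord i.
  move: (y i) => yi; lia.
have e2 : (\sum_(i < m.+1) y i = \sum_(i < m.+1) nth 0 d i + \sum_(i < m.+1) i)%N.
  by rewrite -big_split.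
have e3 : (2 * \sum_(i < m.+1) i = m * m.+1)%N.
  elim: (m) => [|k IH]; first by rewrite big_ord1.
  by rewrite big_ord_recr /= mulnDr IH; lia.
move: (area _) aE e1 e2 e3 => a; clear; gen_atoms => aE e1 e2 e3.
have [q qE] : exists q, (m * m.+1 = 2 * q)%N.
  by exists (m * m.+1)./2; rewrite mul2n even_halfK // oddM /= andbN.
lia.
Qed.

End Encode.
End PositionWord.

Lemma sum_ord_id k : (2 * \sum_(i < k) i + k = k * k)%N.
Proof.
elim: k => [|k IH]; first by rewrite big_ord0.
by rewrite big_ord_recr; move: IH; clear; gen_atoms => /=; nia.
Qed.

Section EncodeGraphical.
Variables (m : nat) (d : seq nat).
Hypotheses (sd : sorted leq d) (dn : size d = m.+1) (dlt : all (fun k => k < m.+1)%N d).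

Let y i : nat := (nth 0 d i + i)%N.
Let dd (i : 'I_m.+1) : nat := nth 0%N d i.

(** A violation at [S] and [T] shows up in the prefix of length
    [#|S| + #|T| - 1]: there the area is at most minus the excess, as the low
    sums over [T] and the high sums over [S] are attained at the ends of the
    sequence. *)
Lemma sinai_excess (S T : {set 'I_m.+1}) : sinai (encode m d) ->
  [disjoint S & T] -> excess m.+1 dd S T <= 0.
Proof.
move=> /sinaiP[_ pos] dj.
have [M0|M0] := eqVneq (#|S| + #|T|)%N 0%N.
  have /eqP/cards0_eq S0 : #|S| == 0%N by move/eqP: M0; rewrite addn_eq0 => /andP[].
  have /eqP/cards0_eq T0 : #|T| == 0%N by move/eqP: M0; rewrite addn_eq0 => /andP[].
  by rewrite S0 T0 /excess !big_set0 !cards0 mul0r !subr0.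
have Mn : (#|S| + #|T| <= m.+1)%N.
  by rewrite -cardsUd // -[leqRHS]card_ord max_card.
pose N := (#|S| + #|T|).-1.
have Nm : (N <= m)%N by rewrite /N; move: Mn; clear; gen_atoms; lia.
have [Sm Tm] : (#|S| <= m.+1 /\ #|T| <= m.+1)%N.
  by move: Mn; clear; gen_atoms; lia.
have aE := encode_area sd dn dlt Nm; have := pos N => Npos.
have f1 := @low_sum _ (nth 0%N d) T (nth_deg_le sd dn).
have f2 := @high_sum _ (nth 0%N d) S (nth_deg_le sd dn).
have A1 : (#|T| * N <= \sum_(i < m.+1) (N - y i) + \sum_(i < #|T|) y i)%N.
  rewrite (big_ord_widen m.+1 y Tm) [X in (_ <= _ + X)%N]big_mkcond -big_split /=.
  apply: (@leq_trans (\sum_(i < m.+1 | (i < #|T|)%N) N)).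
    by rewrite -(big_ord_widen m.+1 (fun => N) Tm) sum_nat_const card_ord.
  rewrite [leqLHS]big_mkcond; apply: leq_sum => i _; case: ifP => _ //.
  by rewrite addnC -leq_subLR.
have A2 : (\sum_(i < #|T|) y i = \sum_(i < #|T|) nth 0 d i + \sum_(i < #|T|) i)%N.
  by rewrite -big_split.
have B1 : (#|S| * N <= \sum_(i < m.+1) (N - (m.*2 - y i)) +
    \sum_(i < #|S|) (m.*2 - y (m.+1 - i.+1)))%N.
  rewrite -(big_mkord xpredT (fun i => N - (m.*2 - y i))%N) big_rev_mkord subn0 /=.
  rewrite (big_ord_widen m.+1 (fun i => m.*2 - y (m.+1 - i.+1))%N Sm).
  rewrite [X in (_ <= _ + X)%N]big_mkcond -big_split /=.
  apply: (@leq_trans (\sum_(i < m.+1 | (i < #|S|)%N) N)).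
    by rewrite -(big_ord_widen m.+1 (fun => N) Sm) sum_nat_const card_ord.
  rewrite [leqLHS]big_mkcond; apply: leq_sum => i _; case: ifP => _ //.
  by rewrite addnC -leq_subLR.
have B2 : (\sum_(i < #|S|) (m.*2 - y (m.+1 - i.+1)) +
    \sum_(i < #|S|) nth 0 d (m.+1 - i.+1) = #|S| * m + \sum_(i < #|S|) i)%N.
  rewrite -big_split -[X in (X * m)%N]card_ord -sum_nat_const -big_split /=.
  apply: eq_bigr => i _; have im : (i < m.+1)%N := leq_trans (ltn_ord i) Sm.
  have := @shifted_le _ _ dn dlt (m.+1 - i.+1)%N; rewrite /y subSS.
  by move: (nth 0%N d _) im => z im; lia.
have s1 := sum_ord_id #|S|; have s2 := sum_ord_id #|T|.
have NE : (N.+1 = #|S| + #|T|)%N by rewrite /N prednK // lt0n.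
move: (N) NE aE Npos A1 A2 B1 B2 f1 f2 s1 s2 => N' NE; rewrite /excess -/y.
move: (\sum_(z <- _) z) => Z; rewrite /dd.
move: NE; move: #|S| #|T| => k l; clear; gen_atoms => NE aE Npos A1 A2 B1 B2 f1 f2 s1 s2.
have p1 := congr1 (muln N') NE; have p2 := congr1 (muln k) NE.
have p3 := congr1 (muln l) NE; lia.
Qed.

(** For the prefix of length [N], the vertices at distance less than [N] from the
    lower and from the upper end of the range serve as [T] and [S].  With
    [x = N - #|S| - #|T|] the area is then at least
    [(x * x + x) / 2 - excess S T]. *)
Lemma excess_sinai : (forall S T : {set 'I_m.+1}, [disjoint S & T] ->
  excess m.+1 dd S T <= 0) -> sinai (encode m d).
Proof.
move=> ex; rewrite encode_sinai //; apply/allP => N; rewrite mem_iota add0n ltnS => Nm.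
have aE := encode_area sd dn dlt Nm.
pose T := [set i : 'I_m.+1 | (y i < N)%N].
pose S := [set i : 'I_m.+1 | (m.*2 - y i < N)%N].
have yle (i : 'I_m.+1) : (y i <= m.*2)%N.
  have : (y i <= m + i)%N := shifted_le dn dlt (ltn_ord i).
  by have := ltn_ord i; move: (y i) (val i); lia.
have dj : [disjoint S & T].
  apply: disjI => i; rewrite !inE; have := yle i; move: (y i); lia.
have A1 : (\sum_(i < m.+1) (N - y i) + \sum_(i in T) y i = #|T| * N)%N.
  rewrite -sum_nat_const [X in (_ + X)%N]big_mkcond -big_split [RHS]big_mkcond /=.
  apply: eq_bigr => i _; rewrite inE; case: ltnP => h; first by rewrite subnK // ltnW.
  by rewrite addn0; apply/eqP; rewrite subn_eq0.
have A2 : (\sum_(i in T) y i = \sum_(i in T) dd i + \sum_(i in T) i)%N.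
  by rewrite -big_split.
have A3 := @low_sum _ id T (fun i j => fun ij => proj1 (andP ij)).
have B1 : (\sum_(i < m.+1) (N - (m.*2 - y i)) + \sum_(i in S) (m.*2 - y i) = #|S| * N)%N.
  rewrite -sum_nat_const [X in (_ + X)%N]big_mkcond -big_split [RHS]big_mkcond /=.
  apply: eq_bigr => i _; rewrite inE; case: ltnP => h; first by rewrite subnK // ltnW.
  by rewrite addn0; apply/eqP; rewrite subn_eq0.
have B2 : (\sum_(i in S) (m.*2 - y i) + \sum_(i in S) dd i + \sum_(i in S) i = #|S| * m.*2)%N.
  rewrite -sum_nat_const -!big_split /=; apply: eq_bigr => i _.
  by rewrite -addnA subnK.
have B3 := @high_sum _ id S (fun i j => fun ij => proj1 (andP ij)).
have Sm : (#|S| <= m.+1)%N by rewrite -[leqRHS]card_ord max_card.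
have B4 : (\sum_(i < #|S|) (m.+1 - i.+1) + \sum_(i < #|S|) i = #|S| * m)%N.
  rewrite -big_split -[X in (X * m)%N]card_ord -sum_nat_const /=.
  apply: eq_bigr => i _; rewrite subSS subnK //.
  by rewrite -ltnS (leq_trans (ltn_ord i) Sm).
have s1 := sum_ord_id #|S|; have s2 := sum_ord_id #|T|.
have := ex S T dj; move: aE A1 A2 A3 B1 B2 B3 B4 s1 s2; rewrite /excess -/y.
move: (\sum_(z <- _) z) #|S| #|T| => Z k l; clear; gen_atoms.
move=> aE A1 A2 A3 B1 B2 B3 B4 s1 s2 E.
have sq x : 0 <= x * (x + 1) :> int by case: (lerP 0 x) => h; nia.
have := sq (N%:Z - k%:Z - l%:Z); lia.

Qed.

Lemma encode_good : good (encode m d) <-> graphical m.+1 d.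
Proof.
rewrite /good last_pword /=; split=> [/andP[sw ev]|gd].
  apply: excess_graphical => //; first by rewrite -(encode_parity sd dn dlt).
  by move=> S T; exact: sinai_excess.
have [ev ex] := graphical_excess gd.
by rewrite (excess_sinai ex) (encode_parity sd dn dlt).
Qed.

End EncodeGraphical.

Section Decode.
Variable m : nat.

Lemma encode_inj (d d' : seq nat) :
  sorted leq d -> size d = m.+1 -> all (fun k => k < m.+1)%N d ->
  sorted leq d' -> size d' = m.+1 -> all (fun k => k < m.+1)%N d' ->
  encode m d = encode m d' -> d = d'.
Proof.
move=> sd dn dlt sd' dn' dlt' /pword_eq mm.
have ss : shifted d = shifted d'.
  apply: (@irr_sorted_eq _ ltn ltn_trans ltnn).
  - exact: (shifted_sorted sd dn).
  - exact: (shifted_sorted sd' dn').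
  move=> x; have [xm|mx] := leqP x m.*2; first exact: mm.
  apply/idP/idP => /shifted_bound; move=> /(_ m) H.
    by have := H sd dn dlt; rewrite leqNgt mx.
  by have := H sd' dn' dlt'; rewrite leqNgt mx.
apply: (@eq_from_nth _ 0%N); first by rewrite dn.
move=> i; rewrite dn => im; apply/eqP; rewrite -(eqn_add2r i); apply/eqP.
have := congr1 (fun s => nth 0%N s i) ss.
by rewrite !(nth_map 0%N) ?size_iota ?dn ?dn' // !nth_iota ?dn ?dn'.
Qed.

Lemma encode_onto w : size w = m.+1 -> bridge w ->
  (last (false, false) w).2 = false ->
  exists d, [/\ sorted leq d, size d = m.+1, all (fun k => k < m.+1)%N d &
    encode m d = w].
Proof.
move=> sw bw lw; have [Y wY] := word_pword sw lw.
pose s := [seq x <- iota 0 m.*2.+1 | Y x].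
have ssz : size s = m.+1.
  by move: bw; rewrite /bridge wY height_pword subr_eq0 eqz_nat size_filter => /eqP ->.
have smem x : (x \in s) = Y x && (x <= m.*2)%N.
  by rewrite mem_filter mem_iota add0n ltnS.
have ssort : sorted ltn s by apply: sorted_filter (iota_ltn_sorted _ _); exact: ltn_trans.
have slt i j : (i <= j)%N -> (j < m.+1)%N -> (nth 0%N s i + (j - i) <= nth 0%N s j)%N.
  move=> ij; rewrite -(subnKC ij) addKn; elim: (j - i)%N => [|k IH] jm.
    by rewrite !addn0.
  have := IH (ltn_trans _ jm); rewrite ltn_add2l ltnSn => /(_ isT) h.
  rewrite addnS; apply: leq_ltn_trans h _; rewrite addnS.
  by move/(sortedP 0%N): ssort; apply; rewrite ssz -addnS.
pose d := [seq (nth 0 s i - i)%N | i <- iota 0 m.+1].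
have dn : size d = m.+1 by rewrite size_map size_iota.
have dE i : (i < m.+1)%N -> nth 0%N d i = (nth 0 s i - i)%N.
  by move=> im; rewrite (nth_map 0%N) ?size_iota // nth_iota.
have le_s i : (i < m.+1)%N -> (i <= nth 0 s i)%N.
  by move=> im; have := @slt 0%N i isT im; lia.
have s_le i : (i < m.+1)%N -> (nth 0 s i <= m + i)%N.
  move=> im; have := @slt i m im (ltnSn m).
  have : nth 0%N s m \in s by rewrite mem_nth // ssz.
  by rewrite smem => /andP[_]; lia.
exists d; split=> //.
- apply/(sortedP 0%N) => i; rewrite dn => im; rewrite !dE ?(ltnW im) //.
  by have := @slt i i.+1 (leqnSn i) im; lia.
- apply/(all_nthP 0%N) => i; rewrite dn => im; rewrite dE //.
  by have := s_le i im; lia.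
have -> : encode m d = pword m [in s].
  apply/pword_eq => j _; congr (j \in _); rewrite /shifted dn.
  apply: (@eq_from_nth _ 0%N); first by rewrite size_map size_iota.
  move=> i; rewrite size_map size_iota => im.
  by rewrite (nth_map 0%N) ?size_iota // nth_iota // add0n dE // subnK // le_s.
rewrite wY; apply/pword_eq => j jm; by rewrite /= smem jm andbT.
Qed.

End Decode.

(** Sets of [m.+1] numbers up to [2 m] correspond to closed walks, by
    [height_pword]. *)
Lemma num_graphicalE m : num_graphical m.+1 = count good (words m.+1).
Proof.
pose A := [seq map val (val d) | d in
  [pred d : m.+1.-tuple 'I_m.+1 | `[< graphical m.+1 (map val d) >]]].
have memA (d : seq nat) : d \in A <-> graphical m.+1 d.
  split=> [/mapP[t]|gd]; first by rewrite mem_enum inE => /asboolP gt ->.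
  have [sd dn dlt] := graphical_bounded gd.
  have st : size [seq (inord k : 'I_m.+1) | k <- d] == m.+1 by rewrite size_map dn.
  have td : d = map val (Tuple st).
    rewrite /= -map_comp -[LHS]map_id; apply/eq_in_map => k kd /=.
    by rewrite inordK //; move/allP: dlt; apply.
  by apply/mapP; exists (Tuple st); rewrite // mem_enum inE; apply/asboolP; rewrite -td.
have -> : num_graphical m.+1 = size [seq encode m d | d <- A].
  by rewrite !size_map -cardE.
rewrite -size_filter; apply: perm_size; apply: uniq_perm.
- rewrite map_inj_in_uniq; last first.
    move=> d d' /memA/graphical_bounded[? ? ?] /memA/graphical_bounded[? ? ?].
    exact: encode_inj.
  by rewrite map_inj_uniq ?enum_uniq // => t t' /(inj_map val_inj)/val_inj.
- by rewrite filter_uniq // words_uniq.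
move=> w; rewrite mem_filter mem_words; apply/mapP/andP => [[d /memA gd ->]|[gw /eqP sw]].
  have [sd dn dlt] := graphical_bounded gd.
  by rewrite (encode_good sd dn dlt) size_pword.
move: (gw) => /and3P[/sinaiP[bw _] lw _].
have [d [sd dn dlt dw]] := encode_onto sw bw (negbTE lw).
by exists d; rewrite // memA -(encode_good sd dn dlt) dw.
Qed.

(** * Tours of plane trees *)

Lemma connect_split (T : finType) (e : rel T) x y v : connect e x y ->
  connect [rel a b | [&& e a b, a != v & b != v]] x y \/ connect e v y.
Proof.
move=> /connectP[p ep ->].
have [vp|vp] := boolP (v \in x :: p); last first.
  left; apply/connectP; exists p => //.
  elim: p x ep vp => //= z p IH x /andP[xz zp]; rewrite !inE !negb_or.
  move=> /and3P[vx vz vp].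
  by rewrite xz ![_ == v]eq_sym vx vz IH // inE negb_or vz.
right; case/splitPl: vp ep => p1 p2 <-; rewrite cat_path last_cat => /andP[_ ep2].
by apply/connectP; exists p2.
Qed.

(** A path without repetitions does not come back to its start. *)
Lemma connect_first (T : finType) (e : rel T) x y : connect e x y -> x != y ->
  exists2 z, e x z & connect [rel a b | [&& e a b, a != x & b != x]] z y.
Proof.
move=> /connectP[p0 ep0 ->]; case/shortenP: ep0 => [[|z p]] //=; first by rewrite eqxx.
move=> /andP[xz zp] /and3P[]; rewrite inE negb_or => /andP[xz' xp] _ _ _ _.
exists z => //; apply/connectP; exists p => //.
elim: p z zp xz' xp {xz} => //= a p IH z /andP[za ap] xz; rewrite inE negb_or.
by move=> /andP[xa xp]; rewrite za ![_ == x]eq_sym xz xa IH.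
Qed.

Section Tree.
Variables (V : finType) (E : {set V * V}) (r : V).
Implicit Types (u v w x y : V).

Notation e := (adj E).
#[local] Arguments adj : simpl never.

Definition off v : rel V := [rel x y | [&& e x y, x != v & y != v]].

(** In a tree: [u] is on the path from [v] to the root. *)
Definition anc u v : bool := (v == u) || ~~ connect (off u) v r.

(** In a tree: [w] is the parent of [v]. *)
Definition up v w : bool := e v w && connect (off v) w r.

Definition depth v : nat := #|[set u | anc u v]|.

Hypothesis tE : tree_graph E.

Let e_sym : symmetric e. Proof. by case: tE => -[]. Qed.
Let e_irr : irreflexive e. Proof. by case: tE => -[]. Qed.
Let e_conn x y : connect e x y. Proof. by case: tE. Qed.

Lemma adj_neq v w : e v w -> (v == w) = false.
Proof. by case: eqP => // ->; rewrite e_irr. Qed.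

Lemma off_sym v : connect_sym (off v).
Proof.
by apply: sym_connect_sym => x y; rewrite /off /= e_sym; case: (x == v); case: (y == v).
Qed.

Lemma off_neq v x y : connect (off v) x y -> (x == v) = (y == v).
Proof.
move=> /connectP[p ep ->]; elim: p x ep => //= z p IH x /andP[/and3P[_ xv zv] zp].
by rewrite -IH // (negPf xv) (negPf zv).
Qed.

(** A path between two neighbours of [v] that avoids [v] closes up to a
    cycle. *)
Lemma off_neighbours v x y : e v x -> e v y -> connect (off v) x y -> x = y.
Proof.
move=> vx vy /connectP[p0 ep0 yl]; move: vy; rewrite {}yl.
case/shortenP: ep0 => p ep up _ vy; case: p ep up vy => //= z p ep up vy.
have [_ _ ac] := tE; suff /ac : ucycle e [:: v, x, z & p] by [].
have nv a q : a != v -> path (off v) a q -> v \notin a :: q.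
  elim: q a => [|b q IH] a av /=; first by rewrite inE eq_sym.
  move=> /andP[/and3P[_ _ bv] bq]; rewrite inE negb_or eq_sym av; exact: IH.
have xv : x != v by rewrite eq_sym (adj_neq vx).
have vn := nv x (z :: p) xv ep.
move: ep => /andP[/and3P[xz _ zv] zp].
rewrite /ucycle cons_uniq vn /= up andbT vx xz /= rcons_path e_sym vy andbT.
by apply: sub_path zp => a b /and3P[].
Qed.

Lemma up_adj v w : up v w -> e v w. Proof. by case/andP. Qed.

Lemma up_uniq v w x : up v w -> up v x -> w = x.
Proof.
move=> /andP[vw wr] /andP[vx xr]; apply: (off_neighbours vw vx).
by apply: connect_trans wr _; rewrite off_sym.
Qed.

Lemma up_root w : up r w = false.
Proof.
apply/negP => /andP[rw /off_neq]; rewrite eqxx => /eqP wr.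
by rewrite wr e_irr in rw.
Qed.

Lemma up_exists v : v != r -> exists w, up v w.
Proof.
by move=> vr; have [w vw wr] := connect_first (e_conn v r) vr; exists w; apply/andP.
Qed.

Lemma up_total v w : e v w -> up v w || up w v.
Proof.
move=> vw; have [wr|wr] := eqVneq w r; first by rewrite /up vw wr connect0.
have [x /andP[wx xr]] := up_exists wr.
have [vx|xv] := eqVneq v x; first by rewrite vx [X in _ || X]/up wx xr orbT.
have [xr'|vr] := connect_split v xr; last by rewrite [X in _ || X]/up e_sym vw vr orbT.
rewrite /up vw; apply/orP; left; apply: (@connect_trans _ _ x).
  by apply: connect1; rewrite /off /= wx eq_sym (adj_neq vw) eq_sym.
by apply: connect_sub xr' => a b /and3P[/and3P[ab _ _] av bv]; apply: connect1; apply/and3P.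
Qed.

Lemma up_asym v w : up v w -> up w v = false.
Proof.
move=> vw; apply/negP => /andP[wv vr].
have vr' : v != r by apply/eqP => vr'; rewrite vr' up_root in vw.
have [x /and3P[vx _ xw] xr] := connect_first vr vr'.
have vx' : up v x.
  rewrite /up vx; apply: connect_sub xr => a b /and3P[/and3P[ab _ _] av bv].
  by apply: connect1; apply/and3P.
by rewrite (up_uniq vx' vw) eqxx in xw.
Qed.

Lemma upC v w : e v w -> up w v = ~~ up v w.
Proof.
move=> vw; have := up_total vw; have [vw'|] := boolP (up v w); first by rewrite up_asym.
by [].
Qed.

(** The only way out of the descendants of [w] is from [w] to its parent. *)
Lemma anc_exit w x y : e x y -> anc w x -> ~~ anc w y -> x = w /\ up w y.
Proof.
move=> xy wx; rewrite /anc negb_or negbK => /andP[yw yr].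
have [xw|xw] := eqVneq x w; first by rewrite -xw /up xy xw yr.
move: wx; rewrite /anc (negPf xw) /= => /negP[]; apply: connect_trans yr.
by apply: connect1; apply/and3P.
Qed.

Lemma anc_refl w : anc w w. Proof. by rewrite /anc eqxx. Qed.

Lemma up_anc v w : up v w -> ~~ anc v w.
Proof.
by move=> /andP[vw wr]; rewrite /anc negb_or negbK eq_sym (adj_neq vw).
Qed.

Lemma anc_up u v w : up v w -> anc u v = (u == v) || anc u w.
Proof.
move=> vw; have /andP[ew wr] := vw.
have [->|uv] := eqVneq u v; first by rewrite anc_refl.
have [->|uw] := eqVneq u w.
  by have := up_asym vw; rewrite /up e_sym ew /= => nc; rewrite anc_refl /anc nc orbT.
rewrite /anc ![_ == u]eq_sym (negPf uv) (negPf uw) /=; congr (~~ _).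
apply: same_connect; first exact: off_sym.
by apply: connect1; rewrite /off /= ew ![_ == u]eq_sym uv.
Qed.

Lemma depth_up v w : up v w -> depth v = (depth w).+1.
Proof.
move=> vw; rewrite /depth (cardsD1 v) inE anc_refl add1n; congr (_.+1).
apply: eq_card => u; rewrite !inE (anc_up u vw).
by case: eqP => // ->; rewrite (negPf (up_anc vw)).
Qed.

Lemma depth_anc w x : anc w x -> (depth w <= depth x)%N.
Proof.
move=> wx; apply/subset_leq_card/subsetP => u; rewrite !inE => uw.
apply: contraLR uw; rewrite /anc !negb_or !negbK => /andP[xu xr].
move: wx; have [<-|xw] := eqVneq x w; first by rewrite xu xr.
rewrite /anc (negPf xw) /= => xr'.
have [h|wr] := connect_split w xr.
  case/negP: xr'; apply: connect_sub h => a b /and3P[/and3P[ab _ _] av bv].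
  by apply: connect1; apply/and3P.
by rewrite wr andbT; apply: contra xr' => /eqP ->.
Qed.

(** Every vertex but the root has one parent. *)
Lemma card_up : #|[set x in E | up x.1 x.2]| = #|V|.-1.
Proof.
rewrite -(@card_in_imset _ _ fst); last first.
  move=> [v w] [v' x]; rewrite !inE /= => /andP[_ vw] /andP[_ vx] vv.
  by rewrite -vv in vx *; rewrite (up_uniq vw vx).
suff -> : [set x.1 | x in [set x in E | up x.1 x.2]] = [set~ r] by rewrite cardsC1.
apply/setP => v; rewrite !inE; apply/imsetP/idP => [[x]|vr].
  by rewrite inE => /andP[_ vw] ->; apply/eqP => xr; rewrite xr up_root in vw.
have [w vw] := up_exists vr; exists (v, w) => //.
by rewrite inE /= vw andbT; exact: up_adj.
Qed.

Definition opp_arc (x : V * V) : V * V := (x.2, x.1).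

Lemma opp_arcK : involutive opp_arc. Proof. by case. Qed.

Lemma card_down : #|[set x in E | ~~ up x.1 x.2]| = #|V|.-1.
Proof.
rewrite -card_up -[RHS](card_imset _ (can_inj opp_arcK)); apply: eq_card => x.
apply/idP/imsetP => [|[y]].
  rewrite inE => /andP[xE ux]; have xe : e x.1 x.2 by rewrite /adj -surjective_pairing.
  exists (opp_arc x); rewrite ?opp_arcK // inE /= (upC xe) ux andbT.
  by move: xe; rewrite e_sym.
move=> + ->; rewrite !inE => /andP[yE uy]; have ye : e y.1 y.2 by rewrite /adj -surjective_pairing.
rewrite /= (up_asym uy) andbT.
by move: ye; rewrite e_sym.
Qed.

Lemma card_arcs : #|E| = (#|V|.-1).*2.
Proof.
rewrite -addnn -{1}card_up -card_down -(cardsID [set x | up x.1 x.2] E).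
by congr (_ + _)%N; apply: eq_card => x; rewrite !inE andbC.
Qed.

End Tree.

Section Tour.
Variables (V : finType) (P : rooted_map V).
Hypothesis tP : rooted_plane_tree P.
Implicit Types (u v w : V) (x y : V * V).

Notation E := (arcs P).
Notation e := (adj (arcs P)).
Notation r := (Defs.root P).

(** The face permutation of the map; a tree has a single face. *)
Definition next_arc x : V * V := (x.2, Defs.rot P x.2 x.1).

Definition down x : bool := ~~ up E r x.1 x.2.

Lemma tree_tE : tree_graph E. Proof. by case: tP. Qed.
Let tE := tree_tE.
Let e_sym : symmetric e. Proof. by case: tE => -[]. Qed.

Lemma arcE x : (x \in E) = e x.1 x.2.
Proof. by rewrite /adj -surjective_pairing. Qed.

Lemma opp_arc_in x : (opp_arc x \in E) = (x \in E).
Proof. by rewrite !arcE /= e_sym. Qed.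

Lemma next_arc_inj : injective next_arc.
Proof. by move=> [v w] [v' w'] [-> /perm_inj ->]. Qed.

Lemma rot_adj v w : e v (Defs.rot P v w) = e v w.
Proof.
case: tP => _ /(_ v)[on _]; have := perm_closed w on.
by rewrite !inE.
Qed.

Lemma next_arc_in x : (next_arc x \in E) = (x \in E).
Proof. by rewrite !arcE /= rot_adj e_sym. Qed.

Lemma iter_next_in k x : (iter k next_arc x \in E) = (x \in E).
Proof. by elim: k => //= k IH; rewrite next_arc_in. Qed.

Lemma down_opp x : x \in E -> down (opp_arc x) = ~~ down x.
Proof. by rewrite arcE => xE; rewrite /down /= (upC _ tE xE). Qed.

(** The tour that enters the descendants of [w] through an arc from its parent
    leaves them through the opposite arc. *)
Lemma tour_return x : x \in E -> down x -> exists i,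
  iter i next_arc x = opp_arc x /\
  forall j, (0 < j <= i)%N -> anc E r x.2 (iter j next_arc x).1.
Proof.
case: x => v w xE dx; have vw : e v w by rewrite arcE in xE.
have wv : up E r w v by rewrite (upC _ tE vw).
pose x := (v, w); pose Q j := ~~ anc E r w (iter j.+1 next_arc x).1.
have exQ : exists j, Q j.
  exists (order next_arc x).-1; rewrite /Q prednK ?order_gt0 //.
  by rewrite iter_order ?(up_anc tE wv) //; exact: next_arc_inj.
case: (ex_minnP exQ) => j Qj jmin.
have inside k : (0 < k <= j)%N -> anc E r w (iter k next_arc x).1.
  case: k => // k /= kj; apply: contraLR (kj) => Qk; rewrite -leqNgt; exact: jmin.
exists j; split=> //.
have j0 : (0 < j)%N by case: (j) Qj => //; rewrite /Q /= anc_refl.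
have yE : iter j next_arc x \in E by rewrite iter_next_in.
move: (inside j); rewrite j0 leqnn => /(_ isT) ay.
move: Qj yE ay; rewrite /Q iterS /next_arc /=; case: (iter j _ _) => a b /= nb ab wa.
rewrite arcE in ab; have [aw wb] := anc_exit ab wa nb.
move: aw wb => /= aw wb; by rewrite /opp_arc /= aw (up_uniq tE wb wv).
Qed.

Definition rise k x : int :=
  \sum_(j < k) (if down (iter j next_arc x) then 1 else -1).

Lemma depth_arc x : x \in E ->
  (depth E r x.2)%:Z = (depth E r x.1)%:Z + (if down x then 1 else -1).
Proof.
rewrite arcE /down => xE; have := upC r tE xE; case: (boolP (up _ _ x.1 _)) => u1 /= u2.
  by rewrite (depth_up tE u1) -addn1 PoszD addrK.
by rewrite (depth_up tE u2) -addn1 PoszD.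
Qed.

Lemma riseE k x : x \in E ->
  rise k x = (depth E r (iter k next_arc x).1)%:Z - (depth E r x.1)%:Z.
Proof.
move=> xE; elim: k => [|k IH]; first by rewrite /rise big_ord0 subrr.
rewrite /rise big_ord_recr /= -/(rise k x) IH.
have := @depth_arc (iter k next_arc x); rewrite iter_next_in => /(_ xE) ->.
ring.
Qed.

(** Hence the arc opposite to a given one is determined by the directions of
    the arcs of the tour. *)
Lemma rise_return x : x \in E -> down x -> exists i,
  [/\ iter i next_arc x = opp_arc x, rise i.+1 x = 0 &
    forall j, (0 < j <= i)%N -> 0 < rise j x].
Proof.
move=> xE dx; have [i [ix inside]] := tour_return xE dx.
exists i; split=> // [|j ji]; first by rewrite riseE //= ix /= subrr.
rewrite riseE //; have := depth_anc (inside j ji).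
have := depth_arc xE; rewrite dx; lia.
Qed.

Lemma tour_opp x : x \in E -> fconnect next_arc x (opp_arc x).
Proof.
move=> xE; have [dx|dx] := boolP (down x).
  by have [i [<- _]] := tour_return xE dx; exact: fconnect_iter.
rewrite fconnect_sym; last exact: next_arc_inj.
have := @tour_return (opp_arc x); rewrite opp_arc_in down_opp // xE dx opp_arcK.
by move=> /(_ isT isT)[i [ix _]]; rewrite -[X in fconnect _ _ X]ix; exact: fconnect_iter.
Qed.

(** The arcs at a vertex follow each other in the rotation, by passing to the
    opposite arc and then to the next one. *)
Lemma tour_connect x y : x \in E -> y \in E -> fconnect next_arc x y.
Proof.
have csym := fconnect_sym next_arc_inj.
have arnd v w w' : e v w -> e v w' -> fconnect next_arc (v, w) (v, w').
  move=> vw vw'; case: tP => _ /(_ v)[_ /(_ w)]; rewrite inE => /(_ vw) pw.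
  have : w' \in porbit (Defs.rot P v) w by rewrite pw inE.
  case/porbitP => k ->; elim: k => [|k IH]; first by rewrite expg0 perm1.
  have vk : e v ((Defs.rot P v ^+ k)%g w).
    have : (Defs.rot P v ^+ k)%g w \in porbit (Defs.rot P v) w by exact: mem_porbit.
    by rewrite pw inE.
  apply: connect_trans IH _; rewrite expgSr permM.
  apply: connect_trans (tour_opp _) _; first by rewrite arcE.
  by apply: (fconnect1 next_arc).
case: x y => v w [v' w']; rewrite !arcE /= => vw vw'.
have /connectP[p ep vl] : connect e v v' by case: tE.
elim: p v w vw ep vl => [|a p IH] v w vw /=; first by move=> _ vl; rewrite vl in vw' *; exact: arnd.
move=> /andP[va ap] vl; apply: connect_trans (arnd _ _ _ vw va) _.
apply: connect_trans (tour_opp _) _; first by rewrite arcE.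
by apply: IH => //=; rewrite e_sym.
Qed.

Lemma orbit_tour x : x \in E -> orbit next_arc x =i E.
Proof.
move=> xE y; rewrite -fconnect_orbit; apply/idP/idP => [/iter_findex <-|].
  by rewrite iter_next_in.
exact: tour_connect.
Qed.

Lemma order_tour x : x \in E -> order next_arc x = (#|V|.-1).*2.
Proof.
move=> xE; rewrite -(card_arcs r tE); apply: eq_card => y.
by rewrite -topredE /= fconnect_orbit orbit_tour.
Qed.

End Tour.

(** * Plane trees from their tours *)

Lemma connect_homo (T T' : finType) (e : rel T) (e' : rel T') (f : T -> T') x y :
  (forall a b, e a b -> e' (f a) (f b)) -> connect e x y -> connect e' (f x) (f y).
Proof.
move=> ee /connectP[p ep ->]; apply/connectP; exists (map f p); last by rewrite last_map.
by elim: p x ep => //= a p IH x /andP[/ee -> /IH].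
Qed.

(** An injective homomorphism of trees preserves parents: it maps a path that
    avoids [v] to one that avoids the image of [v], and exactly one of two
    adjacent vertices is the parent of the other. *)
Lemma up_homo (V V' : finType) (E : {set V * V}) (E' : {set V' * V'}) r r' (f : V -> V') :
  tree_graph E -> tree_graph E' -> injective f -> f r = r' ->
  (forall v w, adj E v w -> adj E' (f v) (f w)) ->
  forall v w, adj E v w -> up E' r' (f v) (f w) = up E r v w.
Proof.
move=> tE tE' finj <- ff.
have homo v w : up E r v w -> up E' (f r) (f v) (f w).
  move=> /andP[vw wr]; apply/andP; split; first exact: ff.
  apply: connect_homo wr => a b /and3P[ab av bv].
  by rewrite /off /= ff // !(inj_eq finj) av.
move=> v w vw; apply/idP/idP; last exact: homo.
apply: contraLR => nu; have wv : up E r w v by rewrite (upC r tE vw).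
by rewrite (up_asym tE' (homo _ _ wv)).
Qed.

Section TourWords.
Variable m : nat.
Notation N := (m.*2.+2).

(** The positions are taken modulo the number of arcs, so that another start of
    the tour shifts this set. *)
Definition tour_word (V : finType) (P : rooted_map V) x : {set 'I_N} :=
  [set i : 'I_N | down P (iter i (next_arc P) x)].

Definition shift (A : {set 'I_N}) (k : 'I_N) : {set 'I_N} :=
  [set i | (k + i)%R \in A].

Definition tour_words (V : finType) (P : rooted_map V) : {set {set 'I_N}} :=
  [set tour_word P x | x in arcs P].

Section OneTree.
Variables (V : finType) (P : rooted_map V).
Hypotheses (tP : rooted_plane_tree P) (cV : #|V| = m.+2).
Notation nx := (next_arc P).

Lemma order_next x : x \in arcs P -> order nx x = N.
Proof. by move=> xE; rewrite (order_tour tP xE) cV doubleS. Qed.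

Lemma iter_next_mod k x : x \in arcs P -> iter (k %% N) nx x = iter k nx x.
Proof.
move=> xE; rewrite [in RHS](divn_eq k N) addnC iterD; congr (iter _ _ _).
elim: (k %/ N)%N => // q IH; rewrite mulSn addnC iterD -{2}(order_next xE).
by rewrite iter_order //; exact: next_arc_inj.
Qed.

Lemma arc_iter x y : x \in arcs P -> y \in arcs P -> exists k : 'I_N, iter k nx x = y.
Proof.
move=> xE yE; have xy := tour_connect tP xE yE.
have := findex_max xy; rewrite (order_next xE) => lt.
by exists (Ordinal lt); rewrite /= iter_findex.
Qed.

Lemma iter_next_eq k l x : x \in arcs P ->
  iter k nx x = iter l nx x <-> k = l %[mod N].
Proof.
move=> xE; split=> [kl|kl]; last by rewrite -(iter_next_mod k xE) kl iter_next_mod.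
have fi j : findex nx x (iter (j %% N) nx x) = (j %% N)%N.
  by apply: findex_iter; rewrite (order_next xE) ltn_mod.
by rewrite -(fi k) -(fi l) !iter_next_mod // kl.
Qed.

Lemma tour_word_shift (k : 'I_N) x : x \in arcs P ->
  tour_word P (iter k nx x) = shift (tour_word P x) k.
Proof.
move=> xE; apply/setP => i; rewrite !inE -iterD addnC -(iter_next_mod _ xE).
by [].
Qed.

Lemma tour_wordsE x : x \in arcs P ->
  tour_words P = [set shift (tour_word P x) k | k : 'I_N].
Proof.
move=> xE; apply/setP => A; apply/imsetP/imsetP => [[y yE ->]|[k _ ->]].
  by have [k <-] := arc_iter xE yE; exists k => //; exact: tour_word_shift.
exists (iter k nx x); first by rewrite iter_next_in.
by rewrite tour_word_shift.
Qed.

Lemma exists_arc : exists x, x \in arcs P.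
Proof.
by apply/set0Pn; rewrite -card_gt0 (card_arcs (Defs.root P) (tree_tE tP)) cV.
Qed.

Lemma vertex_arc v : exists w, (v, w) \in arcs P.
Proof.
have [[a b] ab] := exists_arc; have tE := tree_tE tP.
have [<-|va] := eqVneq a v; first by exists b.
rewrite eq_sym in va; have [_ cE _] := tE.
by have [w vw _] := connect_first (cE v a) va; exists w.
Qed.

Lemma card_tour_word x : x \in arcs P -> #|tour_word P x| = m.+1.
Proof.
move=> xE; rewrite -[RHS]/(m.+2.-1) -cV -(card_down (Defs.root P) (tree_tE tP)).
pose f (i : 'I_N) := iter i nx x.
have finj : injective f.
  move=> i j /(iter_next_eq _ _ xE); rewrite !modn_small // => /val_inj //.
rewrite -(card_imset _ finj); apply: eq_card => y.
apply/imsetP/idP => [[i] + ->|]; rewrite !inE.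
  by move=> di; rewrite iter_next_in // xE.
by move=> /andP[yE dy]; have [k ky] := arc_iter xE yE; exists k; rewrite ?inE /f ky.
Qed.

End OneTree.

Section TwoTrees.
Variables (V : finType) (P Q : rooted_map V) (x y : V * V).
Hypotheses (tP : rooted_plane_tree P) (tQ : rooted_plane_tree Q) (cV : #|V| = m.+2).
Hypotheses (xP : x \in arcs P) (yQ : y \in arcs Q).
Hypothesis xy : tour_word P x = tour_word Q y.

Let p k := iter k (next_arc P) x.
Let q k := iter k (next_arc Q) y.
Let pE k : p k \in arcs P. Proof. by rewrite iter_next_in. Qed.
Let qE k : q k \in arcs Q. Proof. by rewrite iter_next_in. Qed.

Lemma tour_down k : down P (p k) = down Q (q k).
Proof.
rewrite /p /q -(iter_next_mod tP cV _ xP) -(iter_next_mod tQ cV _ yQ).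
have kN : (k %% N < N)%N by rewrite ltn_mod.
by have := congr1 (fun A : {set 'I_N} => Ordinal kN \in A) xy; rewrite !inE.
Qed.

Lemma tour_rise i k : rise P i (p k) = rise Q i (q k).
Proof.
apply: eq_bigr => j _; rewrite /p /q -!iterD -/(p _) -/(q _).
by rewrite tour_down.
Qed.

Lemma tour_eq k l : p k = p l -> q k = q l.
Proof. by move/(iter_next_eq tP cV _ _ xP)/(iter_next_eq tQ cV _ _ yQ). Qed.

Lemma tour_opp_down k l : down P (p k) -> p l = opp_arc (p k) -> q l = opp_arc (q k).
Proof.
move=> dp pl; have dq : down Q (q k) by rewrite -tour_down.
have [i [pi pi0 pipos]] := rise_return tP (pE k) dp.
have [j [qj qj0 qjpos]] := rise_return tQ (qE k) dq.
have ij : i = j.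
  case: (ltngtP i j) => // lt.
    by have := qjpos i.+1 lt; rewrite -tour_rise pi0 ltxx.
  by have := pipos j.+1 lt; rewrite tour_rise qj0 ltxx.
rewrite -qj -ij /q -iterD -/(q _); apply: tour_eq.
by rewrite pl -pi /p -iterD.
Qed.

Lemma tour_opp_arc k l : p l = opp_arc (p k) -> q l = opp_arc (q k).
Proof.
have [dp|dp] := boolP (down P (p k)); first exact: tour_opp_down.
move=> pl; have dl : down P (p l) by rewrite pl down_opp.
by rewrite (@tour_opp_down l k dl) ?opp_arcK // pl opp_arcK.
Qed.

(** The rotation at a vertex is the opposite followed by the next arc, so that
    arcs with the same source correspond to arcs with the same source. *)
Lemma tour_source k l : (p k).1 = (p l).1 -> (q k).1 = (q l).1.
Proof.
move=> kl; case: (tP) => _ /(_ (p k).1)[_ /(_ (p k).2)].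
have kE := pE k; rewrite inE -arcE => /(_ kE) po.
have : (p l).2 \in porbit (Defs.rot P (p k).1) (p k).2.
  by rewrite po inE kl -arcE.
case/porbitP => j lj.
have {lj} : p l = ((p k).1, (Defs.rot P (p k).1 ^+ j)%g (p k).2).
  by rewrite -lj kl -surjective_pairing.
elim: j l {kl} => [|j IH] l pl.
  by congr fst; apply: tour_eq; rewrite pl expg0 perm1 -surjective_pairing.
pose z := ((p k).1, (Defs.rot P (p k).1 ^+ j)%g (p k).2).
have zE : z \in arcs P.
  have : z.2 \in porbit (Defs.rot P (p k).1) (p k).2 by exact: mem_porbit.
  by rewrite po inE.
have [i iz] := arc_iter tP cV xP zE.
rewrite (IH i iz).
have zE' : opp_arc z \in arcs P by rewrite opp_arc_in.
have [t tz] := arc_iter tP cV xP zE'.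
have ql : q l = next_arc Q (q t).
  apply: (@tour_eq l t.+1); rewrite pl /p iterS tz /next_arc /opp_arc /z /=.
  by rewrite expgSr permM.
rewrite ql (@tour_opp_arc i t) //; by rewrite /p tz iz.
Qed.

End TwoTrees.

(** The arcs at the same position of both tours correspond.  By the lemmas above
    this respects sources and opposites, hence defines an isomorphism. *)
Lemma tour_word_iso (V : finType) (P Q : rooted_map V) x y :
  rooted_plane_tree P -> rooted_plane_tree Q -> #|V| = m.+2 ->
  x \in arcs P -> y \in arcs Q -> tour_word P x = tour_word Q y ->
  exists s, plane_isomorphism P Q s.
Proof.
move=> tP tQ cV xP yQ xy.
pose p k := iter k (next_arc P) x; pose q k := iter k (next_arc Q) y.
have pE k : p k \in arcs P by rewrite iter_next_in.
have qE k : q k \in arcs Q by rewrite iter_next_in.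
have pq1 k l : (p k).1 = (p l).1 -> (q k).1 = (q l).1.
  exact: (tour_source tP tQ cV xP yQ xy).
have qp1 k l : (q k).1 = (q l).1 -> (p k).1 = (p l).1.
  exact: (tour_source tQ tP cV yQ xP (esym xy)).
have opq k l : p l = opp_arc (p k) -> q l = opp_arc (q k).
  exact: (tour_opp_arc tP tQ cV xP yQ xy).
have pk v : exists k : 'I_N, (p k).1 == v.
  have [w vw] := vertex_arc tP cV v; have [k kE] := arc_iter tP cV xP vw.
  by exists k; rewrite /p kE.
pose s0 v := (q (xchoose (pk v))).1.
have s0p k : s0 (p k).1 = (q k).1.
  by apply: pq1; exact/eqP/(xchooseP (pk (p k).1)).
have s0_inj : injective s0.
  move=> v v'; have [k /eqP <-] := pk v; have [k' /eqP <-] := pk v'.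
  by rewrite !s0p; exact: qp1.
have pl k : exists l : nat, p l = opp_arc (p k).
  have oE : opp_arc (p k) \in arcs P by rewrite opp_arc_in.
  by have [l lE] := arc_iter tP cV xP oE; exists l.
have s0p2 k : s0 (p k).2 = (q k).2.
  have [l lk] := pl k; have := s0p l; rewrite lk (opq _ _ lk) //.
exists (perm s0_inj); split.
- rewrite permE; have [k /eqP kr] := pk (Defs.root P); rewrite -kr s0p.
  apply/eqP/negPn/negP => qr; have [w qw] := up_exists (tree_tE tQ) qr.
  have qwE : ((q k).1, w) \in arcs Q := up_adj qw.
  have [l lE] := arc_iter tQ cV yQ qwE.
  have plr : (p l).1 = Defs.root P by rewrite -kr; apply: qp1; rewrite /q lE.
  have : down P (p l) by rewrite /down plr (up_root _ (tree_tE tP)).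
  by rewrite (tour_down tP tQ cV xP yQ xy) lE /down /= qw.
- move=> v w; rewrite !permE; apply/idP/idP => [sE|vw].
    have [k kE] := arc_iter tQ cV yQ (sE : (s0 v, s0 w) \in arcs Q).
    have -> : v = (p k).1 by apply: s0_inj; rewrite s0p /q kE.
    have -> : w = (p k).2 by apply: s0_inj; rewrite s0p2 /q kE.
    by rewrite -arcE.
  have [k kE] := arc_iter tP cV xP (vw : (v, w) \in arcs P).
  have -> : v = (p k).1 by rewrite /p kE.
  have -> : w = (p k).2 by rewrite /p kE.
  by rewrite s0p s0p2 -arcE.
move=> v w vw; rewrite !permE.
have [k kE] := arc_iter tP cV xP (vw : (v, w) \in arcs P).
have -> : v = (p k).1 by rewrite /p kE.
have -> : w = (p k).2 by rewrite /p kE.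
have [l lk] := pl k.
have -> : Defs.rot P (p k).1 (p k).2 = (p l.+1).2.
  by rewrite /p iterS -/(p l) lk.
rewrite s0p2 s0p s0p2 /q iterS -/(q l).
by rewrite (opq _ _ lk).
Qed.

Lemma iso_tour_word (V : finType) (P Q : rooted_map V) s x :
  rooted_plane_tree P -> rooted_plane_tree Q -> plane_isomorphism P Q s ->
  x \in arcs P -> tour_word Q (s x.1, s x.2) = tour_word P x.
Proof.
move=> tP tQ [sr sE sR] xE.
have it k : iter k (next_arc Q) (s x.1, s x.2) =
    (s (iter k (next_arc P) x).1, s (iter k (next_arc P) x).2).
  elim: k => //= k IH; rewrite {}IH.
  have := iter_next_in tP k x; rewrite xE arcE; case: (iter k _ x) => a b /= ab.
  rewrite /next_arc /= sR //; by case: tP => -[[es _] _ _] _; rewrite es.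
apply/setP => i; rewrite !inE it /down.
rewrite (up_homo (tree_tE tP) (tree_tE tQ) (@perm_inj _ s) sr) //.
  by move=> v w; rewrite sE.
by rewrite -arcE iter_next_in.
Qed.

Lemma plane_isomorphic_words (V : finType) (P Q : rooted_map V) :
  rooted_plane_tree P -> rooted_plane_tree Q -> #|V| = m.+2 ->
  plane_isomorphic P Q = (tour_words P == tour_words Q).
Proof.
move=> tP tQ cV; have [x xP] := exists_arc tP cV.
apply/asboolP/eqP => [[s sPQ]|PQ].
  have sx : (s x.1, s x.2) \in arcs Q.
    by case: (sPQ) => _ sE _; rewrite arcE /= sE -arcE.
  by rewrite (tour_wordsE tP cV xP) (tour_wordsE tQ cV sx) (iso_tour_word tP tQ sPQ xP).
have : tour_word P x \in tour_words Q by rewrite -PQ imset_f.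
by case/imsetP => y yQ xy; exact: (tour_word_iso tP tQ cV xP yQ xy).
Qed.

End TourWords.

(** * Inserting a leaf *)

Lemma porbit_next (T : finType) (s : {perm T}) z z0 :
  z \in porbit s z0 -> s z \in porbit s z0.
Proof. by case/porbitP => k ->; rewrite -permM -expgSr mem_porbit. Qed.

Lemma porbit_full (T : finType) (s : {perm T}) (A : {set T}) z0 :
  perm_on A s -> z0 \in A -> {in A, forall z, z \in porbit s z0} ->
  {in A, forall w, porbit s w = A}.
Proof.
move=> on z0A full w wA; have -> : porbit s w = porbit s z0.
  by apply/eqP; rewrite eq_porbit_mem full.
apply/setP => z; apply/idP/idP => [|/full//]; case/porbitP => k ->.
elim: k => [|k IH]; first by rewrite expg0 perm1.
by rewrite expgSr permM perm_closed.
Qed.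

Section InsertLeaf.
Variables (n : nat) (P : rooted_map 'I_n.+1) (x : 'I_n.+1 * 'I_n.+1).
Hypotheses (tP : rooted_plane_tree P) (xP : x \in arcs P).

Let g : 'I_n.+1 -> 'I_n.+2 := lift ord_max.
Let lf : 'I_n.+2 := ord_max.
Let c := x.1.
Let g_inj : injective g. Proof. exact: lift_inj. Qed.
Let gl a : (g a == lf) = false. Proof. by apply/negbTE; rewrite eq_sym neq_lift. Qed.
Let lg a : (lf == g a) = false. Proof. by apply/negbTE; rewrite neq_lift. Qed.

Let ug a : unlift ord_max (g a) = Some a. Proof. exact: liftK. Qed.
Let ul : unlift ord_max lf = None. Proof. exact: unlift_none. Qed.

Lemma liftVP (v : 'I_n.+2) : v = lf \/ exists a, v = g a.
Proof. by case: (unliftP ord_max v) => [a ->|->]; [right; exists a|left]. Qed.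

(** A new leaf at the source of [x], just before [x] in the rotation. *)
Definition insert_leaf : rooted_map 'I_n.+2 :=
  ([set z | match unlift ord_max z.1, unlift ord_max z.2 with
            | Some a, Some b => (a, b) \in arcs P
            | Some a, None => a == c
            | None, Some b => b == c
            | None, None => false
            end],
   [ffun v => if unlift ord_max v is Some a then
      (lift_perm ord_max ord_max (Defs.rot P a) *
       (if a == c then tperm lf (g x.2) else 1))%g else 1%g],
   g (Defs.root P)).

Notation P' := insert_leaf.

Lemma adj_gg a b : adj (arcs P') (g a) (g b) = adj (arcs P) a b.
Proof. by rewrite /adj inE /= !ug. Qed.
Lemma adj_gl a : adj (arcs P') (g a) lf = (a == c).
Proof. by rewrite /adj inE /= ug ul. Qed.
Lemma adj_lg a : adj (arcs P') lf (g a) = (a == c).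
Proof. by rewrite /adj inE /= ug ul. Qed.
Lemma adj_ll : adj (arcs P') lf lf = false.
Proof. by rewrite /adj inE /= ul. Qed.

Lemma rot_lf v : Defs.rot P' lf v = v.
Proof. by rewrite /Defs.rot /= ffunE ul perm1. Qed.

Lemma rot_gg a b : Defs.rot P' (g a) (g b) =
  if (a == c) && (Defs.rot P a b == x.2) then lf else g (Defs.rot P a b).
Proof.
rewrite /(Defs.rot P') /= ffunE ug permM lift_perm_lift -/(g _).
case: (a == c) => /=; last by rewrite perm1.
case: eqP => [->|ne]; first by rewrite tpermR.
by rewrite tpermD // ?lg // (inj_eq g_inj); apply/eqP => /esym.
Qed.

Lemma rot_gl a : Defs.rot P' (g a) lf = if a == c then g x.2 else lf.
Proof.
rewrite /(Defs.rot P') /= ffunE ug permM lift_perm_id.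
by case: (a == c) => /=; rewrite ?perm1 // tpermL.
Qed.

Let tE := tree_tE tP.

Lemma insert_leaf_tree : tree_graph (arcs P').
Proof.
have [[es ei] ec ea] := tE.
have es' : symmetric (adj (arcs P')).
  move=> v w; have [->|[a ->]] := liftVP v; have [->|[b ->]] := liftVP w => //.
  - by rewrite adj_lg adj_gl.
  - by rewrite adj_lg adj_gl.
  - by rewrite !adj_gg es.
have cc v : connect (adj (arcs P')) v (g c).
  have [->|[a ->]] := liftVP v; first by apply: connect1; rewrite adj_lg.
  by apply: connect_homo (ec a c) => a' b'; rewrite adj_gg.
split.
- split=> // v; have [->|[a ->]] := liftVP v; first exact: adj_ll.
  by rewrite adj_gg ei.
- move=> v w; apply: connect_trans (cc v) _.
  by rewrite (sym_connect_sym es') cc.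
move=> s /andP[cs us]; have [ls|ls] := boolP (lf \in s).
  have [i p sp] := rot_to ls.
  have : (size (seq.rot i s) <= 2)%N -> (size s <= 2)%N by rewrite size_rot.
  apply; move: cs us; rewrite -(rot_cycle i) -(rot_uniq i) {}sp.
  case: p => [|z [|z' p]] //.
  rewrite /path.cycle rcons_path => /andP[/andP[lz _] ll] /and3P[_ zp _]; exfalso.
  have zc : z = g c.
    by have [zE|[a aE]] := liftVP z; move: lz; rewrite ?zE ?adj_ll // aE adj_lg => /eqP ->.
  have lc : last z' p = g c.
    have [zE|[a aE]] := liftVP (last z' p); move: ll; rewrite /= ?zE ?adj_ll //.
    by rewrite aE adj_gl => /eqP ->.
  by move: zp; rewrite zc -lc mem_last.
have sE : s = map g (pmap (unlift ord_max) s).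
  elim: s ls {cs us} => //= v s IH; rewrite inE negb_or => /andP[lv ls].
  have [ve|[a ->]] := liftVP v; first by rewrite ve eqxx in lv.
  by rewrite ug /= -IH.
move: cs us; rewrite sE cycle_map size_map => cs us.
apply: ea; rewrite /ucycle -(map_inj_uniq g_inj) us andbT.
by apply: sub_cycle cs => a b /=; rewrite adj_gg.
Qed.

Lemma insert_leaf_rotation : rotation_system P'.
Proof.
case: tP => _ rP v; have [->|[a ->]] := liftVP v.
  split=> [|w]; first by apply/subsetP => z; rewrite inE rot_lf eqxx.
  have [->|[b ->]] := liftVP w; rewrite inE ?adj_ll // adj_lg => /eqP ->.
  apply/setP => z; rewrite inE; apply/porbitP/idP => [[k ->]|].
    suff -> : (Defs.rot P' lf ^+ k)%g (g c) = g c by rewrite adj_lg.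
    by elim: k => [|k IH]; rewrite ?expg0 ?perm1 // expgSr permM IH rot_lf.
  have [->|[b' ->]] := liftVP z; rewrite ?adj_ll // adj_lg => /eqP ->.
  by exists 0%N; rewrite expg0 perm1.
have [on orb] := rP a.
have on' : perm_on (neighbours (arcs P') (g a)) (Defs.rot P' (g a)).
  apply/subsetP => z; rewrite !inE; have [->|[b ->]] := liftVP z.
    by rewrite rot_gl adj_gl; case: (a == c); rewrite ?eqxx.
  rewrite rot_gg adj_gg; case: ifP => [/andP[/eqP ac /eqP bx] _|_].
    by rewrite -(rot_adj tP) bx ac /c -arcE.
  rewrite (inj_eq g_inj) => ab; have := subsetP on b; rewrite !inE; exact.
split=> // w wN.
have [ac|ac] := eqVneq a c.
  apply: (porbit_full (z0 := lf) on') => //; first by rewrite inE adj_gl ac.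
  have step t : g t \in porbit (Defs.rot P' (g a)) lf ->
      g (Defs.rot P a t) \in porbit (Defs.rot P' (g a)) lf.
    have [-> _|ne tp] := eqVneq (Defs.rot P a t) x.2.
      have -> : g x.2 = Defs.rot P' (g a) lf by rewrite rot_gl ac eqxx.
      exact: porbit_next (porbit_id _ _).
    by have := porbit_next tp; rewrite rot_gg (negPf ne) andbF.
  move=> z; rewrite inE; have [->|[b ->]] := liftVP z; first by rewrite porbit_id.
  rewrite adj_gg => ab; have cx : x.2 \in neighbours (arcs P) a by rewrite inE ac -arcE.
  have : b \in porbit (Defs.rot P a) x.2 by rewrite (orb _ cx) inE.
  case/porbitP => k ->; elim: k => [|k IH].
    rewrite expg0 perm1; have -> : g x.2 = Defs.rot P' (g a) lf by rewrite rot_gl ac eqxx.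
    exact: porbit_next (porbit_id _ _).
  by rewrite expgSr permM step.
have [we|[b we]] := liftVP w; first by move: wN; rewrite we inE adj_gl (negPf ac).
have ab : b \in neighbours (arcs P) a by move: wN; rewrite we !inE adj_gg.
apply: (porbit_full (z0 := w) on') => // z; rewrite inE.
have [->|[b' ->]] := liftVP z; first by rewrite adj_gl (negPf ac).
rewrite adj_gg => ab'; have : b' \in porbit (Defs.rot P a) b by rewrite (orb _ ab) inE.
case/porbitP => k ->; elim: k => [|k IH]; first by rewrite expg0 perm1 we porbit_id.
by have := porbit_next IH; rewrite rot_gg (negPf ac) /= expgSr permM.
Qed.

Lemma insert_leaf_plane_tree : rooted_plane_tree P'.
Proof. by split; [exact: insert_leaf_tree|exact: insert_leaf_rotation]. Qed.

Lemma new_arc : (g c, lf) \in arcs P'.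
Proof. by rewrite arcE /= adj_gl. Qed.

Lemma next_gg z : next_arc P z != x ->
  next_arc P' (g z.1, g z.2) = (g (next_arc P z).1, g (next_arc P z).2).
Proof.
case: z => a b; rewrite /next_arc /= rot_gg => ne; case: ifP => // /andP[/eqP bc /eqP rx].
by case/eqP: ne; rewrite rx bc [x in RHS]surjective_pairing.
Qed.

(** The new tour makes the detour to the leaf and back, then follows the old
    one. *)
Lemma iter_next_insert j : (j < order (next_arc P) x)%N ->
  iter j.+2 (next_arc P') (g c, lf) =
  (g (iter j (next_arc P) x).1, g (iter j (next_arc P) x).2).
Proof.
elim: j => [|j IH] jo.
  by rewrite /= /next_arc /= rot_lf rot_gl eqxx.
rewrite iterS IH ?(ltnW jo) // next_gg -?iterS //.
apply/eqP => e; have := @findex_iter _ (next_arc P) x j.+1 jo.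
by rewrite e findex0.
Qed.

Lemma down_new : down P' (g c, lf).
Proof.
have u : up (arcs P') (g (Defs.root P)) lf (g c).
  rewrite /up adj_lg eqxx /=; have [_ ec _] := tE.
  apply: connect_homo (ec c (Defs.root P)) => a b ab.
  by rewrite /off /= adj_gg ab !gl.
by rewrite /down /= (up_asym insert_leaf_tree u).
Qed.

Lemma down_gg z : z \in arcs P -> down P' (g z.1, g z.2) = down P z.
Proof.
rewrite arcE => zE; rewrite /down /=.
rewrite (up_homo tE insert_leaf_tree g_inj (erefl _)) // => v w.
by rewrite adj_gg.
Qed.

End InsertLeaf.

(** * Every balanced cyclic word is a tour *)

Lemma tour_words_shift m (V : finType) (P : rooted_map V) A (k : 'I_(m.*2.+2)) :
  rooted_plane_tree P -> #|V| = m.+2 ->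
  (shift A k \in tour_words m P) = (A \in tour_words m P).
Proof.
move=> tP cV.
have sh B (l : 'I_(m.*2.+2)) : B \in tour_words m P -> shift B l \in tour_words m P.
  case/imsetP => x xP ->; rewrite -(tour_word_shift tP cV) // imset_f //.
  by rewrite iter_next_in.
apply/idP/idP; last exact: sh.
move/(sh _ (- k)); suff -> : shift (shift A k) (- k) = A by [].
by apply/setP => i; rewrite !inE addrA subrr add0r.
Qed.

Lemma card_shift m (A : {set 'I_(m.*2.+2)}) k : #|shift A k| = #|A|.
Proof.
have -> : shift A k = [set - k + i | i in A].
  apply/setP => i; rewrite inE; apply/idP/imsetP => [h|[j jA ->]].
    by exists (k + i); rewrite // addrA addNr add0r.
  by rewrite addrA addrN add0r.
by rewrite card_imset //; exact: addrI.
Qed.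

Lemma tour_word_base (A : {set 'I_(0.*2.+2)}) : #|A| = 1%N ->
  exists P : rooted_map 'I_2, rooted_plane_tree P /\ A \in tour_words 0 P.
Proof.
move=> /eqP/cards1P[a ->{A}].
pose P : rooted_map 'I_2 := ([set z | z.1 != z.2], [ffun _ => 1%g], ord0).
have adjP v w : adj (arcs P) v w = (v != w) by rewrite /adj inE.
have eq1 (v w w' : 'I_2) : v != w -> v != w' -> w = w'.
  move: v w w' => [[|[|//]] ?] [[|[|//]] ?] [[|[|//]] ?] //= _ _; exact: val_inj.
have tP : rooted_plane_tree P.
  split; last first.
    move=> v; split=> [|w]; first by rewrite /Defs.rot ffunE perm_on1.
    rewrite inE adjP => vw; apply/setP => z; rewrite inE adjP.
    apply/porbitP/idP => [[k ->]|vz]; first by rewrite /Defs.rot ffunE expg1n perm1.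
    by exists 0%N; rewrite expg0 perm1 (eq1 _ _ _ vw vz).
  split.
  - by split=> [v w|v]; rewrite !adjP ?eqxx // eq_sym.
  - move=> v w; have [->|vw] := eqVneq v w; first exact: connect0.
    by apply: connect1; rewrite adjP.
  - move=> s /andP[_ us]; apply: (@leq_trans (size (enum 'I_2))); last by rewrite size_enum_ord.
    by apply: uniq_leq_size us _ => i _; rewrite mem_enum.
have cV : #|'I_2| = 2 by rewrite card_ord.
have [x xP] := exists_arc (m := 0) tP cV.
exists P; split=> //.
have := card_tour_word tP cV xP => /eqP/cards1P[b wb].
rewrite -(@tour_words_shift 0 _ _ _ (a - b) tP cV).
have -> : shift (m := 0) [set a] (a - b) = [set b].
  by apply/setP => i; rewrite !inE -[X in _ == X](subrK b) (inj_eq (addrI _)).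
by rewrite -wb imset_f.
Qed.

(** Somewhere in a balanced cyclic word an arc away from the root is followed by
    one towards it: the two arcs of a leaf, to be removed. *)
Lemma tour_word_onto m (A : {set 'I_(m.*2.+2)}) : #|A| = m.+1 ->
  exists P : rooted_map 'I_m.+2, rooted_plane_tree P /\ A \in tour_words m P.
Proof.
elim: m A => [|m IH] A; first exact: tour_word_base.
move=> cA; pose N := m.+1.*2.+2; have NE : N = m.*2.+4 by rewrite /N doubleS.
have [k kA k1A] : exists2 k : 'I_N, k \in A & inZp k.+1 \notin A.
  have [/existsP[k /andP[]]|/existsPn no] := boolP [exists k : 'I_N, (k \in A) && (inZp k.+1 \notin A)].
    by exists k.
  have /card_gt0P[a aA] : (0 < #|A|)%N by rewrite cA.
  have all j : inZp (a + j) \in A.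
    elim: j => [|j IHj]; first by rewrite addn0 valZpK.
    have := no (inZp (a + j)); rewrite IHj negbK /=.
    suff -> : inZp ((a + j) %% N).+1 = inZp (a + j.+1) :> 'I_N by [].
    by apply: val_inj; rewrite /= addnS -(addn1 (_ %% _)) -(addn1 (a + j)) modnDml.
  have : #|A| = N.
    rewrite -[RHS](card_ord N) -cardsT; congr #|pred_of_set _|; apply/setP => i.
    rewrite inE; have := all (N - a + i)%N; rewrite addnA subnKC; last exact: ltnW.
    by suff -> : inZp (N + i) = i by []; apply: val_inj; rewrite /= modnDl modn_small.
  by rewrite cA; lia.
pose A' := shift (m := m.+1) A k.
have A'0 : ord0 \in A' by rewrite inE addr0.
have A'1 : inZp 1 \notin A'.
  rewrite inE; suff -> : k + inZp 1 = inZp k.+1 by [].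
  by apply: val_inj; rewrite /= -(addn1 k) modnDmr.
have cA' : #|A'| = m.+2 by rewrite /A' card_shift.
pose f (i : 'I_(m.*2.+2)) : 'I_N := inZp i.+2.
have fE (i : 'I_(m.*2.+2)) : f i = i.+2 :> nat by have h := ltn_ord i; rewrite /= modn_small //; move: (val i) h => j h; lia.
have f_inj : injective f.
  by move=> i j fij; have := congr1 (@nat_of_ord _) fij; rewrite !fE => -[] /val_inj.
pose B : {set 'I_(m.*2.+2)} := [set i | f i \in A'].
have cB : #|B| = m.+1.
  have : A' = ord0 |: f @: B.
    apply/setP => i; rewrite in_setU1; apply/idP/orP => [iA|[/eqP->//|/imsetP[j + ->]]]; last by rewrite in_set.
    have [->|i0] := eqVneq i ord0; first by left.
    right; have i1 : (i : nat) != 1%N.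
      apply: contraNneq A'1 => i1; suff <- : i = inZp 1 by [].
      by apply: val_inj; rewrite /= i1.
    have i0' : (i : nat) != 0%N by apply: contraNneq i0 => i0; exact/eqP/val_inj.
    have jlt : (i.-2 < m.*2.+2)%N by have := ltn_ord i; move: (nat_of_ord i) i0' i1; lia.
    have fi : f (Ordinal jlt) = i.
      by apply: ord_inj; rewrite fE /=; move: i0' i1; case: (nat_of_ord i) => [|[|?]].
    by apply/imsetP; exists (Ordinal jlt); [rewrite in_set fi|rewrite fi].
  move/(congr1 (fun X : {set _} => #|X|)); rewrite cA' cardsU1 card_imset //.
  suff -> : ord0 \notin f @: B by move=> -[].
  by apply/negP => /imsetP[j _ /(congr1 (@nat_of_ord _))]; rewrite fE.
have [P [tP /imsetP[x xP Bx]]] := IH B cB.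
exists (insert_leaf P x); have tP' := insert_leaf_plane_tree tP xP.
split=> //; rewrite -(tour_words_shift _ k tP') ?card_ord //.
suff -> : shift A k = tour_word m.+1 (insert_leaf P x) (lift ord_max x.1, ord_max).
  by rewrite imset_f // new_arc.
rewrite -/A'; apply/setP => i; rewrite [in RHS]inE.
have ox : order (next_arc P) x = m.*2.+2 by apply: order_next => //; rewrite card_ord.
case: i => [[|[|j]] jN].
- by rewrite /= down_new //; rewrite (_ : Ordinal _ = ord0) //; exact: val_inj.
- have -> : Ordinal jN = inZp 1 by exact: val_inj.
  rewrite (negPf A'1); apply/esym/negbTE.
  have := down_opp tP' (new_arc P x); rewrite down_new // => dn.
  by rewrite /= /next_arc /= rot_lf -[X in down _ X]/(opp_arc (lift ord_max x.1, ord_max)) dn.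
have jlt : (j < m.*2.+2)%N by have := jN; lia.
rewrite [val _]/= iter_next_insert ?ox // down_gg ?iter_next_in //.
have := congr1 (fun X : {set 'I_(m.*2.+2)} => Ordinal jlt \in X) Bx.
rewrite !inE /= => <-; suff -> : f (Ordinal jlt) = Ordinal jN by [].
by apply: ord_inj; rewrite fE.
Qed.

Lemma card_equivalence_partition (T T' : finType) (R : rel T) (D : {set T}) (f : T -> T') :
  {in D &, forall x y, R x y = (f x == f y)} ->
  #|equivalence_partition R D| = #|f @: D|.
Proof.
move=> Rf; pose h t : {set T} := [set y in D | t == f y].
have -> : equivalence_partition R D = h @: (f @: D).
  rewrite -imset_comp; apply: eq_in_imset => x xD; apply/setP => y.
  by rewrite !inE; case: (boolP (y \in D)) => //= yD; exact: Rf.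
apply: card_in_imset => _ _ /imsetP[x xD ->] /imsetP[y yD ->].
by move=> /setP/(_ x); rewrite !inE xD eqxx /= => /esym/eqP.
Qed.

(** * Burnside counting of plane trees *)

Section Rotations.
Variable m : nat.
Notation N := (m.*2.+2).

Lemma shift_is_action : is_action [set: 'I_N] (@shift m).
Proof.
apply: is_total_action => [A|A a b]; apply/setP => i; rewrite !inE.
  by rewrite [X in X + _]/(0 : 'I_N) add0r.
by rewrite addrA.
Qed.

Definition rotation_action := Action shift_is_action.

Definition half_sets : {set {set 'I_N}} := [set A : {set 'I_N} | #|A| == m.+1].

Lemma num_plane_trees_orbits :
  num_plane_trees m.+1 = #|action.orbit rotation_action [set: 'I_N] @: half_sets|.
Proof.
have cV : #|'I_m.+2| = m.+2 by rewrite card_ord.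
rewrite /num_plane_trees.
rewrite (card_equivalence_partition (f := tour_words m (V := 'I_m.+2))); last first.
  move=> P Q; rewrite !inE => /asboolP tP /asboolP tQ.
  exact: plane_isomorphic_words.
have orbE (A : {set 'I_N}) :
    action.orbit rotation_action [set: 'I_N] A = [set shift A k | k : 'I_N].
  by apply/setP => B; apply/orbitP/imsetP => [[k _ <-]|[k _ ->]]; exists k.
congr #|pred_of_set _|; apply/setP => O; apply/imsetP/imsetP => [[P]|[A]].
  rewrite inE => /asboolP tP ->; have [x xP] := exists_arc tP cV.
  exists (tour_word m P x); first by rewrite inE (card_tour_word tP cV xP).
  by rewrite orbE (tour_wordsE tP cV xP).
rewrite inE => /eqP cA ->; have [P [tP /imsetP[x xP Ax]]] := tour_word_onto cA.
exists P; first by rewrite inE; exact/asboolP.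
by rewrite orbE (tour_wordsE tP cV xP) Ax.
Qed.

Lemma burnside :
  (\sum_(k : 'I_N) #|[set A in half_sets | shift A k == A]| = num_plane_trees m.+1 * N)%N.
Proof.
rewrite num_plane_trees_orbits -[X in (_ * X)%N]card_ord -cardsT.
rewrite -(@Frobenius_Cauchy _ _ _ rotation_action [set: 'I_N]%G half_sets).
  apply: eq_big => [k|k _]; first by rewrite inE.
  by apply: eq_card => A; rewrite !inE sub1set inE.
apply/actsP => k _ A; by rewrite !inE /= card_shift.
Qed.

(** By Bezout's identity the multiples of [k] modulo [N] are those of the
    greatest common divisor. *)
Lemma shift_fixedP g (k : 'I_N) (A : {set 'I_N}) : gcdn k N = g.+1 ->
  reflect (exists C : {set 'I_g.+1}, A = [set i : 'I_N | inZp i \in C]) (shift A k == A).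
Proof.
move=> gE; have gN : (g.+1 %| N)%N by rewrite -gE dvdn_gcdr.
have gk : (g.+1 %| k)%N by rewrite -gE dvdn_gcdl.
apply: (iffP eqP) => [Ak|[C ->]]; last first.
  apply/setP => i; rewrite !inE; congr (_ \in C); apply: ord_inj => /=.
  by rewrite modn_dvdm // -modnDml (eqP gk) add0n.
have step (t : nat) (i : 'I_N) : (inZp (i + t * k) \in A) = (i \in A).
  elim: t => [|t IH]; first by rewrite addn0 valZpK.
  rewrite -IH -[in RHS]Ak inE; congr (_ \in A); apply: ord_inj => /=.
  by rewrite modnDmr mulSn addnCA.
have per (i j : 'I_N) : (i <= j)%N -> i = j %[mod g.+1] -> (i \in A) = (j \in A).
  move=> ij /eqP; rewrite eq_sym eqn_mod_dvd // => /dvdnP[q qE].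
  have [u _ /dvdnP[z zE]] := @Bezoutr k N isT.
  rewrite -(step (q * u)%N j); congr (_ \in A); apply: ord_inj => /=.
  have -> : (j + q * u * k = i + q * z * N)%N.
    rewrite -(subnKC ij) qE -!mulnA -[(z * N)%N]zE gE -addnA; congr (_ + _)%N.
    by rewrite mulnDr.
  by rewrite addnC modnMDl modn_small.
exists [set c | [exists i in A, inZp i == c]]; apply/setP => i; rewrite !inE.
apply/idP/existsP => [iA|[j /andP[jA /eqP /(congr1 (@nat_of_ord _)) /= ij]]].
  by exists i; rewrite iA eqxx.
by case: (leqP i j) => [h|/ltnW h]; [rewrite (per _ _ h)|rewrite -(per _ _ h)].
Qed.

Lemma sum_mod q g (F : nat -> nat) :
  (\sum_(i < q * g) F (i %% g) = q * \sum_(i < g) F i)%N.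
Proof.
elim: q => [|q IH]; first by rewrite mul0n big_ord0.
rewrite mulSn -(big_mkord xpredT (fun i => F (i %% g)%N)).
rewrite (@big_cat_nat _ _ _ g) ?leq_addr //= mulSn; congr addn.
  by rewrite big_mkord; apply: eq_bigr => i _; rewrite modn_small.
rewrite -{1}[g]add0n big_addn addKn big_mkord -IH.
by apply: eq_bigr => i _; rewrite modnDr.
Qed.

(** The sets of residues modulo [g] that give sets with half of the elements have
    half of the residues. *)
Lemma card_fixed (k : 'I_N) :
  #|[set A in half_sets | shift A k == A]| =
  if odd (gcdn k N) then 0%N else 'C(gcdn k N, (gcdn k N)./2).
Proof.
have [g gE] : exists g, gcdn k N = g.+1.
  by exists (gcdn k N).-1; rewrite prednK // gcdn_gt0 orbT.
rewrite gE; have /dvdnP[q qE] : (g.+1 %| N)%N by rewrite -gE dvdn_gcdr.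
pose f (C : {set 'I_g.+1}) := [set i : 'I_N | inZp i \in C].
have cf C : #|f C| = (q * #|C|)%N.
  pose F i : nat := (inZp i : 'I_g.+1) \in C.
  have -> : #|f C| = (\sum_(i < N) F (i %% g.+1))%N.
    rewrite -sum1_card big_mkcond; apply: eq_bigr => i _; rewrite inE /F.
    have -> : inZp (i %% g.+1) = inZp i :> 'I_g.+1 by apply: ord_inj; rewrite /= modn_mod.
    by case: (_ \in C).
  rewrite qE sum_mod; congr muln; rewrite -sum1_card [RHS]big_mkcond.
  by apply: eq_bigr => i _; rewrite /F valZpK; case: (i \in C).
have f_inj : injective f.
  move=> C C' /setP CC; apply/setP => c.
  have cN : (c < N)%N.
    by apply: leq_trans (ltn_ord c) _; apply: dvdn_leq => //; apply/dvdnP; exists q.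
  by have := CC (Ordinal cN); rewrite !inE /= valZpK.
have -> : [set A in half_sets | shift A k == A] =
    f @: [set C : {set 'I_g.+1} | #|C|.*2 == g.+1].
  apply/setP => A; rewrite !inE; apply/andP/imsetP => [[cA /(shift_fixedP _ gE)[C AC]]|[C]].
    exists C => //; rewrite inE; move: cA; rewrite AC -/(f C) cf => /eqP cC.
    rewrite -(eqn_pmul2l (m := q)); last by case: (q) qE.
    by rewrite -qE -muln2 mulnA cC muln2 doubleS.
  rewrite inE => /eqP cC ->; split; last by apply/(shift_fixedP _ gE); exists C.
  rewrite cf -(eqn_pmul2r (m := 2)) // -mulnA muln2 cC -qE.
  by rewrite muln2 doubleS.
rewrite card_imset //; case: ifP => od.
  apply/eqP; rewrite cards_eq0; apply/eqP/setP => C; rewrite !inE.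
  by apply/negP => /eqP e; rewrite -e odd_double in od.
have -> : [set C : {set 'I_g.+1} | #|C|.*2 == g.+1] = [set C : {set 'I_g.+1} | #|C| == g.+1./2].
  apply/setP => C; rewrite !inE.
  have half a b : ~~ odd b -> (a.*2 == b) = (a == b./2).
    by move=> /even_halfK {1}<-; rewrite -!muln2 eqn_pmul2r.
  by rewrite half // od.
by rewrite card_draws card_ord.
Qed.

End Rotations.

(** In Burnside's sum only the rotations by even numbers [s.*2] fix balanced
    words. *)
Lemma num_plane_trees_sum n : (0 < n)%N ->
  (n.*2 * num_plane_trees n = \sum_(s < n) 'C((gcdn s n).*2, gcdn s n))%N.
Proof.
case: n => // m _; rewrite doubleS mulnC -burnside.
rewrite (eq_bigr _ (fun k _ => card_fixed k)).
pose F k := if odd (gcdn k m.*2.+2) then 0%N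
  else 'C(gcdn k m.*2.+2, (gcdn k m.*2.+2)./2).
have split2 p : (\sum_(k < p.*2) F k = \sum_(s < p) (F s.*2 + F s.*2.+1))%N.
  elim: p => [|p IH]; first by rewrite !big_ord0.
  by rewrite doubleS !big_ord_recr /= IH addnA.
rewrite -[LHS]/(\sum_(k < m.+1.*2) F k)%N split2; apply: eq_bigr => s _.
have oddF : odd (gcdn s.*2.+1 m.*2.+2).
  have := dvdn_gcdl s.*2.+1 m.*2.+2; move/dvdn_odd => /(_ _) -> //.
  by rewrite /= odd_double.
rewrite /F oddF addn0 -doubleS -!muln2 -muln_gcdl !muln2 odd_double.
by rewrite doubleK.
Qed.

Local Close Scope ring_scope.
Local Open Scope classical_set_scope.
Local Open Scope ring_scope.

(** * The limit *)

Lemma closed_walks_trees n : (0 < n)%N ->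
  count (fun w => bridge w && (n%:Z %| area w)%Z) (words n) = (num_plane_trees n).*2.
Proof.
move=> n0; apply/eqP; rewrite -(eqn_pmul2l n0) closed_walks_count // -num_plane_trees_sum //.
by rewrite -!muln2 mulnAC mulnA.
Qed.

Lemma bin_le_exp2 n k : ('C(n, k) <= 2 ^ n)%N.
Proof.
have [nk|kn] := ltnP n k; first by rewrite bin_small.
rewrite -[2%N]/(1 + 1)%N expnDn (bigD1 (Ordinal (kn : (k < n.+1)%N))) //=.
by rewrite !exp1n !muln1 leq_addr.
Qed.

(** In the sum for [n.*2 * num_plane_trees n] the first term is at most [4 ^ n]
    and each of the others at most [2 ^ n], their divisors being proper. *)
Lemma num_plane_trees_le n : (n * num_plane_trees n <= 4 ^ n)%N.
Proof.
have [->|n0] := posnP n; first by [].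
have h : (n.*2 * num_plane_trees n <= 4 ^ n + n * 2 ^ n)%N.
  rewrite num_plane_trees_sum //; case: n n0 => // n _.
  rewrite big_ord_recl gcd0n; apply: leq_add.
    by apply: leq_trans (bin_le_exp2 _ _) _; rewrite -mul2n expnM.
  apply: (@leq_trans (\sum_(i < n) 2 ^ n.+1)%N); last first.
    by rewrite sum_nat_const card_ord leq_mul2r leqnSn orbT.
  apply: leq_sum => i _; apply: leq_trans (bin_le_exp2 _ _) _.
  rewrite leq_exp2l //; set g := gcdn _ _.
  have /dvdnP[q qE] : (g %| n.+1)%N by exact: dvdn_gcdr.
  have gi : (g <= i.+1)%N by apply: dvdn_leq => //; exact: dvdn_gcdl.
  have := ltn_ord i; case: q qE => [|[|q]] qE; first by lia.
    by move: qE gi; rewrite mul1n; lia.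
  by rewrite qE -mul2n leq_mul2r orbT.
have h2 : (n * 2 ^ n <= 4 ^ n)%N.
  by rewrite -[4%N]/(2 * 2)%N expnMn leq_mul2r ltnW ?orbT // ltn_expl.
rewrite -(leq_pmul2l (m := 2)) // mulnA mul2n; apply: leq_trans h _.
by rewrite mul2n -addnn leq_add2l.
Qed.

Section Main.
Variable R : realType.

Definition scale : fps int -> fps R := fps_map (intr : {rmorphism int -> R}) 4^-1.

Lemma scaleE f n : scale f n = (f n)%:~R / 4 ^+ n.
Proof. by rewrite -exprVn. Qed.

Definition trees_fps : fps R :=
  Fps (fun n => (n != 0%N)%:R * (num_plane_trees n)%:R / 4 ^+ n).

Lemma trees_fps_bound n : 0 <= trees_fps n <= n%:R^-1.
Proof.
have p4 : 0 < 4 ^+ n :> R by apply: exprn_gt0; lra.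
case: n p4 => [|n] p4; first by rewrite /= !mul0r invr0 lexx.
rewrite /= mul1r; apply/andP; split; first by rewrite divr_ge0 ?ler0n // ltW.
rewrite ler_pdivrMr // ler_pdivlMl ?ltr0n //.
by rewrite -natrX -natrM ler_nat num_plane_trees_le.
Qed.

Definition sinai_e (e : int) := scale (ev_fps e sinai_fps).
Definition bridges_e (e : int) := scale (ev_fps e bridges_fps).
Definition first_e (e : int) := 1 - scale (ev_fps e blocks_fps).
Definition log_e (e : int) := scale (ev_log e).

Definition half_log (e : int) : fps R := Fps (fun n => log_e e n / 2).

Lemma bridges_first e : bridges_e e * first_e e = 1.
Proof.
rewrite /bridges_e /first_e /scale -(fps_map1 (intr : {rmorphism int -> R}) 4^-1).
by rewrite -fps_mapB -fps_mapM ev_bridges_blocks fps_map1.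
Qed.

Lemma theta_bridges_e e : theta (bridges_e e) = bridges_e e * log_e e.
Proof. by rewrite /bridges_e /log_e /scale -fps_map_theta theta_ev_bridges fps_mapM. Qed.

Lemma log_e_uniq e k : theta (bridges_e e) = bridges_e e * k -> log_e e = k.
Proof.
move=> bk; have := theta_bridges_e e; rewrite bk => /(congr1 (fun f => first_e e * f)).
by rewrite !mulrA [first_e e * _]mulrC bridges_first !mul1r.
Qed.

(** The symmetric part of the logarithmic derivative is halved, and the bridges
    of area zero contribute the plane trees. *)
Lemma theta_sinai_e e : e * e = 1 ->
  theta (sinai_e e) = sinai_e e * (half_log e + trees_fps).
Proof.
move=> e2; rewrite /sinai_e /scale -fps_map_theta theta_ev_sinai fps_mapM.
congr (_ * _); apply: fpsP => n; rewrite fpsD -/scale.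
rewrite -[half_log e n]/(scale (ev_log e) n / 2) !scaleE -[trees_fps n]/(_ * _ / _).
have /(congr1 (intr : int -> R)) := ev_flen_nonneg e2 n.
have -> : (\sum_(w <- words n | bridge w && (area w == 0)) flen w)%N =
    ((n != 0) * 2 * num_plane_trees n)%N.
  case: n => [|n]; last by rewrite sum_flen_area0 // closed_walks_trees // mul1n mul2n.
  rewrite !mul0n big_seq_cond big1 // => w /andP[+ _].
  by rewrite mem_words => /eqP/size0nil ->; rewrite /flen minn0.
move: (ev_fps e flen_nonneg_fps n) (ev_log e n) => F L.
rewrite !PoszM /= intrM intrD !intrM -!pmulrn => h.
set p := 4 ^+ n; have p0 : p != 0 by rewrite expf_neq0 //; lra.
move: (F%:~R) (L%:~R) ((n != 0%N)%:R) ((num_plane_trees n)%:R) p p0 h => F' L' b T' q q0 h.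
have -> : F' = (L' + b * 2 * T') / 2 by rewrite -h; field.
by field.
Qed.

Lemma bridges_e1 : bridges_e 1 = central R.
Proof.
apply: fpsP => n; rewrite scaleE ev_bridgesE -[central R n]/(_ / _).
congr (_ / _); rewrite -count_bridges -sum1_count pmulrn; congr (_%:~R).
rewrite -[RHS]natz natr_sum; apply: eq_bigr => w _; exact: expr1n.
Qed.

Lemma log_e1 : half_log 1 = quarter_log R.
Proof.
rewrite /half_log; have -> : log_e 1 = Fps (fun n => (n != 0%N)%:R * (1 / 2)).
  by apply: log_e_uniq; rewrite bridges_e1; apply: theta_rising => n; exact: centralS.
by apply: fpsP => n /=; field.
Qed.

Lemma ev_bridges_sign n : (ev_fps (-1) bridges_fps n)%:~R =
  \sum_(w <- words n | bridge w) (-1 : rat) ^ area w.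
Proof.
rewrite ev_bridgesE rmorph_sum; apply: eq_bigr => w _.
rewrite rmorphXn /= rmorphN1 areaE expfzDr // -exprnP exprD; congr (_ * _).
by rewrite -invr_expz -exprnP -exprVn invrN1.
Qed.

Lemma bridges_sign_even d : ev_fps (-1) bridges_fps d.*2 = 'C(d.*2, d)%:Z.
Proof.
by apply/eqP; rewrite -(eqr_int rat) ev_bridges_sign sign_sum_even -pmulrn.
Qed.

Lemma bridges_sign_odd d : ev_fps (-1) bridges_fps d.*2.+1 = (2 * 'C(d.*2, d))%N%:Z.
Proof.
by apply/eqP; rewrite -(eqr_int rat) ev_bridges_sign sign_sum_odd -pmulrn natrM.
Qed.

Lemma bridges_sign_rec n : (n.+2)%:Z * ev_fps (-1) bridges_fps n.+2 =
  4 * n%:Z * ev_fps (-1) bridges_fps n + 2 * ev_fps (-1) bridges_fps n.+1.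
Proof.
have nE := odd_double_half n; move: nE; case: (odd n) => <-; set d := n./2.
  rewrite add1n -doubleS !bridges_sign_odd bridges_sign_even.
  have := central_binS d; move: 'C(_, _) 'C(_, _) => a b; lia.
rewrite add0n -doubleS bridges_sign_odd !bridges_sign_even.
have := central_binS d; move: 'C(_, _) 'C(_, _) => a b; lia.
Qed.

Definition sign_log : fps R := Fps (fun n => (odd n)%:R * 2^-1 ^+ n).

(** Signed by the parity of their areas, the bridges are counted by 1, 2, 2, 4,
    6, 12, 20, and so on, with the square root of [(1 + 2 x) / (1 - 2 x)] as
    generating function; its logarithmic derivative is [2 x / (1 - 4 x ^ 2)]. *)
Lemma log_e_sign : log_e (-1) = sign_log.
Proof.
apply: log_e_uniq; set f := bridges_e (-1).
have frec n : f n.+2 *+ n.+2 = (f n *+ n) / 4 + f n.+1 / 2.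
  rewrite /f /bridges_e !scaleE !exprS -[LHS]mulr_natl -[_ *+ n]mulr_natl.
  have := bridges_sign_rec n.
  move: (ev_fps (-1) bridges_fps n.+2) (ev_fps (-1) bridges_fps n)
    (ev_fps (-1) bridges_fps n.+1) => a b c /(congr1 (intr : int -> R)).
  rewrite intrD !intrM -!pmulrn => h.
  have p0 : 4 ^+ n != 0 :> R by rewrite expf_neq0 //; lra.
  move: h p0; move: (4 ^+ n) => p h p0.
  have -> : n.+2%:R * (a%:~R / (4 * (4 * p))) = n.+2%:R * a%:~R / 16 / p :> R by field.
  by rewrite h; field.
have krec n : sign_log n.+2 = sign_log n / 4.
  by rewrite /= negbK !exprS; move: (2^-1 ^+ n) => p; field.
have fkrec n : (f * sign_log) n.+2 = (f * sign_log) n / 4 + f n.+1 / 2.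
  have k0 : sign_log 0%N = 0 by rewrite /= mul0r.
  have k1 : sign_log 1%N = 1 / 2 by rewrite /=; lra.
  have -> : (f * sign_log) n.+2 = \sum_(i < n.+1) f i * sign_log (n.+2 - i)%N +
      f n.+1 * sign_log 1%N + f n.+2 * sign_log 0%N.
    rewrite fpsM; move: sign_log => g.
    by rewrite 2!big_ord_recr; congr (_ + _ + _ * g _); rewrite ?subnn // subSnn.
  rewrite k0 k1 mulr0 addr0 mul1r; congr (_ + _).
  rewrite fpsM mulr_suml; apply: eq_bigr => i _ /=.
  have im : (i <= n)%N by rewrite -ltnS.
  rewrite -mulrA -[X in _ = _ * X]krec; congr (_ * sign_log _); lia.
apply: fpsP => n; rewrite thetaE.
suff : f n *+ n = (f * sign_log) n /\ f n.+1 *+ n.+1 = (f * sign_log) n.+1 by case.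
elim: n => [|n [IH1 IH2]]; last by split=> //; rewrite frec fkrec IH1.
have k0 : sign_log 0%N = 0 by rewrite /= mul0r.
have k1 : sign_log 1%N = 1 / 2 by rewrite /=; lra.
have f0 : f 0%N = 1.
  have e0 := bridges_sign_even 0; rewrite double0 in e0.
  by rewrite /f /bridges_e scaleE e0 bin0 expr0 divr1.
have f1 : f 1%N = 1 / 2.
  have e1 := bridges_sign_odd 0; rewrite double0 in e1.
  by rewrite /f /bridges_e scaleE e1 bin0 muln1 expr1 -pmulrn; lra.
split; first by rewrite mulr0n fpsM0 k0 mulr0.
have -> : (f * sign_log) 1%N = f 0%N * sign_log 1%N + f 1%N * sign_log 0%N.
  by rewrite fpsM; move: sign_log => g; rewrite big_ord_recr big_ord1.
by rewrite k0 k1 f0 f1 mulr0 addr0 [RHS]mul1r.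
Qed.

Lemma sign_log_bound n : `|half_log (-1) n| <= n%:R^-1 :> R.
Proof.
rewrite /half_log log_e_sign /=; case: n => [|n]; first by rewrite !mul0r normr0 invr0.
rewrite exprVn; set p := 2 ^+ n.+1.
have p1 : n.+1%:R <= p :> R by rewrite /p -natrX ler_nat ltnW // ltn_expl.
have n0 : 0 < n.+1%:R :> R by rewrite ltr0n.
have p0 : 0 < p := lt_le_trans n0 p1.
rewrite ger0_norm; last by rewrite !mulr_ge0 // ?invr_ge0 ?(ltW p0).
apply: (@le_trans _ _ p^-1); last by rewrite lef_pV2.
have pi0 : 0 < p^-1 by rewrite invr_gt0.
by case: (odd _); rewrite ?mul0r ?mul1r; lra.
Qed.

Lemma constant_sinai e : sinai_e e 0%N = 1.
Proof.
by rewrite /sinai_e scaleE expr0 divr1 /ev_fps fps_mapE sinai_fps0 rmorph1 expr0 mulr1.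
Qed.

Lemma constant_bridges e : bridges_e e 0%N = 1.
Proof.
by rewrite /bridges_e scaleE expr0 divr1 /ev_fps fps_mapE bridges_fps0 rmorph1 expr0 mulr1.
Qed.

Definition graphs_seq n : R := (num_graphical n)%:R / 4 ^+ n.

(** Averaging over both signs selects the even areas, and by negation of letters
    the condition on the last letter removes half of the last excursions. *)
Lemma graphs_seqE n : 4 * graphs_seq n.+1 =
  sinai_e 1 n.+1 + (sinai_e 1 * first_e 1) n.+1 +
  sinai_e (-1) n.+1 + (sinai_e (-1) * first_e (-1)) n.+1.
Proof.
have sb e : sinai_e e n.+1 + (sinai_e e * first_e e) n.+1 =
    (2 * sinai_down e n.+1)%:~R / 4 ^+ n.+1.
  rewrite sinai_downE /first_e mulrBr mulr1 fpsB /sinai_e /scale -fps_mapM -/scale !scaleE.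
  rewrite intrB intrM; move: (4 ^+ _)^-1 => p; ring.
rewrite sb -addrA sb /graphs_seq num_graphicalE.
have := count_good n.+1; rewrite -mulrDl.
move: (count _ _) (sinai_down 1 _) (sinai_down (-1) _) (4 ^+ n.+1)^-1 => c x y p.
by move=> /(congr1 (intr : int -> R)); rewrite !intrM intrD -!pmulrn => h; rewrite -mulrDr -h; ring.
Qed.

Lemma cvg_omega_sum : cvgn (series (fps_int trees_fps)).
Proof.
apply: normed_cvg; apply: (small_tau_summable (C := 1)) => n.
by have /andP[t0 t1] := trees_fps_bound n; rewrite mul1r ger0_norm.
Qed.

Lemma omega_partial_sumE n : omega_partial_sum R n = series (fps_int trees_fps) n.+1.
Proof.
pose g k : R := (num_plane_trees k)%:R / (k%:R * 4 ^+ k).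
have -> : series (fps_int trees_fps) n.+1 = \sum_(0 <= k < n.+1) g k.
  apply: eq_bigr => -[|k] _; rewrite /g; first by rewrite mul0r invr0 mulr0 /= invr0 mulr0.
  rewrite -[fps_int _ k.+1]/(1 * (num_plane_trees k.+1)%:R / 4 ^+ k.+1 / k.+1%:R).
  by rewrite mul1r invfM mulrA mulrAC.
by rewrite big_ltn // /g mul0r invr0 mulr0 add0r.
Qed.

End Main.

Theorem theorem1 (R : realType) :
  cvgn (@omega_partial_sum R) /\
  (fun n : nat => n%:R `^ (3 / 4) / 4 ^+ (n - 1) * (num_graphical n)%:R : R)
    @ \oo --> expR (omega R) / Gamma (1 / 4 : R).
Proof.
have oE : @omega_partial_sum R = (fun n => series (fps_int (trees_fps R)) (n + 1)%N).
  by apply/funext => n; rewrite omega_partial_sumE addn1.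
have oc : cvgn (series (fps_int (trees_fps R))) by exact: cvg_omega_sum.
have oc1 : (@omega_partial_sum R) @ \oo --> limn (series (fps_int (trees_fps R))).
  by rewrite oE cvg_shiftn.
have omegaE : omega R = limn (series (fps_int (trees_fps R))) by exact: cvg_lim.
split; first by apply/cvg_ex; eexists; exact: oc1.
have s1 : theta (sinai_e R 1) = sinai_e R 1 * (quarter_log R + trees_fps R).
  by rewrite theta_sinai_e // log_e1.
have sg : theta (sinai_e R (-1)) = sinai_e R (-1) * (half_log R (-1) + trees_fps R).
  by rewrite theta_sinai_e.
have bg : theta (bridges_e R (-1)) = bridges_e R (-1) * (half_log R (-1) + half_log R (-1)).
  rewrite theta_bridges_e; congr (_ * _); apply: fpsP => n.
  by rewrite fpsD /half_log /=; field.
have c1 : central R * first_e R 1 = 1 by rewrite -bridges_e1 bridges_first.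
have := combined_asymptotics (@trees_fps_bound R) (@sign_log_bound R)
  (constant_sinai R 1) s1 c1 (constant_sinai R (-1)) sg (constant_bridges R (-1)) bg
  (bridges_first R (-1)) (@graphs_seqE R).
rewrite -omegaE => lim.
have -> : expR (omega R) / Gamma (1 / 4 : R) = 4 * ((Gamma (1 / 4 : R))^-1 * expR (omega R) / 4).
  by have := Gamma_quarter_gt0 R; move: (Gamma _) => g g0; field; rewrite gt_eqF.
have lim4 : 4 * (n%:R `^ (3 / 4) * graphs_seq R n) @[n --> \oo] -->
    4 * ((Gamma (1 / 4 : R))^-1 * expR (omega R) / 4).
  by apply: cvgM => //; exact: cvg_cst.
apply: cvg_trans lim4; apply: near_eq_cvg.
near=> n; have n0 : (0 < n)%N by near: n; exact: nbhs_infty_gt.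
rewrite /graphs_seq subn1; have -> : 4 ^+ n = 4 * 4 ^+ n.-1 :> R by rewrite -exprS prednK.
have p0 : 4 ^+ n.-1 != 0 :> R by rewrite expf_neq0 // pnatr_eq0.
by move: (4 ^+ n.-1) p0 (_ `^ _) => p p0 x; field.
Unshelve. all: by end_near.
Qed.
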